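(* Let $G$ be a countable discrete group acting by homeomorphisms on a second countable locally compact Hausdorff space $Q$, and let $\mathcal{G}=G\times Q$ be the associated étale transformation groupoid. Then: (i) For each $a\in C^*(\mathrm{IntIso}(\mathcal{G}))$, the map $Q\ni q\mapsto p^{\mathrm{full}}_q(a)\in[0,\infty)$ is continuous. (ii) For each $a\in C^*_{\mathrm{red}}(\mathrm{IntIso}(\mathcal{G}))$, the map $Q\ni q\mapsto p^{\mathbb{E}_{\mathrm{red}}}_q(a)\in[0,\infty)$ is continuous. In particular, every $q\in Q$ is a unit of continuous reduction relative to $\mathbb{E}_{\mathrm{red}}$, i.e. the $C^*$-seminorms $p^{\mathrm{other}}_q$ and $p^{\mathbb{E}_{\mathrm{red}}}_q$ coincide on $C^*_{\mathrm{red}}(\mathrm{IntIso}(\mathcal{G}))$, and thus the $C^*$-norms $\|\cdot\|_{\mathrm{other},q}$ and $\|\cdot\|_{\mathrm{red}}$ coincide on $\mathbb{C}[\mathrm{IntIso}(\mathcal{G})q]=\mathbb{C}[G^\circ_q]$.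
   Context: The transformation groupoid $\mathcal{G}=G\times Q$ has the product topology; $(g_1,q_1)$ and $(g_2,q_2)$ are composable iff $q_1=g_2q_2$, with $(g_1,q_1)(g_2,q_2)=(g_1g_2,q_2)$, and $(g,q)^{-1}=(g^{-1},gq)$. The unit space $\{e\}\times Q$ is identified with $Q$, so $s(g,q)=q$ and $r(g,q)=gq$. For any étale groupoid $\mathcal{H}$ (second countable, locally compact, Hausdorff), $C_c(\mathcal{H})$ is a $*$-algebra under $(f\times k)(\gamma)=\sum_{\alpha\beta=\gamma}f(\alpha)k(\beta)$ and $f^*(\gamma)=\overline{f(\gamma^{-1})}$; $C^*(\mathcal{H})$ is its completion in the norm $\|f\|_{\mathrm{full}}=\sup_\pi\|\pi(f)\|$ over all $*$-representations on Hilbert spaces. Restriction to $\mathcal{H}^{(0)}$ extends to a conditional expectation $\mathbb{E}:C^*(\mathcal{H})\to C_0(\mathcal{H}^{(0)})$; $C^*_{\mathrm{red}}(\mathcal{H})=C^*(\mathcal{H})/\{a:\mathbb{E}(xay)=0\ \forall x,y\}$, and $\mathbb{E}_{\mathrm{red}}:C^*_{\mathrm{red}}(\mathcal{H})\to C_0(\mathcal{H}^{(0)})$ is the induced (faithful) conditional expectation. $\mathrm{IntIso}(\mathcal{G})$ is the interior in $\mathcal{G}$ of $\{\gamma\in\mathcal{G}:r(\gamma)=s(\gamma)\}$; it is an étale groupoid with unit space $Q$ on which $r=s$, and $C_0(Q)$ is central in both $C^*(\mathrm{IntIso}(\mathcal{G}))$ and $C^*_{\mathrm{red}}(\mathrm{IntIso}(\mathcal{G}))$.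 For $q\in Q$, the group $\mathrm{IntIso}(\mathcal{G})q=\mathrm{IntIso}(\mathcal{G})\cap s^{-1}(q)$ is identified, via $(g,q)\mapsto g$, with the interior stabilizer group $G^\circ_q$, the set of $g\in G$ for which there is an open set $V\ni q$ with $gq'=q'$ for all $q'\in V$. For $q\in Q$: $p^{\mathrm{full}}_q(a)=\|a+J^{\mathrm{full}}_q\|$, where $J^{\mathrm{full}}_q$ is the closed two-sided ideal of $C^*(\mathrm{IntIso}(\mathcal{G}))$ generated by $\{f\in C_0(Q):f(q)=0\}$; $p^{\mathrm{other}}_q(a)=\|a+J^{\mathrm{other}}_q\|$, where $J^{\mathrm{other}}_q$ is the closed two-sided ideal of $C^*_{\mathrm{red}}(\mathrm{IntIso}(\mathcal{G}))$ generated by $\{f\in C_0(Q):f(q)=0\}$; and $p^{\mathbb{E}_{\mathrm{red}}}_q(a)$ is the norm of the image of $a\in C^*_{\mathrm{red}}(\mathrm{IntIso}(\mathcal{G}))$ under the GNS representation associated with the state $\mathrm{ev}_q\circ\mathbb{E}_{\mathrm{red}}$ on $C^*_{\mathrm{red}}(\mathrm{IntIso}(\mathcal{G}))$. On $\mathbb{C}[G^\circ_q]$, $\|\cdot\|_{\mathrm{red}}$ is the reduced group $C^*$-norm, and $\|x\|_{\mathrm{other},q}=p^{\mathrm{other}}_q(f)$, where $f\in C_c(\mathrm{IntIso}(\mathcal{G}))$ is any function whose restriction to $\mathrm{IntIso}(\mathcal{G})q\cong G^\circ_q$ equals $x$ (the value is independent of the choice of $f$). *)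

(* Defs.v *)
From HB Require Import structures.
From mathcomp Require Import all_boot all_order all_algebra.
From mathcomp Require Import complex.
From mathcomp Require Import all_classical all_reals all_analysis.

Set Implicit Arguments.
Unset Strict Implicit.
Unset Printing Implicit Defensive.

Import Order.TTheory GRing.Theory Num.Theory.
Import numFieldNormedType.Exports.

Local Open Scope classical_set_scope.
Local Open Scope ring_scope.

(* Norms of vector spaces over R[i] take values in R[i] (they are real and
   nonnegative there); [nrm] is the same number seen in R. *)
Definition nrm (R : realType) (V : normedModType R[i]) (x : V) : R :=
  complex.Re `|x|.

Definition cmod (R : realType) (z : R[i]) : R := nrm (z : R[i]^o).

Record hilbert (R : realType) := Hilbert {
  hilbert_car :> completeNormedModType R[i];
  ip : hilbert_car -> hilbert_car -> R[i];
  ip_linearl : forall a x y z, ip (a *: x + y) z = a * ip x z + ip y z;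
  ip_conj : forall x y, ip y x = Num.conj (ip x y);
  ip_norm : forall x, ip x x = `|x| ^+ 2 }.

Definition opnorm (R : realType) (H : hilbert R) (T : H -> H) : R :=
  sup [set nrm (T x) | x in [set x : H | nrm x <= 1]].

(* C*-algebras, not assumed unital. *)
Record cstarAlg (R : realType) := CstarAlg {
  cstar_car :> completeNormedModType R[i];
  cmul : cstar_car -> cstar_car -> cstar_car;
  cadj : cstar_car -> cstar_car;
  cmulA : forall a b c, cmul a (cmul b c) = cmul (cmul a b) c;
  cmul_linearl : forall (t : R[i]) a b c,
    cmul (t *: a + b) c = t *: cmul a c + cmul b c;
  cmul_linearr : forall (t : R[i]) a b c,
    cmul a (t *: b + c) = t *: cmul a b + cmul a c;
  cmul_norm : forall a b, `|cmul a b| <= `|a| * `|b|;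
  cadjK : forall a, cadj (cadj a) = a;
  cadjM : forall a b, cadj (cmul a b) = cmul (cadj b) (cadj a);
  cadj_antilinear : forall (t : R[i]) a b,
    cadj (t *: a + b) = Num.conj t *: cadj a + cadj b;
  cstar_identity : forall a, `|cmul (cadj a) a| = `|a| ^+ 2 }.

Section Ideals.
Context {R : realType} (A : cstarAlg R).

Definition closed_ideal (I : set A) : Prop :=
  [/\ closed I, I 0,
      (forall (t : R[i]) a b, I a -> I b -> I (t *: a + b)),
      (forall a b, I b -> I (cmul a b))
    & (forall a b, I a -> I (cmul a b))].

Definition quotient_norm (I : set A) (a : A) : R :=
  inf [set nrm (a + j) | j in I].

(* A GNS triple of the positive functional [phi]: the space is the completion
   of A for the form (b, c) |-> phi (c^* b), with canonical map [gns_vec], and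
   A acts by left multiplication.  It is unique up to unitary equivalence. *)
Record gns (phi : A -> R[i]) := Gns {
  gns_hilbert : hilbert R;
  gns_vec : {linear A -> gns_hilbert};
  gns_rep : A -> {linear gns_hilbert -> gns_hilbert};
  gns_vec_ip : forall b c, ip (gns_vec b) (gns_vec c) = phi (cmul (cadj c) b);
  gns_vec_dense : dense (range gns_vec);
  gns_rep_continuous : forall a, continuous (gns_rep a);
  gns_repE : forall a b, gns_rep a (gns_vec b) = gns_vec (cmul a b) }.

End Ideals.

Section GroupNorm.
Context {R : realType} {G : groupType} (Gam : set G).

(* Elements of the group algebra C[Gam] and of l^2(Gam), for a subgroup Gam
   of G, are functions on G that vanish off Gam. *)
Definition group_algebra : set (G -> R[i]) :=
  [set x | finite_set [set g | x g != 0] /\ [set g | x g != 0] `<=` Gam].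

Definition l2sq (xi : G -> R[i]) : \bar R :=
  (\esum_(g in [set: G]) (cmod (xi g) ^+ 2)%:E)%E.

Definition left_regular (x xi : G -> R[i]) (g : G) : R[i] :=
  \sum_(h \in [set: G]) x h * xi (h^-1 * g)%g.

Definition norm_red (x : G -> R[i]) : R :=
  sup [set Num.sqrt (fine (l2sq (left_regular x xi))) |
        xi in [set xi : G -> R[i] |
          (forall g, ~ Gam g -> xi g = 0) /\ (l2sq xi <= 1)%E]].

End GroupNorm.

Section C0.
Context {R : realType} {Q : topologicalType}.

Definition Cc_space : set (Q -> R[i]) :=
  [set h | continuous (h : Q -> R[i]^o) /\ compact (closure [set q | h q != 0])].

Definition C0_space : set (Q -> R[i]) :=
  [set h | continuous (h : Q -> R[i]^o) /\
           forall e : R, 0 < e -> compact [set q | e <= cmod (h q)]].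

End C0.

Notation arrow G Q := (discrete_topology G * Q)%type.

Section Groupoid.
Context {G : groupType} {Q : topologicalType} (act : G -> Q -> Q).

Definition action_by_homeo : Prop :=
  [/\ (forall q, act 1%g q = q),
      (forall g h q, act (g * h)%g q = act g (act h q))
    & (forall g, continuous (act g))].

Definition mk_arrow (g : G) (q : Q) : arrow G Q := (g, q).
Definition lbl (c : arrow G Q) : G := c.1.
Definition src (c : arrow G Q) : Q := c.2.
Definition rng (c : arrow G Q) : Q := act (lbl c) (src c).
Definition composable (a b : arrow G Q) : Prop := src a = rng b.
Definition acomp (a b : arrow G Q) : arrow G Q := mk_arrow (lbl a * lbl b)%g (src b).
Definition ainv (a : arrow G Q) : arrow G Q := mk_arrow (lbl a)^-1%g (rng a).
Definition unit_arrow (q : Q) : arrow G Q := mk_arrow 1%g q.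

Definition IntIso : set (arrow G Q) := interior [set c | rng c = src c].

Definition int_stab (q : Q) : set G :=
  [set g | exists V : set Q,
    [/\ open V, V q & forall q', V q' -> act g q' = q']].

End Groupoid.

Section GroupoidAlgebra.
Context (R : realType) {G : groupType} {Q : topologicalType}.
Variable act : G -> Q -> Q.

Local Notation fn := (arrow G Q -> R[i]).

(* C_c(IntIso), each function being extended by 0 to all arrows (IntIso is
   open, so the extension is still continuous). *)
Definition Cc : set fn :=
  [set f | [/\ continuous (f : arrow G Q -> R[i]^o),
               compact (closure [set c | f c != 0])
             & closure [set c | f c != 0] `<=` IntIso act]].

Definition conv (f k : fn) : fn := fun c =>
  \sum_(p \in [set p : arrow G Q * arrow G Q |
        [/\ IntIso act p.1, IntIso act p.2, composable act p.1 p.2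
          & acomp p.1 p.2 = c]]) f p.1 * k p.2.

Definition invol (f : fn) : fn := fun c => Num.conj (f (ainv act c)).

Definition lincomb (t : R[i]) (f k : fn) : fn := fun c => t * f c + k c.

Definition star_rep (H : hilbert R) (pi : fn -> {linear H -> H}) : Prop :=
  [/\ (forall f, Cc f -> continuous (pi f)),
      (forall t f k x, Cc f -> Cc k ->
         pi (lincomb t f k) x = t *: pi f x + pi k x),
      (forall f k x, Cc f -> Cc k -> pi (conv f k) x = pi f (pi k x))
    & (forall f x y, Cc f -> ip (pi f x) y = ip x (pi (invol f) y))].

Definition full_norm (f : fn) : R :=
  sup [set r | exists (H : hilbert R) (pi : fn -> {linear H -> H}),
         star_rep pi /\ r = opnorm (pi f)].

(* The completion of C_c(IntIso) in the full norm, determined up to a unique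
   isometric *-isomorphism compatible with [full_emb].  Only the values of
   [full_emb] on Cc matter. *)
Record fullCstar := FullCstar {
  full_alg :> cstarAlg R;
  full_emb : fn -> full_alg;
  full_emb_linear : forall t f k, Cc f -> Cc k ->
    full_emb (lincomb t f k) = t *: full_emb f + full_emb k;
  full_embM : forall f k, Cc f -> Cc k ->
    full_emb (conv f k) = cmul (full_emb f) (full_emb k);
  full_embJ : forall f, Cc f -> full_emb (invol f) = cadj (full_emb f);
  full_emb_norm : forall f, Cc f -> nrm (full_emb f) = full_norm f;
  full_emb_dense : dense [set full_emb f | f in Cc] }.

(* The conditional expectation onto C_0(Q), i.e. the unique continuous
   extension of the restriction map f |-> f|_Q. *)
Record condExp (A : fullCstar) := CondExp {
  cexp :> A -> Q -> R[i];
  cexp_C0 : forall a, C0_space (cexp a);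
  cexp_linear : forall t a b q, cexp (t *: a + b) q = t * cexp a q + cexp b q;
  cexp_contractive : forall a q, cmod (cexp a q) <= nrm a;
  cexp_restr : forall f q, Cc f -> cexp (full_emb A f) q = f (unit_arrow q) }.

(* The quotient C*-algebra A / {a | E (x a y) = 0 for all x, y}, together with
   the map [red_exp] induced by E. *)
Record redCstar (A : fullCstar) (E : condExp A) := RedCstar {
  red_alg :> cstarAlg R;
  red_proj : {linear A -> red_alg};
  red_projM : forall a b, red_proj (cmul a b) = cmul (red_proj a) (red_proj b);
  red_projJ : forall a, red_proj (cadj a) = cadj (red_proj a);
  red_proj_surj : forall b, exists a, red_proj a = b;
  red_proj_ker : forall a,
    red_proj a = 0 <-> forall x y q, E (cmul (cmul x a) y) q = 0;
  red_proj_norm : forall a,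
    nrm (red_proj a) = quotient_norm [set k : A | red_proj k = 0] a;
  red_exp : red_alg -> Q -> R[i];
  red_exp_proj : forall a q, red_exp (red_proj a) q = E a q }.

Definition red_emb (A : fullCstar) (E : condExp A) (B : redCstar E) (f : fn) : B :=
  red_proj B (full_emb A f).

Arguments red_emb {A E} B f.

Section Fibre.
Context (X : cstarAlg R) (emb : fn -> X).

Definition extend_units (h : Q -> R[i]) : fn :=
  fun c => if lbl c == 1%g then h (src c) else 0.

(* [a] is the image of [f] under the inclusion of C_0(Q) in X, the continuous
   extension of the inclusion C_c(Q) -> C_c(IntIso) -> X: the pair (f, a) is
   in the closure of the graph of the latter. *)
Definition C0_image (f : Q -> R[i]) (a : X) : Prop :=
  forall e : R, 0 < e -> exists h : Q -> R[i],
    [/\ Cc_space h, (forall q, cmod (f q - h q) <= e)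
      & nrm (a - emb (extend_units h)) <= e].

Definition fibre_ideal (q : Q) : set X :=
  smallest (@closed_ideal R X)
    [set a | exists f, [/\ C0_space f, f q = 0 & C0_image f a]].

Definition p_fibre (q : Q) (a : X) : R := quotient_norm (fibre_ideal q) a.

End Fibre.

Definition p_full (A : fullCstar) (q : Q) (a : A) : R :=
  p_fibre (full_emb A) q a.

Section Reduced.
Context (A : fullCstar) (E : condExp A) (B : redCstar E).

Definition p_other (q : Q) (b : B) : R := p_fibre (red_emb B) q b.

Definition ev_exp (q : Q) (b : B) : R[i] := red_exp b q.

Definition p_Ered (q : Q) (S : gns (ev_exp q)) (b : B) : R :=
  opnorm (gns_rep S b).

Definition fibre_extensions (q : Q) (x : G -> R[i]) : set fn :=
  [set f | Cc f /\
           forall g, IntIso act (mk_arrow g q) -> f (mk_arrow g q) = x g].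

Definition norm_other (q : Q) (x : G -> R[i]) : R :=
  p_other q (red_emb B (xget (fun=> 0) (fibre_extensions q x))).

End Reduced.
End GroupoidAlgebra.

Arguments ev_exp {R G Q act A E} B q b.
Arguments norm_other {R G Q act A E} B q x.

(* Main.v *)
(* Seminorms at different points of [Q] are compared inside the single discrete
   group [G].  A unitary representation [V] of [G] and a point [q] give the
   representation [f |-> sum_g f(g,q) V_g] of the convolution algebra, which
   factors through the fibre at [q] and whose operators move by at most
   [sum_g |f(g,q) - f(g,q0)|] when [q] does.

   (i) The fibre norm of [f] at [q0] is at most the full norm of [u f], for a
   cutoff [u] at [q0] supported in an open set [W] on which the finitely many
   group elements relevant to [f] at [q0] act trivially.  In a representation
   [pi] almost attaining the norm of [u f], each [g] acting trivially on [W] acts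
   by the strong limit of the operators [pi (u_n delta_g)], with [u_n]
   increasing to the indicator function of an open subset of [W]; inducing to
   [G] gives a [V] as above that almost attains the fibre norm at [q0].  Hence
   [|p_q(f) - p_q0(f)| <= sum_g |f(g,q) - f(g,q0)|].

   (ii) The GNS representation at [q] is the left regular representation on
   l^2 of the interior stabilizer; since [G] is a disjoint union of right cosets
   of the latter, its norm equals the norm in the regular representation of [G],
   and continuity follows as in (i).  The direct sum of the GNS representations
   is faithful on the reduced algebra, hence isometric (a contraction in the
   image of a C*-algebra lifts to a contraction, by truncation), so the norm of
   [u f] is [sup_q u(q) p_q(f)].  By continuity this is at most [p_q0(f) + e] for
   a suitable cutoff [u] at [q0], whereas [u f - f] lies in the fibre ideal. *)
From HB Require Import structures.
From mathcomp Require Import all_boot all_order all_algebra.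
From mathcomp Require Import complex finmap.
From mathcomp Require Import all_classical all_reals all_analysis.
From mathcomp Require Import ring lra.
Require Import Defs.
Set Implicit Arguments.
Unset Strict Implicit.
Unset Printing Implicit Defensive.
Import Order.TTheory GRing.Theory Num.Theory.
Import numFieldNormedType.Exports.
Local Open Scope classical_set_scope.
Local Open Scope ring_scope.
Local Open Scope complex_scope.

(** * Norms and Hilbert spaces *)

Local Notation Re := complex.Re.

Section NormBasics.
Context {R : realType}.
Implicit Types (V W : normedModType R[i]) (z t : R[i]) (e : R).

(** The obstacle in (i) is lower semicontinuity: the interior stabilizer at a point near [q0] may be
    larger than the one at [q0], so a representation of the latter group says nothing there.
    Induction removes it. Restricted to the subgroup, an induced representation contains the
    original one as the part carried by the trivial coset, so no norm is lost, and a representation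
    of all of [G] can be evaluated at every point. The strong limits are there because [delta_g] is
    usually not in the algebra: only [h delta_g] is, with [h] compactly supported in the open set
    fixed by [g]. The limit for the neutral element is a projection that may differ from the
    identity, so a representation [V] of [G] means here a multiplicative family with [V g^-1]
    adjoint to [V g]; such operators are still contractions. In (ii), order and positivity are
    handled on vectors. The full norm is a supremum over representations, so inequalities in the
    full algebra reduce to inequalities between inner products, and the positive part used for
    truncation is the limit of an explicit quadratic recursion. *)

Lemma normE V (x : V) : `|x| = (nrm x)%:C.
Proof. by rewrite /nrm RRe_real// normr_real. Qed.

Lemma nrm_ge0 V (x : V) : 0 <= nrm x.
Proof. by rewrite -lecR -normE normr_ge0. Qed.

Lemma cmodE z : `|z| = (cmod z)%:C.
Proof. exact: (@normE R[i]^o). Qed.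

Lemma nrm_le V (x : V) e : (`|x| <= e%:C) = (nrm x <= e).
Proof. by rewrite normE lecR. Qed.

Lemma nrm0 V : nrm (0 : V) = 0.
Proof. by rewrite /nrm normr0. Qed.

Lemma nrm_eq0 V (x : V) : nrm x = 0 -> x = 0.
Proof. by move=> x0; apply/normr0_eq0; rewrite normE x0. Qed.

Lemma nrmN V (x : V) : nrm (- x) = nrm x.
Proof. by rewrite /nrm normrN. Qed.

Lemma nrmBC V (x y : V) : nrm (x - y) = nrm (y - x).
Proof. by rewrite /nrm distrC. Qed.

Lemma nrmD V (x y : V) : nrm (x + y) <= nrm x + nrm y.
Proof. by rewrite -lecR rmorphD /= -!normE ler_normD. Qed.

Lemma nrmB V (x y : V) : nrm (x - y) <= nrm x + nrm y.
Proof. by rewrite (le_trans (nrmD _ _))// nrmN. Qed.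

Lemma nrm_dist V (x y : V) : `|nrm x - nrm y| <= nrm (x - y).
Proof.
rewrite ler_norml; apply/andP; split.
  rewrite lerNl opprB lerBlDr nrmBC (le_trans _ (nrmD _ _))//.
  by rewrite subrK.
by rewrite lerBlDr (le_trans _ (nrmD _ _))// subrK.
Qed.

Lemma nrmZ V z (x : V) : nrm (z *: x) = cmod z * nrm x.
Proof. by apply: complexI; rewrite -normE normrZ rmorphM /= -cmodE -normE. Qed.

Lemma nrm_sum V (I : Type) (r : seq I) (P : pred I) (F : I -> V) :
  nrm (\sum_(i <- r | P i) F i) <= \sum_(i <- r | P i) nrm (F i).
Proof.
elim/big_ind2 : _ => [|x a y b xa yb|//]; first by rewrite nrm0.
exact: le_trans (nrmD _ _) (lerD xa yb).
Qed.

Lemma cmod_ge0 z : 0 <= cmod z. Proof. exact: nrm_ge0. Qed.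
Lemma cmod0 : cmod (0 : R[i]) = 0. Proof. exact: nrm0. Qed.
Lemma cmodM z t : cmod (z * t) = cmod z * cmod t.
Proof. exact: (@nrmZ R[i]^o). Qed.
Lemma cmodD z t : cmod (z + t) <= cmod z + cmod t.
Proof. exact: nrmD. Qed.
Lemma cmodN z : cmod (- z) = cmod z. Proof. exact: nrmN. Qed.
Lemma cmodBC z t : cmod (z - t) = cmod (t - z). Proof. exact: nrmBC. Qed.
Lemma cmod_eq0 z : cmod z = 0 -> z = 0. Proof. exact: nrm_eq0. Qed.

Lemma conjE z : Num.conj z = z^*.
Proof. by []. Qed.

Lemma cmodJ z : cmod (Num.conj z) = cmod z.
Proof. by apply: complexI; rewrite -!cmodE norm_conjC. Qed.

Lemma cmodR (r : R) : cmod r%:C = `|r|.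
Proof. by apply: complexI; rewrite -cmodE normc_def /= expr0n addr0 sqrtr_sqr. Qed.

Lemma cmod1 : cmod (1 : R[i]) = 1.
Proof. by rewrite (_ : 1 = 1%:C)// cmodR normr1. Qed.

Lemma conjR (r : R) : Num.conj r%:C = r%:C :> R[i].
Proof. by rewrite conjE conjc_real. Qed.

Lemma cmod_sqr z : (cmod z ^+ 2)%:C = Num.conj z * z.
Proof. by rewrite rmorphXn /= -cmodE normCKC. Qed.

Lemma Re_le_cmod z : Re z <= cmod z.
Proof.
rewrite -lecR -cmodE (le_trans _ (normc_ge_Re z))//.
by rewrite lecR ler_norm.
Qed.

(** Balls in a normed module over [R[i]] have radii in [R[i]]; the order makes a positive radius
    real, so every epsilon can be taken in [R]. *)
Lemma gt0_complexE z : 0 < z -> z = (Re z)%:C /\ 0 < Re z.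
Proof. by rewrite ltcE /= => /andP[/eqP z0 ->]; split=> //; case: z z0 => a b /= ->. Qed.

Section Filters.
Context {T : Type} {F : set_system T} {FF : Filter F}.

Lemma cvg_nrm V (f : T -> V) (l : V) :
  f @ F --> l <-> forall e, 0 < e -> \forall x \near F, nrm (l - f x) <= e.
Proof.
split=> [/cvgrPdist_le fl e e0|fl].
  have /fl : 0 < e%:C by rewrite ltcR.
  by apply: filterS => x; rewrite nrm_le.
apply/cvgrPdist_le => e /gt0_complexE[-> e0].
by move/fl : e0; apply: filterS => x; rewrite nrm_le.
Qed.

Lemma cvg_real (f : T -> R) (l : R) :
  f @ F --> l <-> forall e, 0 < e -> \forall x \near F, `|l - f x| <= e.
Proof. exact: (iff_trans (cvgrPdist_le _ _)). Qed.

Lemma cvg_nrm_nrm V (f : T -> V) (l : V) : f @ F --> l -> nrm (f x) @[x --> F] --> nrm l.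
Proof.
move=> /cvg_nrm fl; apply/cvgrPdist_le => e e0.
by apply: filterS (fl _ e0) => x; exact/le_trans/nrm_dist.
Qed.
End Filters.

Lemma nbhs_nrm V (x : V) (P : set V) :
  nbhs x P <-> exists2 e, 0 < e & forall y, nrm (x - y) <= e -> P y.
Proof.
split=> [|[e e0 eP]].
  move=> /nbhs_ballP[e /gt0_complexE[eE e0]] eP.
  exists (Re e / 2); first by rewrite divr_gt0.
  move=> y xy; apply: eP; rewrite -ball_normE /= eE normE ltcR.
  by rewrite (le_lt_trans xy)// ltr_pdivrMr// mulr_natr mulr2n ltrDl.
apply/nbhs_ballP; exists e%:C => /=; first by rewrite ltcR.
by move=> y; rewrite -ball_normE /= normE ltcR => /ltW/eP.
Qed.

Lemma nrm_closed V (I : set V) :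
  (forall x, (forall e, 0 < e -> exists2 y, I y & nrm (x - y) <= e) -> I x) ->
  closed I.
Proof.
move=> H x clx; apply: H => e e0.
have [|y [Iy xy]] := clx [set y | nrm (x - y) <= e]; last by exists y.
by apply/nbhs_nrm; exists e.
Qed.

Lemma dense_nrm V (D : set V) : dense D -> forall (x : V) e, 0 < e ->
  exists2 y, D y & nrm (x - y) <= e.
Proof.
move=> dD x e e0; have [||y [Iy xy]] := dD (interior [set y | nrm (x - y) <= e]).
- exists x; apply/nbhs_nrm; exists e => //.
- exact: open_interior.
- by exists y => //; exact: (interior_subset Iy).
Qed.

Lemma cauchy_seq_cvg (V : completeNormedModType R[i]) (u : nat -> V) :
  (forall e, 0 < e -> exists N, forall n m, (N <= n)%N -> (N <= m)%N ->
     nrm (u n - u m) <= e) -> cvg (u n @[n --> \oo]).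
Proof.
move=> H; apply/cauchy_cvgP/cauchy_ballP => e /gt0_complexE[-> e0].
have [N HN] := H (Re e / 2) ltac:(by rewrite divr_gt0).
exists ([set u n | n in [set n | (N <= n)%N]], [set u n | n in [set n | (N <= n)%N]]).
  by split; exists N => // n /= Nn; exists n.
move=> [x y]/= [[n Nn <-] [m Nm <-]].
rewrite -ball_normE /= normE ltcR (le_lt_trans (HN _ _ Nn Nm))//.
by rewrite ltr_pdivrMr// mulr_natr mulr2n ltrDl.
Qed.

Lemma nrm_cvg_le V (u : nat -> V) (l : V) (a : R) :
  u n @[n --> \oo] --> l -> (\forall n \near \oo, nrm (u n) <= a) -> nrm l <= a.
Proof.
move=> /cvg_nrm ul ua; apply/ler_addgt0Pr => e /ul ue.
have [n [/= un un']] := filter_ex (filterI ue ua).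
by rewrite -(subrK (u n) l) (le_trans (nrmD _ _))// addrC lerD.
Qed.

Lemma cvg_unique_nrm V (T : Type) (F : set_system T) (FF : ProperFilter F)
  (f : T -> V) (l m : V) : f @ F --> l -> f @ F --> m -> l = m.
Proof. by move=> fl fm; apply: (cvg_unique _ fl fm). Qed.

Lemma eps_eq0 V (x : V) : (forall e, 0 < e -> nrm x <= e) -> x = 0.
Proof.
move=> H; apply: nrm_eq0; apply/eqP; rewrite eq_le nrm_ge0 andbT.
by apply/ler_addgt0Pr => e e0; rewrite add0r H.
Qed.

Lemma linear_bound V W (f : {linear V -> W}) : continuous f ->
  exists2 C, 0 <= C & forall x, nrm (f x) <= C * nrm x.
Proof.
move=> cf; have /cvg_nrm/(_ _ ltr01)/nbhs_nrm[e e0 He] := cf 0.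
exists e^-1; first by rewrite invr_ge0 ltW.
move=> x; have [x0|x0] := eqVneq (nrm x) 0.
  by rewrite (nrm_eq0 x0) linear0 !nrm0 mulr0.
have xp : 0 < nrm x by rewrite lt_neqAle eq_sym x0 nrm_ge0.
have := He ((e / nrm x)%:C *: x).
rewrite sub0r nrmN nrmZ cmodR ger0_norm ?divr_ge0 ?nrm_ge0 ?(ltW e0)//.
rewrite divfK// => /(_ (lexx _)).
rewrite linear0 sub0r nrmN linearZ /= nrmZ cmodR ger0_norm ?divr_ge0 ?nrm_ge0 ?(ltW e0)//.
by rewrite mulrAC ler_pdivrMr// mul1r -ler_pdivlMl.
Qed.

Lemma bound_continuous V W (f : {linear V -> W}) C :
  (forall x, nrm (f x) <= C * nrm x) -> continuous f.
Proof.
move=> H x; apply/cvg_nrm => e e0.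
have C1 : 0 < `|C| + 1 by rewrite ltr_wpDl.
apply/nbhs_nrm; exists (e / (`|C| + 1)); first by rewrite divr_gt0.
move=> y xy; rewrite -linearB (le_trans (H _))//.
apply: (@le_trans _ _ ((`|C| + 1) * nrm (x - y))).
  by rewrite ler_wpM2r ?nrm_ge0// (le_trans (ler_norm _))// lerDl.
by rewrite mulrC -ler_pdivlMr.
Qed.

End NormBasics.

Section Hilbert.
Context {R : realType}.
Implicit Type H : hilbert R.

Lemma ipDl H (x y z : H) : ip (x + y) z = ip x z + ip y z.
Proof. by rewrite -{1}[x]scale1r ip_linearl mul1r. Qed.
Lemma ip0l H (z : H) : ip 0 z = 0.
Proof. by apply: (addrI (ip 0 z)); rewrite -ipDl !addr0. Qed.
Lemma ipZl H t (x z : H) : ip (t *: x) z = t * ip x z.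
Proof. by rewrite -[t *: x]addr0 ip_linearl ip0l addr0. Qed.
Lemma ipNl H (x z : H) : ip (- x) z = - ip x z.
Proof. by rewrite -scaleN1r ipZl mulN1r. Qed.
Lemma ipBl H (x y z : H) : ip (x - y) z = ip x z - ip y z.
Proof. by rewrite ipDl ipNl. Qed.
Lemma ipDr H (x y z : H) : ip z (x + y) = ip z x + ip z y.
Proof. by rewrite ip_conj ipDl rmorphD /= -!ip_conj. Qed.
Lemma ip0r H (z : H) : ip z 0 = 0.
Proof. by rewrite ip_conj ip0l rmorph0. Qed.
Lemma ipZr H t (x z : H) : ip z (t *: x) = Num.conj t * ip z x.
Proof. by rewrite ip_conj ipZl rmorphM /= -ip_conj. Qed.
Lemma ipNr H (x z : H) : ip z (- x) = - ip z x.
Proof. by rewrite ip_conj ipNl rmorphN /= -ip_conj. Qed.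
Lemma ipBr H (x y z : H) : ip z (x - y) = ip z x - ip z y.
Proof. by rewrite ipDr ipNr. Qed.

Lemma ip_nrm H (x : H) : ip x x = (nrm x ^+ 2)%:C.
Proof. by rewrite ip_norm normE rmorphXn. Qed.

Lemma Re_ip H (x : H) : Re (ip x x) = nrm x ^+ 2.
Proof. by rewrite ip_nrm. Qed.

Lemma CauchySchwarz H (x y : H) : cmod (ip x y) <= nrm x * nrm y.
Proof.
have [y0|y0] := eqVneq (nrm y) 0.
  by rewrite (nrm_eq0 y0) ip0r cmod0 nrm0 mulr0.
have yp : 0 < nrm y by rewrite lt_neqAle eq_sym y0 nrm_ge0.
pose t := ip x y; pose s := (nrm y ^+ 2).
(* Up to the factor [s], this is the squared distance from [x] to its projection on the line of [y],
   scaled so that nothing is divided by [|y|^2]. *)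
have := nrm_ge0 (s%:C *: x - t *: y) => /(exprn_ge0 2).
rewrite -Re_ip ipBl !ipBr !ipZl !ipZr conjR -/t (ip_conj x y) -/t !ip_nrm -/s.
have -> : s%:C * (s%:C * (nrm x ^+ 2)%:C) - s%:C * (Num.conj t * t) -
   (t * (s%:C * Num.conj t) - t * (Num.conj t * s%:C))
   = (s * (s * nrm x ^+ 2 - cmod t ^+ 2))%:C.
  transitivity (s%:C * (s%:C * (nrm x ^+ 2)%:C) - s%:C * (Num.conj t * t)); first by ring.
  by rewrite -cmod_sqr -!rmorphM -rmorphB /= mulrBr.
rewrite /= pmulr_rge0 ?exprn_gt0// subr_ge0 /s -exprMn.
by rewrite ler_pXn2r ?nnegrE ?mulr_ge0 ?nrm_ge0// mulrC.
Qed.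

Lemma Re_ip_le H (x y : H) : Re (ip x y) <= nrm x * nrm y.
Proof. exact: le_trans (Re_le_cmod _) (CauchySchwarz _ _). Qed.

Lemma nrm_sq_le H (x : H) a : 0 <= a -> nrm x ^+ 2 <= a * nrm x -> nrm x <= a.
Proof.
move=> a0; have [->|x0] := eqVneq (nrm x) 0; first by [].
by rewrite expr2 ler_pM2r// lt_neqAle eq_sym x0 nrm_ge0.
Qed.

Lemma ip_cvgl H (u : nat -> H) (l z : H) : u n @[n --> \oo] --> l ->
  (ip (u n) z : R[i]^o) @[n --> \oo] --> (ip l z : R[i]^o).
Proof.
move=> /cvg_nrm ul; apply/cvg_nrm => e e0.
have z1 : 0 < nrm z + 1 by rewrite ltr_wpDl ?nrm_ge0.
have := ul (e / (nrm z + 1)) ltac:(by rewrite divr_gt0).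
apply: filterS => n; rewrite ler_pdivlMr// => un.
rewrite -ipBl (le_trans (CauchySchwarz _ _))// (le_trans _ un)//.
by rewrite ler_wpM2l ?nrm_ge0// lerDl.
Qed.

Lemma opnorm_ub H (T : {linear H -> H}) : continuous T ->
  has_ubound [set nrm (T x) | x in [set x : H | nrm x <= 1]].
Proof.
move=> /linear_bound[C C0 CT]; exists C => _ [x x1 <-].
by rewrite (le_trans (CT x))// ler_piMr.
Qed.

Lemma opnorm_le H (T : {linear H -> H}) (C : R) : 0 <= C ->
  (forall x, nrm (T x) <= C * nrm x) -> opnorm T <= C.
Proof.
move=> C0 HT; apply: ge_sup; first by exists (nrm (T 0)), 0 => //=; rewrite nrm0.
by move=> _ [x x1 <-]; rewrite (le_trans (HT x))// ler_piMr.
Qed.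

Lemma opnorm_ge H (T : {linear H -> H}) x : continuous T -> nrm x <= 1 ->
  nrm (T x) <= opnorm T.
Proof. by move=> cT x1; apply: ub_le_sup; [exact: opnorm_ub|exists x]. Qed.

Lemma opnorm_ge0 H (T : {linear H -> H}) : continuous T -> 0 <= opnorm T.
Proof.
by move=> cT; rewrite (le_trans (nrm_ge0 (T 0)))// opnorm_ge// nrm0.
Qed.

Lemma unit_ball_bound H (T : {linear H -> H}) (C : R) :
  (forall x, nrm x <= 1 -> nrm (T x) <= C) -> forall x, nrm (T x) <= C * nrm x.
Proof.
move=> HT x; have [x0|x0] := eqVneq (nrm x) 0.
  by rewrite (nrm_eq0 x0) linear0 !nrm0 mulr0.
have xp : 0 < nrm x by rewrite lt_neqAle eq_sym x0 nrm_ge0.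
have := HT ((nrm x)^-1%:C *: x); rewrite linearZ /= !nrmZ cmodR ger0_norm ?invr_ge0 ?nrm_ge0//.
by rewrite mulVf// => /(_ (lexx _)); rewrite mulrC ler_pdivrMr.
Qed.

Lemma opnormP H (T : {linear H -> H}) x : continuous T ->
  nrm (T x) <= opnorm T * nrm x.
Proof. by move=> cT; apply: unit_ball_bound => y; exact: opnorm_ge. Qed.

End Hilbert.

(** * Square-summable families *)

Section SquareSummable.
Context {R : realType} {X : choiceType} {H : hilbert R}.
Implicit Types (xi eta : X -> H) (D : {fset X}).

Definition sqsum xi D : R := \sum_(i <- D) nrm (xi i) ^+ 2.
Definition sqsummable : {pred X -> H} :=
  mem [set xi | has_ubound (range (sqsum xi))].
Definition sqnorm xi : R := sup (range (sqsum xi)).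

Lemma sqsummableP xi :
  reflect (exists M, forall D, sqsum xi D <= M) (xi \in sqsummable).
Proof.
apply: (iffP idP) => [/set_mem[M MM]|[M MM]].
  by exists M => D; apply: MM; exists D.
by apply/mem_set; exists M => _ [D _ <-].
Qed.

Lemma sqsum_ge0 xi D : 0 <= sqsum xi D.
Proof. by apply: sumr_ge0 => i _; rewrite exprn_ge0 ?nrm_ge0. Qed.

Lemma sqsum_mono xi D D' : (D `<=` D')%fset -> sqsum xi D <= sqsum xi D'.
Proof.
move=> DD'; rewrite /sqsum [leRHS](big_fsetID _ (mem D))/=.
rewrite (_ : [fset x in D' | x \in D]%fset = D).
  by rewrite lerDl sumr_ge0// => i _; rewrite exprn_ge0 ?nrm_ge0.
apply/fsetP => x; rewrite !inE /=; apply/andP/idP => [[]//|xD].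
by split=> //; exact: (fsubsetP DD').
Qed.

Lemma sqnorm_ub xi D : xi \in sqsummable -> sqsum xi D <= sqnorm xi.
Proof. by move=> /set_mem xiP; apply: ub_le_sup => //; exists D. Qed.

Lemma sqnorm_ge0 xi : xi \in sqsummable -> 0 <= sqnorm xi.
Proof. by move=> xiP; rewrite (le_trans (sqsum_ge0 xi fset0))// sqnorm_ub. Qed.

Lemma sqnorm_le xi M : (forall D, sqsum xi D <= M) -> sqnorm xi <= M.
Proof.
move=> HM; apply: ge_sup; first by exists (sqsum xi fset0), fset0.
by move=> _ [D _ <-].
Qed.

Lemma sqnorm_approx xi e : xi \in sqsummable -> 0 < e ->
  exists D0, forall D, (D0 `<=` D)%fset -> `|sqnorm xi - sqsum xi D| <= e.
Proof.
move=> xiP e0; have [|_ [D0 _ <-] D0P] := @sup_adherent _ (range (sqsum xi)) e e0.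
  by split; [exists (sqsum xi fset0), fset0|exact: set_mem].
exists D0 => D /(sqsum_mono xi) DD; rewrite ger0_norm ?subr_ge0 ?sqnorm_ub//.
by rewrite lerBlDl addrC -lerBlDl (le_trans _ DD)// ltW// -/(sqnorm xi) ltrBlDl addrC -ltrBlDl.
Qed.

Lemma sqsummable_point xi i : xi \in sqsummable -> nrm (xi i) <= Num.sqrt (sqnorm xi).
Proof.
move=> xiP; rewrite -[leLHS]ger0_norm ?nrm_ge0// -sqrtr_sqr ler_sqrt ?sqnorm_ge0//.
rewrite (le_trans _ (sqnorm_ub [fset i]%fset xiP))// /sqsum.
by rewrite big_seq_fset1.
Qed.

(** The difference of the two sides is [(q a - p b)^2 / (p q)]. With [p] and [q] bounding the norms
    of two families, the right side adds up to [(p + q)^2]: this gives the triangle inequality of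
    l^2 without Cauchy-Schwarz for sums. *)
Lemma sq_split (a b p q : R) : 0 < p -> 0 < q ->
  (a + b) ^+ 2 <= (1 + q / p) * a ^+ 2 + (1 + p / q) * b ^+ 2.
Proof.
move=> p0 q0; rewrite -subr_ge0.
rewrite (_ : _ - _ = (p * q)^-1 * (q * a - p * b) ^+ 2).
  by rewrite mulr_ge0 ?sqr_ge0// invr_ge0 mulr_ge0 ?ltW.
by field; rewrite !gt_eqF.
Qed.

Lemma sqsumD xi eta (p q M N : R) D : 0 < p -> 0 < q ->
  sqsum xi D <= M -> sqsum eta D <= N ->
  sqsum (xi + eta) D <= (1 + q / p) * M + (1 + p / q) * N.
Proof.
move=> p0 q0 xM eN.
apply: (@le_trans _ _ ((1 + q / p) * sqsum xi D + (1 + p / q) * sqsum eta D)).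
  rewrite /sqsum !mulr_sumr -big_split /=; apply: ler_sum => i _.
  rewrite (le_trans _ (sq_split _ _ p0 q0))//.
  by rewrite ler_pXn2r ?nnegrE ?addr_ge0 ?nrm_ge0//; exact: nrmD.
by rewrite lerD// ler_wpM2l// addr_ge0// divr_ge0// ltW.
Qed.

Lemma sqsumZ t xi D : sqsum (t *: xi) D = cmod t ^+ 2 * sqsum xi D.
Proof. by rewrite /sqsum mulr_sumr; apply: eq_bigr => i _; rewrite nrmZ exprMn. Qed.

Lemma sqsummable_submod_closed : submod_closed sqsummable.
Proof.
split=> [|t xi eta /sqsummableP[M xM] /sqsummableP[N eN]]; apply/sqsummableP.
  by exists 0 => D; rewrite /sqsum big1// => i _; rewrite nrm0 expr0n.
exists ((1 + 1 / 1) * (cmod t ^+ 2 * M) + (1 + 1 / 1) * N) => D.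
by apply: sqsumD => //; rewrite sqsumZ ler_wpM2l// exprn_ge0// cmod_ge0.
Qed.

HB.instance Definition _ := GRing.isSubmodClosed.Build _ _ sqsummable
  sqsummable_submod_closed.

End SquareSummable.

Arguments sqsummable {R X H}.

Section L2.
Context {R : realType} (X : choiceType) (H : hilbert R).

Record l2 := L2 { l2_fun :> X -> H; _ : l2_fun \in sqsummable }.

HB.instance Definition _ := [isSub for l2_fun].
HB.instance Definition _ := [Choice of l2 by <:].
HB.instance Definition _ := [SubChoice_isSubLmodule of l2 by <:].

Implicit Types xi eta zeta : l2.

Lemma l2P xi : (xi : X -> H) \in sqsummable.
Proof. exact: valP. Qed.

Lemma l2_ext xi eta : (forall i, xi i = eta i) -> xi = eta.
Proof. by move=> xe; apply: val_inj; apply/funext. Qed.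

Lemma l2D xi eta i : (xi + eta) i = xi i + eta i. Proof. by []. Qed.
Lemma l2Z t xi i : (t *: xi) i = t *: xi i. Proof. by []. Qed.
Lemma l2N xi i : (- xi) i = - xi i. Proof. by []. Qed.
Definition l2norm xi : R := Num.sqrt (sqnorm xi).

Lemma l2norm_sq xi : l2norm xi ^+ 2 = sqnorm xi.
Proof. by rewrite sqr_sqrtr// sqnorm_ge0// l2P. Qed.

Lemma l2norm_le xi M : 0 <= M -> (forall D, sqsum xi D <= M ^+ 2) -> l2norm xi <= M.
Proof.
by move=> M0 /sqnorm_le H1; rewrite -[leRHS]ger0_norm// -sqrtr_sqr ler_sqrt// sqr_ge0.
Qed.

Let l2normC xi : R[i] := (l2norm xi)%:C.

Let l2_normD xi eta : l2normC (xi + eta) <= l2normC xi + l2normC eta.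
Proof.
rewrite /l2normC -rmorphD lecR; apply/ler_addgt0Pr => e e0.
(* The margin [e / 2] makes both weights positive, as [sq_split] divides by them. *)
pose p := l2norm xi + e / 2; pose q := l2norm eta + e / 2.
have p0 : 0 < p by rewrite ltr_wpDl ?sqrtr_ge0// divr_gt0.
have q0 : 0 < q by rewrite ltr_wpDl ?sqrtr_ge0// divr_gt0.
rewrite (_ : _ + e = p + q); last by rewrite /p /q; field.
apply: l2norm_le => [|D]; first by rewrite addr_ge0 ?ltW.
rewrite (_ : _ ^+ 2 = (1 + q / p) * p ^+ 2 + (1 + p / q) * q ^+ 2); last first.
  by field; rewrite !gt_eqF.
apply: sqsumD => //.
  rewrite (le_trans (sqnorm_ub _ (l2P xi)))// -l2norm_sq ler_pXn2r ?nnegrE ?sqrtr_ge0 ?ltW//.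
  by rewrite ltrDl divr_gt0.
rewrite (le_trans (sqnorm_ub _ (l2P eta)))// -l2norm_sq ler_pXn2r ?nnegrE ?sqrtr_ge0 ?ltW//.
by rewrite ltrDl divr_gt0.
Qed.

Lemma l2_normZ_le t xi : l2norm (t *: xi) <= cmod t * l2norm xi.
Proof.
apply: l2norm_le => [|D]; first by rewrite mulr_ge0 ?cmod_ge0 ?sqrtr_ge0.
by rewrite sqsumZ exprMn l2norm_sq ler_wpM2l ?exprn_ge0 ?cmod_ge0// sqnorm_ub// l2P.
Qed.

Let l2_normZ t xi : l2normC (t *: xi) = `|t| * l2normC xi.
Proof.
rewrite cmodE /l2normC -rmorphM; congr (_%:C); apply/eqP.
rewrite eq_le l2_normZ_le /=; have [->|t0] := eqVneq t 0.
  by rewrite cmod0 mul0r sqrtr_ge0.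
have tp : 0 < cmod t.
  by rewrite lt_neqAle cmod_ge0 andbT eq_sym; apply: contra t0 => /eqP/cmod_eq0/eqP.
rewrite mulrC -ler_pdivlMr// mulrC (_ : (cmod t)^-1 = cmod t^-1).
  by rewrite (le_trans _ (l2_normZ_le _ _))// scalerA mulVf// scale1r.
by apply: (mulfI (lt0r_neq0 tp)); rewrite -cmodM !divff ?cmod1// gt_eqF.
Qed.

Let l2_norm0 xi : l2normC xi = 0 -> xi = 0.
Proof.
move=> [xi0]; apply: l2_ext => i; apply: nrm_eq0; apply/eqP.
rewrite eq_le nrm_ge0 andbT (le_trans (sqsummable_point i (l2P xi)))//.
by rewrite -/(l2norm xi) xi0.
Qed.

HB.instance Definition _ := @Lmodule_isNormed.Build R[i] l2 l2normC
  l2_normD l2_normZ l2_norm0.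

Lemma l2_nrmE xi : nrm xi = l2norm xi.
Proof. by []. Qed.

Lemma l2_nrm_sq xi : nrm xi ^+ 2 = sqnorm xi.
Proof. by rewrite l2_nrmE l2norm_sq. Qed.

Lemma l2_nrm_le xi M : 0 <= M -> (forall D, sqsum xi D <= M ^+ 2) -> nrm xi <= M.
Proof. exact: l2norm_le. Qed.

Lemma l2_sqsum_le xi D : sqsum xi D <= nrm xi ^+ 2.
Proof. by rewrite l2_nrm_sq sqnorm_ub// l2P. Qed.

Lemma l2_point xi i : nrm (xi i) <= nrm xi.
Proof. exact/sqsummable_point/l2P. Qed.

(** Evaluations are contractive, so a Cauchy filter converges pointwise. The Cauchy bound holds for
    every finite partial sum and passes to the pointwise limit, which gives both square summability
    and convergence in norm. *)
Let l2_complete (F : set_system l2) : ProperFilter F -> cauchy F -> cvg F.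
Proof.
move=> FF /cauchy_ballP Fc.
have Fc' e : 0 < e -> exists2 A, F A & forall xi eta, A xi -> A eta -> nrm (xi - eta) <= e.
  move=> e0; have [[A B]/= [FA FB] AB] := Fc e%:C ltac:(by rewrite ltcR).
  exists (A `&` B); first exact: filterI.
  move=> xi eta [xA _] [_ eB]; have := AB (xi, eta) (conj xA eB).
  by rewrite -ball_normE /= normE ltcR => /ltW.
have ptc i : cvg ((fun xi : l2 => xi i) @ F).
  apply/cauchy_cvgP/cauchy_ballP => e /gt0_complexE[-> e0].
  have [A FA Ae] := Fc' (complex.Re e / 2) ltac:(by rewrite divr_gt0).
  exists ((fun xi : l2 => xi i) @` A, (fun xi : l2 => xi i) @` A).
    by split; apply: (@filterS _ F _ A) => // xi Axi /=; exists xi.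
  move=> [_ _] /= [[xi Axi <-] [eta Aeta <-]].
  rewrite -ball_normE /= normE ltcR.
  have := le_trans (l2_point (xi - eta) i) (Ae _ _ Axi Aeta).
  by rewrite l2D l2N => /le_lt_trans; apply; rewrite ltr_pdivrMr// mulr_natr mulr2n ltrDl.
pose f i : H := lim ((fun xi : l2 => xi i) @ F).
have fcvg i : (fun xi : l2 => xi i) @ F --> f i by exact: ptc.
have near_f e : 0 < e -> exists2 A, F A & forall xi, A xi -> forall D,
    sqsum (f - (xi : X -> H)) D <= e ^+ 2.
  move=> e0; have [A FA Ae] := Fc' e e0; exists A => // xi Axi D.
  have cv : (fun eta : l2 => sqsum ((eta - xi : l2) : X -> H) D) @ F --> sqsum (f - (xi : X -> H)) D.
    rewrite /sqsum; apply: cvg_big => [|i _]; first exact: add_continuous.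
    rewrite !expr2; apply: cvgM; (apply: cvg_nrm_nrm; apply: cvgB; [exact: fcvg|exact: cvg_cst]).
  apply: (closed_cvg (fun y => y <= e ^+ 2)) cv; first exact: closed_le.
  apply: filterS FA => eta Aeta; rewrite (le_trans (l2_sqsum_le _ _))//.
  by rewrite ler_pXn2r ?nnegrE ?nrm_ge0 ?(ltW e0)// Ae.
have fP : f \in sqsummable.
  have [A FA Ae] := near_f 1 ltr01; have [xi Axi] := filter_ex FA.
  rewrite -(subrK (xi : X -> H) f) rpredD ?l2P//.
  by apply/sqsummableP; exists (1 ^+ 2) => D; exact: Ae.
apply/cvg_ex; exists (L2 fP); apply/(@cvg_nrm _ _ _ _ _ id) => e e0.
have [A FA Ae] := near_f e e0; apply: filterS FA => xi Axi.
by apply: l2_nrm_le; [exact: ltW|exact: Ae].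
Qed.

HB.instance Definition _ := Uniform_isComplete.Build l2 l2_complete.

Definition ipD (xi eta : X -> H) (D : {fset X}) : R[i] := \sum_(i <- D) ip (xi i) (eta i).

(** Polarization expresses the inner product by four suprema of nonnegative sums, so no complex
    series has to be summed; [l2ip_approx] recovers it as the limit of the finite sums [ipD]. *)
Definition l2ip xi eta : R[i] := 4%:R^-1 *
  ((sqnorm (xi + eta))%:C - (sqnorm (xi - eta))%:C
   + 'i%C * ((sqnorm (xi + 'i%C *: eta))%:C - (sqnorm (xi - 'i%C *: eta))%:C)).

Lemma ip_polar (x y : H) : ip x y = 4%:R^-1 *
  ((nrm (x + y) ^+ 2)%:C - (nrm (x - y) ^+ 2)%:C
   + 'i%C * ((nrm (x + 'i%C *: y) ^+ 2)%:C - (nrm (x - 'i%C *: y) ^+ 2)%:C)).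
Proof.
rewrite -!ip_nrm !ipDl !ipDr !(ipNl, ipNr) !(ipZl, ipZr).
have -> : Num.conj 'i%C = - 'i%C :> R[i].
  by rewrite conjE; apply/eqP; rewrite eq_complex /= oppr0 !eqxx.
have i2 : 'i%C * 'i%C = -1 :> R[i] by rewrite -expr2 sqr_i.
move: (ip x x) (ip x y) (ip y x) (ip y y) => a b c d.
rewrite (_ : _ - _ + _ = 2%:R * b + 2%:R * c
   - 2%:R * ('i%C * 'i%C) * b + 2%:R * ('i%C * 'i%C) * c); last by ring.
by rewrite i2; field.
Qed.

Lemma l2ip_approx xi eta e : 0 < e -> exists D0, forall D, (D0 `<=` D)%fset ->
  cmod (l2ip xi eta - ipD xi eta D) <= e.
Proof.
move=> e0.
have [D1 H1] := sqnorm_approx (l2P (xi + eta)) e0.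
have [D2 H2] := sqnorm_approx (l2P (xi - eta)) e0.
have [D3 H3] := sqnorm_approx (l2P (xi + 'i%C *: eta)) e0.
have [D4 H4] := sqnorm_approx (l2P (xi - 'i%C *: eta)) e0.
exists (D1 `|` D2 `|` (D3 `|` D4))%fset => D.
rewrite !fsubUset => /andP[/andP[/H1 {}H1 /H2 {}H2] /andP[/H3 {}H3 /H4 {}H4]].
have -> : ipD xi eta D = 4%:R^-1 * ((sqsum (xi + eta) D)%:C - (sqsum (xi - eta) D)%:C
   + 'i%C * ((sqsum (xi + 'i%C *: eta) D)%:C - (sqsum (xi - 'i%C *: eta) D)%:C)).
  rewrite /ipD /sqsum !rmorph_sum -!sumrB mulr_sumr -big_split mulr_sumr /=.
  by apply: eq_bigr => i _; rewrite ip_polar.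
rewrite /l2ip -mulrBr cmodM.
have -> : cmod (4%:R^-1 : R[i]) = 4%:R^-1.
  rewrite (_ : 4%:R^-1 = (4%:R^-1)%:C); last by rewrite fmorphV rmorph_nat.
  by rewrite cmodR ger0_norm// invr_ge0.
rewrite mulrC ler_pdivrMr//.
set a1 := sqnorm _ in H1 *; set a2 := sqnorm _ in H2 *; set a3 := sqnorm _ in H3 *; set a4 := sqnorm _ in H4 *.
set b1 := sqsum _ _ in H1 *; set b2 := sqsum _ _ in H2 *; set b3 := sqsum _ _ in H3 *; set b4 := sqsum _ _ in H4 *.
rewrite (_ : _ - _ = (a1 - b1)%:C + - (a2 - b2)%:C + ('i%C * ((a3 - b3)%:C + - (a4 - b4)%:C))); last first.
  by rewrite !rmorphB /=; ring.
have ci : cmod ('i%C : R[i]) = 1 by apply: complexI; rewrite -cmodE complexiE normCi.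
rewrite mulr_natr (_ : e *+ 4 = e + e + (e + e)); last by rewrite !mulrS mulr0n; ring.
rewrite (le_trans (cmodD _ _))// cmodM ci mul1r.
by rewrite lerD// (le_trans (cmodD _ _))// cmodN !cmodR lerD.
Qed.

Lemma fset_common (P Q : {fset X} -> Prop) :
  (exists D0, forall D, (D0 `<=` D)%fset -> P D) ->
  (exists D0, forall D, (D0 `<=` D)%fset -> Q D) ->
  exists D0, forall D, (D0 `<=` D)%fset -> P D /\ Q D.
Proof.
move=> [D1 H1] [D2 H2]; exists (D1 `|` D2)%fset => D.
by rewrite fsubUset => /andP[/H1 ? /H2].
Qed.

Let l2ip_linear t xi eta zeta :
  l2ip (t *: xi + eta) zeta = t * l2ip xi zeta + l2ip eta zeta.
Proof.
apply/eqP; rewrite -subr_eq0; apply/eqP; apply: (@eps_eq0 R R[i]^o) => e e0.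
pose d := e / (cmod t + 2).
have t2 : 0 < cmod t + 2 by rewrite ltr_wpDl ?cmod_ge0.
have d0 : 0 < d by rewrite divr_gt0.
have [D HD] := fset_common (l2ip_approx (t *: xi + eta) zeta d0)
  (fset_common (l2ip_approx xi zeta d0) (l2ip_approx eta zeta d0)).
have [H1 [H2 H3]] := HD D (fsubset_refl D).
have E : ipD (t *: xi + eta) zeta D = t * ipD xi zeta D + ipD eta zeta D.
  by rewrite /ipD mulr_sumr -big_split; apply: eq_bigr => i _ /=; rewrite ip_linearl.
move: H1 H2 H3; rewrite -/(cmod _) E.
move: (l2ip (t *: xi + eta) zeta) (l2ip xi zeta) (l2ip eta zeta)
  (ipD xi zeta D) (ipD eta zeta D) => u1 u2 u3 u4 u5 H1 H2 H3.
rewrite (_ : _ - _ = (u1 - (t * u4 + u5)) + (- (t * (u2 - u4)) + - (u3 - u5))); last by ring.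
rewrite (_ : e = d + (cmod t * d + d)); last by rewrite /d; field; rewrite gt_eqF.
rewrite (le_trans (cmodD _ _))// lerD// (le_trans (cmodD _ _))// !cmodN cmodM lerD//.
by rewrite ler_wpM2l// cmod_ge0.
Qed.

Let l2ip_conj xi eta : l2ip eta xi = Num.conj (l2ip xi eta).
Proof.
apply/eqP; rewrite -subr_eq0; apply/eqP; apply: (@eps_eq0 R R[i]^o) => e e0.
have d0 : 0 < e / 2 by rewrite divr_gt0.
have [D HD] := fset_common (l2ip_approx eta xi d0) (l2ip_approx xi eta d0).
have [H1 H2] := HD D (fsubset_refl D).
have E : ipD eta xi D = Num.conj (ipD xi eta D).
  by rewrite /ipD rmorph_sum /=; apply: eq_bigr => i _; rewrite ip_conj.
rewrite -/(cmod _) (_ : _ - _ = (l2ip eta xi - ipD eta xi D)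
  + - (Num.conj (l2ip xi eta - ipD xi eta D))); last first.
  by rewrite E rmorphB opprB addrA subrK.
by rewrite [leRHS]splitr (le_trans (cmodD _ _))// cmodN cmodJ lerD.
Qed.

Let l2ip_norm xi : l2ip xi xi = `|xi| ^+ 2.
Proof.
rewrite normE -rmorphXn /= l2_nrm_sq.
apply/eqP; rewrite -subr_eq0; apply/eqP; apply: (@eps_eq0 R R[i]^o) => e e0.
have d0 : 0 < e / 2 by rewrite divr_gt0.
have [D HD] := fset_common (l2ip_approx xi xi d0) (sqnorm_approx (l2P xi) d0).
have [H1 H2] := HD D (fsubset_refl D).
have E : ipD xi xi D = (sqsum xi D)%:C.
  by rewrite /ipD rmorph_sum /=; apply: eq_bigr => i _; rewrite ip_nrm.
rewrite -/(cmod _) (_ : _ - _ = (l2ip xi xi - ipD xi xi D)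
  + - (sqnorm xi - sqsum xi D)%:C); last first.
  by rewrite E rmorphB opprB addrA subrK.
by rewrite [leRHS]splitr (le_trans (cmodD _ _))// cmodN cmodR lerD.
Qed.

Definition l2_hilbert : hilbert R := @Hilbert R l2 l2ip l2ip_linear l2ip_conj l2ip_norm.

End L2.

(** * Cutoff functions *)

Section CompactSupport.
Context {R : realType} {Q : topologicalType}.
Implicit Types (K O : set Q) (h k : Q -> R[i]).

(** If [P K] failed, the sets [A] with [P (K minus A)] would form a proper filter containing [K]. At
    a cluster point of it in [K], a neighbourhood satisfying [P] has its complement in the filter,
    which is absurd. *)
Lemma compact_ind (X : topologicalType) (K : set X) (P : set (set X)) :
  compact K -> P set0 -> (forall A B, P A -> P B -> P (A `|` B)) ->
  (forall A B, A `<=` B -> P B -> P A) ->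
  (forall x, K x -> exists2 U, nbhs x U & P U) -> P K.
Proof.
move=> cK P0 PU PS Ploc; apply: contrapT => nPK.
pose F : set_system X := [set A | P (K `\` A)].
have FF : ProperFilter F.
  apply: Build_ProperFilter_ex => [A FA|].
    apply: contrapT => A0; apply: nPK; apply: PS FA => x Kx; split=> // Ax.
    by apply: A0; exists x.
  split=> [|A B FA FB|A B AB FA].
  - by apply: PS P0 => x [_ /(_ I)].
  - apply: PS (PU _ _ FA FB) => x [Kx nAB].
    have [Ax|nAx] := pselect (A x); last by left.
    by right; split=> // Bx; apply: nAB.
  - by apply: PS FA => x [Kx nB]; split=> // /AB.
have [|x [Kx clx]] := cK F FF; first by apply: PS P0 => x [].
have [U Ux PUx] := Ploc x Kx.
have [|y [nUy Uy]] := clx (~` U) U _ Ux; last exact: nUy.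
by apply: PS PUx => y [_ /contrapT].
Qed.

Lemma continuousC h : continuous (h : Q -> R[i]^o) <->
  forall q e, 0 < e -> \forall q' \near q, cmod (h q - h q') <= e.
Proof.
split=> [ch q e e0|H q]; first by have /cvg_nrm := ch q; exact.
by apply/cvg_nrm; exact: H.
Qed.

(** Support is measured by any compact subset of [O] outside of which [h] vanishes, so sums and
    products need no closure of a support; [ccin_Cc] relates this to [Cc_space]. *)
Definition ccin O h := continuous (h : Q -> R[i]^o) /\
  exists K, [/\ compact K, K `<=` O & forall q, h q != 0 -> K q].

Lemma ccin_mono O O' h : O `<=` O' -> ccin O h -> ccin O' h.
Proof.
by move=> OO [ch [K [cK KO hK]]]; split=> //; exists K; split=> //; exact: subset_trans OO.
Qed.

Lemma ccin_sub O h k : ccin O h -> continuous (k : Q -> R[i]^o) ->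
  (forall q, h q = 0 -> k q = 0) -> ccin O k.
Proof.
move=> [ch [K [cK KO hK]]] ck hk; split=> //; exists K; split=> // q.
by move=> kq; apply: hK; apply: contra kq => /eqP/hk ->.
Qed.

Lemma continuousCD h k : continuous (h : Q -> R[i]^o) -> continuous (k : Q -> R[i]^o) ->
  continuous ((fun q => h q + k q) : Q -> R[i]^o).
Proof. by move=> ch ck q; apply: cvgD; [exact: ch|exact: ck]. Qed.

Lemma continuousCM h k : continuous (h : Q -> R[i]^o) -> continuous (k : Q -> R[i]^o) ->
  continuous ((fun q => h q * k q) : Q -> R[i]^o).
Proof. by move=> ch ck q; apply: cvgM; [exact: ch|exact: ck]. Qed.

Lemma continuousC_cst (z : R[i]) : continuous ((fun=> z) : Q -> R[i]^o).
Proof. by move=> q; exact: cvg_cst. Qed.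

Lemma continuousCJ h : continuous (h : Q -> R[i]^o) ->
  continuous ((fun q => Num.conj (h q)) : Q -> R[i]^o).
Proof.
move=> /continuousC ch; apply/continuousC => q e /ch-/(_ q).
by apply: filterS => q'; rewrite -rmorphB cmodJ.
Qed.

Lemma continuousC_real (u : Q -> R) : continuous u ->
  continuous ((fun q => (u q)%:C) : Q -> R[i]^o).
Proof.
move=> cu; apply/continuousC => q e e0; have /cvg_real/(_ e e0) := cu q.
by apply: filterS => q' ; rewrite -rmorphB cmodR.
Qed.

Lemma continuous_cmod h : continuous (h : Q -> R[i]^o) -> continuous (fun q => cmod (h q)).
Proof. by move=> ch q; apply: (@cvg_nrm_nrm _ _ _ _ R[i]^o); exact: ch. Qed.

Lemma ccinD O h k : ccin O h -> ccin O k -> ccin O (fun q => h q + k q).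
Proof.
move=> [ch [K [cK KO hK]]] [ck [L [cL LO kL]]]; split; first exact: continuousCD.
exists (K `|` L); split; [exact: compactU|by rewrite subUset|].
move=> q; have [h0|/hK] := eqVneq (h q) 0; last by left.
by rewrite h0 add0r => /kL; right.
Qed.

Lemma ccinMl O h k : ccin O h -> continuous (k : Q -> R[i]^o) -> ccin O (fun q => k q * h q).
Proof.
by move=> hO ck; apply: (ccin_sub hO) => [|q ->]; [exact: continuousCM ck hO.1|rewrite mulr0].
Qed.

Lemma ccinJ O h : ccin O h -> ccin O (fun q => Num.conj (h q)).
Proof.
by move=> hO; apply: (ccin_sub hO) => [|q ->]; [exact: continuousCJ hO.1|rewrite rmorph0].
Qed.

Lemma ccin0 O : ccin O (fun=> 0).
Proof.
split; first exact: continuousC_cst.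
by exists set0; split=> [||q]; [exact: compact0|by []|rewrite eqxx].
Qed.

Lemma ccin_bounded O h : ccin O h -> exists2 M, 0 <= M & forall q, cmod (h q) <= M.
Proof.
move=> [/continuousC ch [K [cK KO hK]]].
pose P : set (set Q) := [set U | exists2 M, 0 <= M & forall q, U q -> cmod (h q) <= M].
have [|A B [M M0 HM] [N N0 HN]|A B AB [M M0 HM]|q Kq|M M0 HM] :=
    compact_ind (P := P) cK.
- by exists 0.
- by exists (M + N) => [|q [/HM|/HN] le]; rewrite ?addr_ge0// (le_trans le)// ?lerDl ?lerDr.
- by exists M => // q /AB/HM.
- exists [set q' | cmod (h q - h q') <= 1]; first exact: ch.
  exists (cmod (h q) + 1) => [|q' /=]; first by rewrite addr_ge0 ?cmod_ge0.
  rewrite cmodBC -{2}(subrK (h q) (h q')) => le.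
  by rewrite (le_trans (cmodD _ _))// addrC lerD.
- exists M => // q; have [->|/hK/HM//] := eqVneq (h q) 0.
  by rewrite cmod0.
Qed.

Section LCH.
Hypotheses (lcQ : locally_compact [set: Q]) (hQ : hausdorff_space Q).

Lemma ccin_Cc h : Cc_space h <-> ccin setT h.
Proof.
split=> [[ch cK]|[ch [K [cK _ hK]]]]; split=> //.
  by exists (closure [set q | h q != 0]); split=> // q hq; exact: subset_closure.
have clK := compact_closed hQ cK; apply: subclosed_compact cK _; first exact: closed_closure.
rewrite [X in _ `<=` X](closure_id K).1//.
exact: closureS.
Qed.

Definition cutoff O (u : Q -> R) := [/\ continuous u, (forall q, 0 <= u q <= 1) &
  ccin O (fun q => (u q)%:C)].

Lemma cutoff_point O q : open O -> O q -> exists2 u, cutoff O u & u q = 1.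
Proof.
move=> oO Oq.
have [U Uq cU] : exists2 U, nbhs q U & compact (closure U).
  have := lcQ I (x := q); rewrite withinET => -[U Uq [cU clU]].
  by exists U => //; rewrite -(closure_id U).1.
pose O' := O `&` interior U.
have oO' : open O' by apply: openI => //; exact: open_interior.
have [f [cf f01 fq fO]] : exists f : Q -> R, [/\ continuous f, range f `<=` `[0, 1],
    f @` [set q] `<=` [set 0] & f @` (~` O') `<=` [set 1]].
  apply/uniform_separatorP/(@locally_compact_completely_regular Q R lcQ hQ).
    exact: open_closedC.
  by apply; split.
have {}fq : f q = 0 by apply: fq; exists q.
(* [f] is 0 at the point and 1 off [O']. Hence [u] lives on the closed set [f <= 1/2], which lies
   inside [O'], and so inside [O] and the compact closure of [U]. *)
pose u q := Num.max 0 (1 - 2 * f q).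
have cu : continuous u.
  move=> x; apply: (@continuous_max R Q (fun=> 0) (fun x => 1 - 2 * f x) x); first exact: cvg_cst.
  by apply: cvgB; [exact: cvg_cst|apply: cvgM; [exact: cvg_cst|exact: cf]].
have f0 x : 0 <= f x by have := f01 _ (ex_intro2 _ _ x I erefl); rewrite /= in_itv /= => /andP[].
exists u; last by rewrite /u fq mulr0 subr0 max_r.
split=> //.
  by move=> x; rewrite /u le_max lexx /= ge_max ler01 /= gerBl mulr_ge0.
split; first exact: continuousC_real.
exists [set x | f x <= 1 / 2]; split.
- apply: subclosed_compact cU _.
    by apply: (@closed_comp _ _ f [set y | y <= 1 / 2]) => [x _|]; [exact: cf|exact: closed_le].
  move=> x /= fx; apply: subset_closure.
  have [[_ /interior_subset//]|nO] := pselect (O' x).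
  by move: fx; rewrite (fO (f x)); [lra|exists x].
- move=> x /= fx; have [[]//|nO] := pselect (O' x).
  by move: fx; rewrite (fO (f x)); [lra|exists x].
- move=> x; apply: contra_neqP => /negP; rewrite -ltNge => fx; rewrite /u max_l//.
  lra.
Qed.

Lemma cutoff_compact O K : open O -> compact K -> K `<=` O ->
  exists2 u, cutoff O u & forall q, K q -> u q = 1.
Proof.
move=> oO cK KO.
(* Asking for [1 <= w] instead of [w = 1] makes the property stable under unions, by addition; the
   bound [1] is restored by a minimum at the end. *)
pose P : set (set Q) := [set U | exists w : Q -> R, [/\ continuous w,
   (forall q, 0 <= w q), ccin O (fun q => (w q)%:C) & forall q, (U `&` K) q -> 1 <= w q]].
have [|||q Kq|w [cw w0 wO w1]] := compact_ind (P := P) cK.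
- exists (fun=> 0); split=> //; [by move=> q; exact: cvg_cst|exact: ccin0|by move=> q []].
- move=> A B [w [cw w0 wO w1]] [v [cv v0 vO v1]]; exists (fun q => w q + v q); split.
  + by move=> q; apply: cvgD; [exact: cw|exact: cv].
  + by move=> q; rewrite addr_ge0.
  + rewrite (_ : (fun _ => _) = fun q => (w q)%:C + (v q)%:C); first exact: ccinD.
    by apply/funext => q; rewrite rmorphD.
  + by move=> q [[Aq|Bq] Kq]; [rewrite ler_wpDr// w1|rewrite ler_wpDl// v1].
- move=> A B AB [w [cw w0 wO w1]]; exists w; split=> // q [/AB Bq Kq]; exact: w1.
- have [u [cu u01 uO] uq] := cutoff_point oO (KO _ Kq).
  exists [set x | 1 / 2 < u x].
    by apply: (cvgr_gt (u q) (cu q)); rewrite uq; lra.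
  exists (fun x => 2 * u x); split.
  + by move=> x; apply: cvgM; [exact: cvg_cst|exact: cu].
  + by move=> x; rewrite mulr_ge0//; case/andP: (u01 x).
  + rewrite (_ : (fun _ => _) = fun q => (2%:C : R[i]) * (u q)%:C).
      by apply: ccinMl => //; exact: continuousC_cst.
    by apply/funext => x; rewrite rmorphM.
  + by move=> x [/= ux _]; lra.
- have cm : continuous (fun q => Num.min 1 (w q)).
    by move=> q; apply: (@continuous_min R Q (fun=> 1) w q); [exact: cvg_cst|exact: cw].
  exists (fun q => Num.min 1 (w q)); last first.
    by move=> q Kq; rewrite min_l// w1.
  split=> //.
    by move=> q; rewrite le_min ler01 w0 /= ge_min lexx.
  apply: (ccin_sub wO); first exact: continuousC_real.
  by move=> q [->]; rewrite min_r.
Qed.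

Lemma cutoff_ccin O h : open O -> ccin O h ->
  exists2 u, cutoff O u & forall q, h q != 0 -> u q = 1.
Proof.
move=> oO [ch [K [cK KO hK]]]; have [u uO u1] := cutoff_compact oO cK KO.
by exists u => // q /hK/u1.
Qed.

End LCH.
End CompactSupport.

(** * The convolution algebra of the interior of the isotropy *)

Section GroupoidFunctions.
Context {R : realType} {G : groupType} {Q : topologicalType} (act : G -> Q -> Q).
Hypotheses (lcQ : locally_compact [set: Q]) (hQ : hausdorff_space Q)
  (act_homeo : action_by_homeo act).

Local Notation fn := (arrow G Q -> R[i]).
Implicit Types (f k : fn) (g : G) (q : Q) (F : {fset G}).

(** [IntIso] is the disjoint union of the open sets [{g} x fixint g]. Hence a function in [Cc]
    amounts to finitely many slices, the one at [g] compactly supported in [fixint g]: this is the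
    content of [Cc_intro], [Cc_slice] and [Cc_supp]. *)
Definition fixint g : set Q := [set q | int_stab act q g].

Lemma act1 q : act 1%g q = q. Proof. by case: act_homeo. Qed.
Lemma actM g h q : act (g * h)%g q = act g (act h q). Proof. by case: act_homeo. Qed.

Lemma stab_act q g : int_stab act q g -> act g q = q.
Proof. by move=> [V [_ Vq ->]]. Qed.

Lemma stab1 q : int_stab act q 1%g.
Proof. by exists setT; split=> [||q' _]; [exact: openT| |exact: act1]. Qed.

Lemma act_fixV g q : act g q = q -> act g^-1%g q = q.
Proof. by move=> gq; rewrite -{1}gq -actM mulVg act1. Qed.

Lemma stabV q g : int_stab act q g -> int_stab act q g^-1%g.
Proof.
move=> [V [oV Vq HV]]; exists V; split=> // q' Vq'.
exact/act_fixV/HV.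
Qed.

Lemma stabM q g h : int_stab act q g -> int_stab act q h -> int_stab act q (g * h)%g.
Proof.
move=> [V [oV Vq HV]] [W [oW Wq HW]]; exists (V `&` W); split=> //; first exact: openI.
by move=> q' [Vq' Wq']; rewrite actM HW// HV.
Qed.

Lemma open_fixint g : open (fixint g).
Proof.
rewrite openE => q [V [oV Vq HV]]; rewrite /interior /= nbhsE; exists V => // q' Vq'.
by exists V.
Qed.

Lemma nbhs_arrow g q (A : set (arrow G Q)) :
  nbhs (mk_arrow g q) A <-> nbhs q [set q' | A (mk_arrow g q')].
Proof.
split=> [[[U V]/= [Ug Vq] UV]|Aq].
  apply: filterS Vq => q' Vq'; apply: UV; split=> //=.
  exact: (nbhs_singleton Ug).
exists ([set g : discrete_topology G], [set q' | A (mk_arrow g q')]) => /=.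
  by split=> //; exact: discrete_set1.
by move=> [g' q'] [/= -> Aq'].
Qed.

Lemma IntIsoE c : IntIso act c <-> int_stab act (src c) (lbl c).
Proof.
case: c => g q; rewrite /IntIso /interior /= nbhs_arrow /rng /= nbhsE /=; split.
  by move=> [V [oV Vq] VV]; exists V; split=> // q' /VV.
by move=> [V [oV Vq VV]]; exists V => // q' /VV.
Qed.

Definition suppF F f := forall g q, g \notin F -> f (mk_arrow g q) = 0.

Lemma Cc_intro f F : suppF F f ->
  (forall g, ccin (fixint g) (fun q => f (mk_arrow g q))) -> Cc act f.
Proof.
move=> fF fg.
pose K g := projT1 (cid (fg g).2).
have KP g : [/\ compact (K g), K g `<=` fixint g & forall q, f (mk_arrow g q) != 0 -> K g q].
  exact: (projT2 (cid (fg g).2)).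
pose L := \big[setU/set0]_(g <- F) (mk_arrow g @` K g).
have cL : compact L.
  apply: bigsetU_compact => g _; apply: continuous_compact; last by have [] := KP g.
  apply: continuous_subspaceT => q A /=; rewrite nbhs_arrow; exact.
have Lmem g q : L (mk_arrow g q) <-> g \in F /\ K g q.
  rewrite /L -bigcup_seq; split=> [[g' /= g'F [q' Kq' [<- <-]]]//|[gF Kq]].
  by exists g => //; exists q.
have clL : closed L.
  move=> [g q] clq; have [gF|gF] := boolP (g \in F); last first.
    have [|[g' q'] [/Lmem[g'F _] /= gg]] := clq [set c | lbl c = g].
      by rewrite nbhs_arrow; apply: filterS filterT.
    by rewrite -gg /lbl /= g'F in gF.
  apply/Lmem; split=> //; have [cK _ _] := KP g.
  apply: (compact_closed hQ cK) => B Bq.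
  have [|[g' q'] [/Lmem[g'F Kq'] /= [gg Bq']]] := clq [set c | lbl c = g /\ B (src c)].
    by rewrite nbhs_arrow; apply: filterS Bq => x Bx; split.
  by exists q'; split=> //; rewrite -gg.
have sL : closure [set c | f c != 0] `<=` L.
  rewrite [X in _ `<=` X](closure_id L).1//; apply: closureS => -[g q] /= fgq.
  apply/Lmem; split; last by have [_ _] := KP g; apply.
  by apply: contraR fgq => gF; rewrite fF.
split.
- move=> [g q] A /(fg g).1 Aq.
  by apply/(nbhs_arrow g q).
- by apply: subclosed_compact cL _; first exact: closed_closure.
- apply: subset_trans sL _ => -[g q] /Lmem[_ Kq]; apply/IntIsoE.
  by have [_ + _] := KP g; apply.
Qed.

Lemma Cc_slice f g : Cc act f -> ccin (fixint g) (fun q => f (mk_arrow g q)).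
Proof.
move=> [cf cK fI]; split.
  by move=> q A /cf/nbhs_arrow.
exists [set q | closure [set c | f c != 0] (mk_arrow g q)]; split.
- apply: (@subclosed_compact _ _ (snd @` closure [set c | f c != 0])).
  + have : closed (closure [set c | f c != 0]) by exact: closed_closure.
    move=> clK q Hq; apply: clK => B /nbhs_arrow/Hq[q' [/= Kq' Bq']].
    by exists (mk_arrow g q').
  + apply: continuous_compact cK; apply: continuous_subspaceT => -[a b].
    exact: cvg_snd.
  + by move=> q Kq; exists (mk_arrow g q).
- by move=> q /fI/IntIsoE.
- by move=> q fq; apply: subset_closure.
Qed.

(** The support is compact and [G] is discrete, so its projection to [G] is finite. *)
Lemma Cc_supp f : Cc act f -> exists F, suppF F f.
Proof.
move=> [cf cK fI].
have fin : finite_set (lbl @` closure [set c | f c != 0]).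
  apply: (compact_ind (P := fun A => finite_set (lbl @` A)) cK).
  - by rewrite image_set0.
  - by move=> A B fA fB; rewrite image_setU finite_setU.
  - by move=> A B AB; apply/sub_finite_set/image_subset.
  - move=> [g q] _; exists [set c | lbl c = g].
      by rewrite nbhs_arrow; apply: filterS filterT.
    by apply: (@sub_finite_set _ _ [set g]) => // _ [c /= <- <-].
exists (fset_set (lbl @` closure [set c | f c != 0])) => g q.
rewrite in_fset_set// => /negP nfg; apply/eqP/negPn/negP => fgq; apply: nfg.
by rewrite inE; exists (mk_arrow g q) => //; exact: subset_closure.
Qed.

Lemma Cc_stab f g q : Cc act f -> f (mk_arrow g q) != 0 -> int_stab act q g.
Proof.
move=> /Cc_slice-/(_ g)[_ [K [_ KO hK]]] fgq.
by apply: KO; exact: hK.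
Qed.

Lemma Cc_nstab f g q : Cc act f -> ~ int_stab act q g -> f (mk_arrow g q) = 0.
Proof. by move=> Cf ns; apply/eqP/negPn/negP => /(Cc_stab Cf). Qed.

Lemma suppF_mono F F' f : {subset F <= F'} -> suppF F f -> suppF F' f.
Proof. by move=> FF fF g q gF; apply: fF; apply: contra gF => /FF. Qed.

Lemma Cc_supp2 f k : Cc act f -> Cc act k -> exists F, suppF F f /\ suppF F k.
Proof.
move=> /Cc_supp[F fF] /Cc_supp[F' kF]; exists (F `|` F')%fset; split.
  by apply: suppF_mono fF => x xF; rewrite inE xF.
by apply: suppF_mono kF => x xF; rewrite inE xF orbT.
Qed.

Definition sgl g (h : Q -> R[i]) : fn := fun c => if lbl c == g then h (src c) else 0.

Lemma sglE g h g' q : sgl g h (mk_arrow g' q) = if g' == g then h q else 0.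
Proof. by []. Qed.

Lemma Cc_sgl g h : ccin (fixint g) h -> Cc act (sgl g h).
Proof.
move=> hg; apply: (@Cc_intro _ [fset g]%fset) => [g' q|g'].
  by rewrite inE sglE => /negPf ->.
have [->|gg] := eqVneq g' g.
  by rewrite (_ : (fun _ => _) = h)//; apply/funext => q; rewrite sglE eqxx.
rewrite (_ : (fun _ => _) = fun=> 0); first exact: ccin0.
by apply/funext => q; rewrite sglE (negPf gg).
Qed.

Lemma extend_unitsE (h : Q -> R[i]) : extend_units h = sgl 1%g h.
Proof. by []. Qed.

Lemma fixint1 : fixint 1%g = setT.
Proof. by apply/seteqP; split=> // q _; exact: stab1. Qed.

Lemma Cc_units (h : Q -> R[i]) : Cc_space h -> Cc act (extend_units h).
Proof. by move=> /(ccin_Cc hQ) hQQ; rewrite extend_unitsE; apply: Cc_sgl; rewrite fixint1. Qed.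

Lemma Cc0 : Cc act (fun=> 0 : R[i]).
Proof. by apply: (@Cc_intro _ fset0) => // g; exact: ccin0. Qed.

Lemma Cc_lincomb t f k : Cc act f -> Cc act k -> Cc act (lincomb t f k).
Proof.
move=> Cf Ck; have [F [fF kF]] := Cc_supp2 Cf Ck.
apply: (@Cc_intro _ F) => [g q gF|g]; first by rewrite /lincomb fF// kF// mulr0 addr0.
apply: ccinD; last exact: Cc_slice.
by apply: ccinMl; [exact: Cc_slice|exact: continuousC_cst].
Qed.

Lemma ccinM O O' (h k : Q -> R[i]) : ccin O h -> ccin O' k ->
  ccin (O `&` O') (fun q => h q * k q).
Proof.
move=> [ch [K [cK KO hK]]] [ck [L [cL LO kL]]]; split; first exact: continuousCM.
exists (K `&` L); split.
- by apply: compact_closedI => //; exact: compact_closed.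
- by move=> q [/KO ? /LO].
- by move=> q; rewrite mulf_eq0 negb_or => /andP[/hK ? /kL].
Qed.

Lemma ccin_sum O (I : Type) (r : seq I) (h : I -> Q -> R[i]) :
  (forall i, ccin O (h i)) -> ccin O (fun q => \sum_(i <- r) h i q).
Proof.
move=> hO; elim: r => [|i r IH].
  by rewrite (_ : (fun _ => _) = fun=> 0); [exact: ccin0|apply/funext => q; rewrite big_nil].
rewrite (_ : (fun _ => _) = fun q => h i q + \sum_(i <- r) h i q).
  exact: ccinD.
by apply/funext => q; rewrite big_cons.
Qed.

(** On [IntIso] range and source agree, so both factors of an arrow over [q] lie over [q], and the
    convolution is that of the group algebra. The two index sets are compared inside their union:
    the pairs missing from one of them contribute 0, because [f] and [k] vanish off [IntIso] and [f]
    vanishes off [F]. *)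
Lemma convE f k F g q : Cc act f -> Cc act k -> suppF F f ->
  Defs.conv act f k (mk_arrow g q) =
  \sum_(h <- F) f (mk_arrow h q) * k (mk_arrow (h^-1 * g)%g q).
Proof.
move=> Cf Ck fF; rewrite /Defs.conv.
set P := [set p | _]; pose phi h := (mk_arrow h q, mk_arrow (h^-1 * g)%g q).
pose D := P `|` phi @` [set` F].
rewrite (@fsbig_widen _ _ _ _ P D); first last.
- move=> [[h1 q1] [h2 q2]] /= [+ nP]; case=> [//|[h hF [e1 e2 e3 e4]]]; subst h1 q1 h2 q2.
  apply/eqP/negPn/negP => /= nz; apply: nP; move: nz; rewrite mulf_eq0 negb_or.
  move=> /andP[/(Cc_stab Cf) sh /(Cc_stab Ck) sk]; split.
  + exact/IntIsoE.
  + exact/IntIsoE.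
  + by rewrite /composable /rng /src /lbl /= (stab_act sk).
  + by rewrite /acomp /lbl /src /= mulVKg.
- by move=> p Pp; left.
rewrite -(@fsbig_widen _ _ _ _ (phi @` [set` F]) D); first last.
- move=> [[h1 q1] [h2 q2]] /= [+ nP]; case=> [[/= _ /IntIsoE sh2]|//].
  rewrite /composable /acomp /rng /src /lbl /= in sh2 *; move=> e1 [e2 e3].
  subst q2 g; rewrite (stab_act sh2) in e1; subst q1.
  rewrite (_ : f _ = 0) ?mul0r//; have [hF|hF] := boolP (h1 \in F); last exact: fF.
  by exfalso; apply: nP; exists h1 => //; rewrite /phi mulKg.
- by move=> p Pp; right.
rewrite fsbig_image; last by move=> h h' _ _ [].
by rewrite fsbig_finite//= set_fsetK.
Qed.

Lemma Cc_conv f k : Cc act f -> Cc act k -> Cc act (Defs.conv act f k).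
Proof.
move=> Cf Ck; have [F [fF kF]] := Cc_supp2 Cf Ck.
apply: (@Cc_intro _ [fset (x * y)%g | x in F, y in F]%fset) => [g q gF|g].
  rewrite (convE _ _ Cf Ck fF) big_seq big1// => h hF.
  rewrite [k _]kF ?mulr0//; apply: contra gF => hg.
  by apply/imfset2P; exists h => //; exists (h^-1 * g)%g => //; rewrite mulVKg.
rewrite (_ : (fun _ => _) = fun q => \sum_(h <- F) f (mk_arrow h q) * k (mk_arrow (h^-1 * g)%g q)).
  apply: ccin_sum => h; apply: (@ccin_mono _ _ (fixint h `&` fixint (h^-1 * g)%g)).
    by move=> q [/= sh sg]; rewrite /fixint /= -(mulVKg h g); apply: stabM.
  by apply: ccinM; exact: Cc_slice.
by apply/funext => q; exact: convE.
Qed.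

(** By definition [f] is evaluated at [(g^-1, g q)]. Either [g] fixes [q], or both [(g^-1, g q)] and
    [(g^-1, q)] lie outside [IntIso], where [f] vanishes. *)
Lemma involE f g q : Cc act f ->
  invol act f (mk_arrow g q) = Num.conj (f (mk_arrow g^-1%g q)).
Proof.
move=> Cf; rewrite /invol /ainv /rng /= /src /lbl /=; congr Num.conj.
have [sg|nsg] := pselect (int_stab act q g); first by rewrite (stab_act sg).
rewrite (Cc_nstab (q := q) Cf); last by move=> /stabV; rewrite invgK.
apply: (Cc_nstab Cf) => /[dup] /stab_act + s; rewrite -actM mulVg act1 => gq.
by apply: nsg; move/stabV: s; rewrite invgK -gq.
Qed.

Lemma Cc_invol f : Cc act f -> Cc act (invol act f).
Proof.
move=> Cf; have [F fF] := Cc_supp Cf.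
apply: (@Cc_intro _ [fset x^-1%g | x in F]%fset) => [g q gF|g].
  rewrite involE// fF ?rmorph0//; apply: contra gF => gF.
  by apply/imfsetP; exists g^-1%g => //; rewrite invgK.
rewrite (_ : (fun _ => _) = fun q => Num.conj (f (mk_arrow g^-1%g q))).
  apply: ccinJ; apply: ccin_mono (Cc_slice _ Cf) => q /stabV.
  by rewrite invgK.
by apply/funext => q; exact: involE.
Qed.

Lemma fn_ext f k : (forall g q, f (mk_arrow g q) = k (mk_arrow g q)) -> f = k.
Proof. by move=> fk; apply/funext => -[g q]; exact: fk. Qed.

Lemma suppF_sgl g h : suppF [fset g]%fset (sgl g h).
Proof. by move=> g' q; rewrite inE sglE => /negPf ->. Qed.

Lemma conv_sgll g h k : ccin (fixint g) h -> Cc act k ->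
  Defs.conv act (sgl g h) k = fun c => h (src c) * k (mk_arrow (g^-1 * lbl c)%g (src c)).
Proof.
move=> hg Ck; apply: fn_ext => g' q.
by rewrite (convE _ _ (Cc_sgl hg) Ck (@suppF_sgl g h)) big_seq_fset1 sglE eqxx.
Qed.

Lemma conv_sgl g g' h h' : ccin (fixint g) h -> ccin (fixint g') h' ->
  Defs.conv act (sgl g h) (sgl g' h') = sgl (g * g')%g (fun q => h q * h' q).
Proof.
move=> hg hg'; rewrite conv_sgll//; last exact: Cc_sgl.
apply: fn_ext => x q; rewrite !sglE /lbl /src /=.
by rewrite -(inj_eq (mulgI g)) mulVKg; case: ifP; rewrite ?mulr0.
Qed.

Lemma invol_sgl g h : ccin (fixint g) h ->
  invol act (sgl g h) = sgl g^-1%g (fun q => Num.conj (h q)).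
Proof.
move=> hg; apply: fn_ext => x q; rewrite involE; last exact: Cc_sgl.
by rewrite !sglE -(inj_eq (@invg_inj G)) invgK; case: ifP; rewrite ?rmorph0.
Qed.

Lemma sgl_decomp f F : Cc act f -> suppF F f ->
  f = fun c => \sum_(g <- F) sgl g (fun q => f (mk_arrow g q)) c.
Proof.
move=> Cf fF; apply: fn_ext => g q; under eq_bigr do rewrite sglE.
have [gF|gF] := boolP (g \in F).
  rewrite (big_fsetD1 g gF) /= eqxx big_seq big1 ?addr0// => h.
  by rewrite !inE eq_sym => /andP[/negPf ->].
rewrite fF// big_seq big1// => h hF; case: ifP => // /eqP gh.
by rewrite -gh (negPf gF) in hF.
Qed.

(** * Representations of the convolution algebra and finiteness of the full norm *)

Section SumRep.
Variables (H : hilbert R) (pi : fn -> {linear H -> H}).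
Hypothesis piP : star_rep act pi.

Lemma rep_lin t f k x : Cc act f -> Cc act k -> pi (lincomb t f k) x = t *: pi f x + pi k x.
Proof. by case: piP => _ + _ _; apply. Qed.

Lemma repM f k x : Cc act f -> Cc act k -> pi (Defs.conv act f k) x = pi f (pi k x).
Proof. by case: piP => _ _ + _; apply. Qed.

Lemma rep_adj f x y : Cc act f -> ip (pi f x) y = ip x (pi (invol act f) y).
Proof. by case: piP => _ _ _; apply. Qed.

Lemma rep0 x : pi (fun=> 0) x = 0.
Proof.
have := rep_lin 1 x Cc0 Cc0; rewrite scale1r (_ : lincomb _ _ _ = fun=> 0).
  by move=> e; apply: (addrI (pi (fun=> 0) x)); rewrite addr0 -e.
by apply/funext => c; rewrite /lincomb mulr0 addr0.
Qed.

Lemma repD f k x : Cc act f -> Cc act k -> pi (fun c => f c + k c) x = pi f x + pi k x.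
Proof.
move=> Cf Ck; rewrite -[pi f x]scale1r -rep_lin//; congr (pi _ x).
by apply/funext => c; rewrite /lincomb mul1r.
Qed.

Lemma repZ t f x : Cc act f -> pi (fun c => t * f c) x = t *: pi f x.
Proof.
move=> Cf; rewrite -[t *: _]addr0 -(rep0 x) -rep_lin//; last exact: Cc0.
by congr (pi _ x); apply/funext => c; rewrite /lincomb addr0.
Qed.

Lemma Cc_sum (I : Type) (r : seq I) (f : I -> fn) :
  (forall i, Cc act (f i)) -> Cc act (fun c => \sum_(i <- r) f i c).
Proof.
move=> Cf; elim: r => [|i r IH].
  by rewrite (_ : (fun _ => _) = fun=> 0); [exact: Cc0|apply/funext => c; rewrite big_nil].
rewrite (_ : (fun _ => _) = lincomb 1 (f i) (fun c => \sum_(i <- r) f i c)).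
  exact: Cc_lincomb.
by apply/funext => c; rewrite big_cons /lincomb mul1r.
Qed.

Lemma rep_sum (I : Type) (r : seq I) (f : I -> fn) x : (forall i, Cc act (f i)) ->
  pi (fun c => \sum_(i <- r) f i c) x = \sum_(i <- r) pi (f i) x.
Proof.
move=> Cf; elim: r => [|i r IH].
  rewrite big_nil (_ : (fun _ => _) = fun=> 0) ?rep0//.
  by apply/funext => c; rewrite big_nil.
rewrite big_cons -IH -repD//; last exact: Cc_sum.
by congr (pi _ x); apply/funext => c; rewrite big_cons.
Qed.

Lemma ccin_fix1 O (h : Q -> R[i]) : ccin O h -> ccin (fixint 1%g) h.
Proof. by apply: ccin_mono => q _; exact: stab1. Qed.

Lemma rep_square f x : Cc act f ->
  ip (pi (Defs.conv act (invol act f) f) x) x = ip (pi f x) (pi f x).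
Proof.
move=> Cf; rewrite repM//; last exact: Cc_invol.
by rewrite ip_conj -rep_adj// ip_nrm conjR.
Qed.

Lemma rep_units_pos (w : Q -> R) x : ccin setT (fun q => (w q)%:C) ->
  continuous w -> (forall q, 0 <= w q) -> 0 <= complex.Re (ip (pi (sgl 1%g (fun q => (w q)%:C)) x) x).
Proof.
move=> wc cw w0; pose s q := (Num.sqrt (w q))%:C.
have sc : ccin (fixint 1%g) s.
  apply: (@ccin_sub _ _ _ (fun q => (w q)%:C)); first exact: ccin_fix1 wc.
    apply: continuousC_real => q; apply: continuous_comp; first exact: cw.
    exact: sqrt_continuous.
  by move=> q [wq]; rewrite /s wq sqrtr0.
have -> : sgl 1%g (fun q => (w q)%:C) = Defs.conv act (invol act (sgl 1%g s)) (sgl 1%g s).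
  rewrite invol_sgl// invg1 conv_sgl//; last exact: ccinJ.
  rewrite mulg1; congr (sgl _); apply/funext => q.
  by rewrite /s conjR -rmorphM /= -expr2 sqr_sqrtr.
have Cs := Cc_sgl sc; have Cs' := Cc_invol Cs.
by rewrite rep_square// ip_nrm /= exprn_ge0// nrm_ge0.
Qed.

Lemma sgl_lin t g (h k : Q -> R[i]) : sgl g (fun q => t * h q + k q) = lincomb t (sgl g h) (sgl g k).
Proof.
apply: fn_ext => x q; rewrite /lincomb !sglE.
by case: ifP => // _; rewrite mulr0 addr0.
Qed.

Lemma rep_sgl_lin t g (h k : Q -> R[i]) x : ccin (fixint g) h -> ccin (fixint g) k ->
  pi (sgl g (fun q => t * h q + k q)) x = t *: pi (sgl g h) x + pi (sgl g k) x.
Proof. by move=> hg kg; rewrite sgl_lin rep_lin//; exact: Cc_sgl. Qed.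

(* If [c v - w] is nonnegative, so is [pi (c v - w)], being the square of
   [pi (sqrt (c v - w))]. *)
Lemma rep_units_mono (v w : Q -> R) (c : R) x :
  ccin setT (fun q => (v q)%:C) -> ccin setT (fun q => (w q)%:C) ->
  continuous v -> continuous w -> (forall q, w q <= c * v q) ->
  complex.Re (ip (pi (sgl 1%g (fun q => (w q)%:C)) x) x) <=
  c * complex.Re (ip (pi (sgl 1%g (fun q => (v q)%:C)) x) x).
Proof.
move=> vc wc cv cw wv.
have E : (fun q => (c * v q - w q)%:C) = (fun q => c%:C * (v q)%:C + - (w q)%:C).
  by apply/funext => q; rewrite rmorphB rmorphM.
have Nw : ccin setT (fun q => - (w q)%:C).
  rewrite (_ : (fun _ => _) = fun q => (-1) * (w q)%:C).
    by apply: ccinMl => //; exact: continuousC_cst.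
  by apply/funext => q; rewrite mulN1r.
have : 0 <= complex.Re (ip (pi (sgl 1%g (fun q => (c * v q - w q)%:C)) x) x).
  apply: rep_units_pos.
  - by rewrite E; apply: ccinD => //; apply: ccinMl => //; exact: continuousC_cst.
  - by move=> q; apply: cvgB; [apply: cvgM; [exact: cvg_cst|exact: cv]|exact: cw].
  - by move=> q; rewrite subr_ge0.
have -> : (fun q => (c * v q - w q)%:C) = (fun q => (-1) * (w q)%:C + (c%:C * (v q)%:C + 0)).
  by apply/funext => q; rewrite rmorphB rmorphM /= mulN1r addr0 addrC.
have v1 := ccin_fix1 vc; have w1 := ccin_fix1 wc.
have cv0 : ccin (fixint 1%g) (fun q => c%:C * (v q)%:C + 0).
  by apply: ccinD; [apply: ccinMl => //; exact: continuousC_cst|exact: ccin0].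
rewrite (rep_sgl_lin (-1) x w1 cv0) (rep_sgl_lin c%:C x v1 (ccin0 _)).
rewrite scaleN1r (_ : pi (sgl 1%g (fun=> 0)) x = 0); last first.
  rewrite -[RHS](rep0 x); congr (pi _ x); apply: fn_ext => y q.
  by rewrite sglE if_same.
rewrite addr0 ipDl ipNl ipZl.
move: (ip _ _) (ip _ _) => [a a'] [b b'] /=; lra.
Qed.

(** From [w^2 <= w] follows [|pi(w) x|^2 <= <pi(w) x, x> <= |pi(w) x| |x|], and one factor
    cancels. *)
Lemma rep_units_le1 (w : Q -> R) x : cutoff setT w ->
  nrm (pi (sgl 1%g (fun q => (w q)%:C)) x) <= nrm x.
Proof.
move=> [cw w01 wc]; apply: nrm_sq_le; first exact: nrm_ge0.
have w1 := ccin_fix1 wc.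
rewrite -Re_ip -rep_square; last exact: Cc_sgl.
rewrite invol_sgl// conv_sgl//; last by rewrite invg1; exact: ccinJ.
rewrite invg1 mulg1.
rewrite (_ : (fun _ => _) = fun q => (w q * w q)%:C); last first.
  by apply/funext => q; rewrite conjR rmorphM.
apply: (le_trans (@rep_units_mono w (fun q => w q * w q) 1 x _ _ _ _ _)) => //.
- rewrite (_ : (fun _ => _) = fun q => (w q)%:C * (w q)%:C).
    by apply: ccinMl => //; case: wc.
  by apply/funext => q; rewrite rmorphM.
- by move=> q; apply: cvgM; exact: cw.
- by move=> q; have /andP[? ?] := w01 q; rewrite mul1r ler_piMr.
by rewrite mul1r mulrC Re_ip_le.
Qed.

(** [h delta_g] times its adjoint on the left is the function [|h|^2] on units, at most [M^2 w^2]
    for a cutoff [w] equal to 1 where [h] is nonzero. The cutoff replaces the constant 1, which need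
    not have compact support. *)
Lemma rep_sgl_le g h M x : ccin (fixint g) h -> 0 <= M -> (forall q, cmod (h q) <= M) ->
  nrm (pi (sgl g h) x) <= M * nrm x.
Proof.
move=> hg M0 hM.
have [w [cw w01 wc] w1] := cutoff_ccin lcQ hQ (@openT Q) (ccin_mono (@subsetT _ _) hg).
have w1' := ccin_fix1 wc.
apply: (@le_trans _ _ (M * nrm (pi (sgl 1%g (fun q => (w q)%:C)) x))); last first.
  by rewrite ler_wpM2l// rep_units_le1.
rewrite -(@ler_pXn2r _ 2)// ?nnegrE ?mulr_ge0 ?nrm_ge0// exprMn -!Re_ip -!rep_square; [|exact: Cc_sgl..].
rewrite !invol_sgl// !conv_sgl//; first last.
- by apply: ccinJ; apply: ccin_mono hg => q; exact: stabV.
- by rewrite invg1; exact: ccinJ.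
rewrite !mulVg.
rewrite (_ : (fun q => Num.conj (h q) * h q) = fun q => (cmod (h q) ^+ 2)%:C); last first.
  by apply/funext => q; rewrite cmod_sqr.
rewrite (_ : (fun q => Num.conj (w q)%:C * _) = fun q => (w q * w q)%:C); last first.
  by apply/funext => q; rewrite conjR rmorphM.
apply: rep_units_mono.
- rewrite (_ : (fun _ => _) = fun q => (w q)%:C * (w q)%:C).
    by apply: ccinMl => //; case: wc.
  by apply/funext => q; rewrite rmorphM.
- rewrite (_ : (fun _ => _) = fun q => Num.conj (h q) * h q).
    apply: ccinMl; first exact: ccin_mono (@subsetT _ _) hg.
    exact/continuousCJ/hg.1.
  by apply/funext => q; rewrite cmod_sqr.
- by move=> q; apply: cvgM; exact: cw.
- have ch := continuous_cmod hg.1.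
  by move=> q; rewrite /=; apply: cvgM; exact: ch.
- move=> q; have [->|hq] := eqVneq (h q) 0.
    by rewrite cmod0 expr0n mulr_ge0 ?exprn_ge0// mulr_ge0//; case/andP: (w01 q).
  by rewrite w1// !mulr1 ler_pXn2r// nnegrE// cmod_ge0.
Qed.

End SumRep.

(** The sum of the sup norms of the slices bounds [f] in all representations at once, so the
    supremum defining [full_norm] is over a bounded set and is a genuine least upper bound. *)
Lemma full_norm_bound f : Cc act f -> exists2 C, 0 <= C &
  forall (H : hilbert R) (pi : fn -> {linear H -> H}), star_rep act pi ->
  forall x, nrm (pi f x) <= C * nrm x.
Proof.
move=> Cf; have [F fF] := Cc_supp Cf.
have bnd g : exists2 M, 0 <= M & forall q, cmod (f (mk_arrow g q)) <= M.
  by apply: ccin_bounded; exact: Cc_slice.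
pose M g := projT1 (cid2 (bnd g)).
have M0 g : 0 <= M g by rewrite /M; case: cid2.
have MP g q : cmod (f (mk_arrow g q)) <= M g by rewrite /M; case: cid2.
exists (\sum_(g <- F) M g) => [|H pi piP x]; first by rewrite sumr_ge0.
rewrite (sgl_decomp Cf fF) (rep_sum piP); last by move=> g; apply/Cc_sgl/Cc_slice.
rewrite (le_trans (nrm_sum _ _ _))// mulr_suml; apply: ler_sum => g _.
by apply: rep_sgl_le => //; exact: Cc_slice.
Qed.

Lemma rep_full_norm f (H : hilbert R) (pi : fn -> {linear H -> H}) x :
  Cc act f -> star_rep act pi -> nrm (pi f x) <= full_norm act f * nrm x.
Proof.
move=> Cf piP; have [cpi _ _ _] := piP.
apply: (le_trans (opnormP x (cpi _ Cf))).
rewrite ler_wpM2r ?nrm_ge0//; apply: ub_le_sup; last by exists H, pi.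
have [C C0 HC] := full_norm_bound Cf.
exists C => _ [H' [pi' [pi'P ->]]]; apply: opnorm_le => //; exact: HC.
Qed.

Lemma full_norm_le f C : Cc act f -> 0 <= C ->
  (forall (H : hilbert R) (pi : fn -> {linear H -> H}), star_rep act pi ->
    forall x, nrm (pi f x) <= C * nrm x) -> full_norm act f <= C.
Proof.
move=> Cf C0 HC; rewrite /full_norm; set S := [set r | _].
have [[r Sr]|S0] := pselect (exists r, S r).
  apply: ge_sup; first by exists r.
  by move=> _ [H [pi [piP ->]]]; apply: opnorm_le => //; exact: HC.
(* The supremum of the empty set is 0 by convention, which is below [C]. *)
rewrite (_ : S = set0) ?sup0//.
by apply/seteqP; split=> // r Sr; apply: S0; exists r.
Qed.

Lemma full_norm_approx f e : Cc act f -> 0 < e -> 0 < full_norm act f ->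
  exists (H : hilbert R) (pi : fn -> {linear H -> H}) (x : H),
  [/\ star_rep act pi, nrm x <= 1 & full_norm act f - e <= nrm (pi f x)].
Proof.
move=> Cf e0 f0; apply: contrapT => nex.
(* The maximum with 0 gives an admissible bound for [full_norm_le]; it is strictly below the norm
   because the norm is positive. *)
have : full_norm act f <= Num.max 0 (full_norm act f - e).
  apply: full_norm_le => //; first by rewrite le_max lexx.
  move=> H pi piP; apply: unit_ball_bound => x x1; rewrite le_max; apply/orP; right.
  have [//|lt] := leP (nrm (pi f x)) (full_norm act f - e).
  by exfalso; apply: nex; exists H, pi, x; split=> //; exact: ltW.
by apply/negP; rewrite -ltNge gt_max f0 gtrDl oppr_lt0.
Qed.

End GroupoidFunctions.

(** * Truncation in C*-algebras *)

Section CstarBasics.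
Context {R : realType}.
Implicit Types (A : cstarAlg R) (H : hilbert R).

Lemma cmulDl A (a b c : A) : cmul (a + b) c = cmul a c + cmul b c.
Proof. by rewrite -{1}[a]scale1r cmul_linearl scale1r. Qed.
Lemma cmulDr A (a b c : A) : cmul c (a + b) = cmul c a + cmul c b.
Proof. by rewrite -{1}[a]scale1r cmul_linearr scale1r. Qed.
Lemma cmul0l A (c : A) : cmul 0 c = 0.
Proof. by apply: (addrI (cmul 0 c)); rewrite -cmulDl !addr0. Qed.
Lemma cmul0r A (c : A) : cmul c 0 = 0.
Proof. by apply: (addrI (cmul c 0)); rewrite -cmulDr !addr0. Qed.
Lemma cmulZl A t (a c : A) : cmul (t *: a) c = t *: cmul a c.
Proof. by rewrite -[t *: a]addr0 cmul_linearl cmul0l addr0. Qed.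
Lemma cmulZr A t (a c : A) : cmul c (t *: a) = t *: cmul c a.
Proof. by rewrite -[t *: a]addr0 cmul_linearr cmul0r addr0. Qed.
Lemma cmulNl A (a c : A) : cmul (- a) c = - cmul a c.
Proof. by rewrite -scaleN1r cmulZl scaleN1r. Qed.
Lemma cmulNr A (a c : A) : cmul c (- a) = - cmul c a.
Proof. by rewrite -scaleN1r cmulZr scaleN1r. Qed.
Lemma cmulBl A (a b c : A) : cmul (a - b) c = cmul a c - cmul b c.
Proof. by rewrite cmulDl cmulNl. Qed.
Lemma cmulBr A (a b c : A) : cmul c (a - b) = cmul c a - cmul c b.
Proof. by rewrite cmulDr cmulNr. Qed.
Lemma cadjD A (a b : A) : cadj (a + b) = cadj a + cadj b.
Proof. by rewrite -{1}[a]scale1r cadj_antilinear rmorph1 scale1r. Qed.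
Lemma cadj0 A : cadj (0 : A) = 0.
Proof. by apply: (addrI (cadj (0 : A))); rewrite -cadjD !addr0. Qed.
Lemma cadjZ A t (a : A) : cadj (t *: a) = Num.conj t *: cadj a.
Proof. by rewrite -[t *: a]addr0 cadj_antilinear cadj0 addr0. Qed.
Lemma cadjN A (a : A) : cadj (- a) = - cadj a.
Proof. by rewrite -scaleN1r cadjZ rmorphN rmorph1 scaleN1r. Qed.

Lemma cmul_nrm A (a b : A) : nrm (cmul a b) <= nrm a * nrm b.
Proof. by rewrite -lecR rmorphM /= -!normE cmul_norm. Qed.

Lemma cadj_nrm A (a : A) : nrm (cadj a) = nrm a.
Proof.
have le b : nrm (b : A) <= nrm (cadj b).
  apply: (@le_trans _ _ (nrm b)) => //.
  have [->|b0] := eqVneq (nrm b) 0; first exact: nrm_ge0.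
  have bp : 0 < nrm b by rewrite lt_neqAle eq_sym b0 nrm_ge0.
  have := cmul_nrm (cadj b) b.
  rewrite (_ : nrm (cmul _ _) = nrm b ^+ 2); first by rewrite expr2 ler_pM2r.
  by apply: complexI; rewrite -normE cstar_identity normE rmorphXn.
by apply/eqP; rewrite eq_le le -{2}(cadjK a) le.
Qed.

Lemma cstar_nrm A (a : A) : nrm (cmul (cadj a) a) = nrm a ^+ 2.
Proof. by apply: complexI; rewrite -normE cstar_identity normE rmorphXn. Qed.

Definition crep A H (rho : A -> H -> H) := [/\
  (forall t a b x, rho (t *: a + b) x = t *: rho a x + rho b x),
  (forall t a x y, rho a (t *: x + y) = t *: rho a x + rho a y),
  (forall a b x, rho (cmul a b) x = rho a (rho b x)),
  (forall a x y, ip (rho a x) y = ip x (rho (cadj a) y))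
 & (forall a x, nrm (rho a x) <= nrm a * nrm x)].

(** This plays the part of the Gelfand-Naimark theorem: norm bounds in [A] may be checked on
    vectors. The full algebra has the property by the very definition of its norm, see
    [full_normed_by_reps]. *)
Definition normed_by_reps A := forall (a : A) C, 0 <= C ->
  (forall H (rho : A -> H -> H), crep rho -> forall x, nrm (rho a x) <= C * nrm x) ->
  nrm a <= C.

Section Crep.
Variables (A : cstarAlg R) (H : hilbert R) (rho : A -> H -> H).
Hypothesis rhoP : crep rho.
Implicit Types (a b : A) (x y : H).

Lemma crepD a b x : rho (a + b) x = rho a x + rho b x.
Proof. by case: rhoP => l _ _ _ _; rewrite -{1}[a]scale1r l scale1r. Qed.
Lemma crep0 x : rho 0 x = 0.
Proof. by apply: (addrI (rho 0 x)); rewrite -crepD !addr0. Qed.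
Lemma crepZ t a x : rho (t *: a) x = t *: rho a x.
Proof. by case: rhoP => l _ _ _ _; rewrite -[t *: a]addr0 l crep0 addr0. Qed.
Lemma crepN a x : rho (- a) x = - rho a x.
Proof. by rewrite -scaleN1r crepZ scaleN1r. Qed.
Lemma crepB a b x : rho (a - b) x = rho a x - rho b x.
Proof. by rewrite crepD crepN. Qed.
Lemma crepDr a x y : rho a (x + y) = rho a x + rho a y.
Proof. by case: rhoP => _ l _ _ _; rewrite -{1}[x]scale1r l scale1r. Qed.
Lemma crep0r a : rho a 0 = 0.
Proof. by apply: (addrI (rho a 0)); rewrite -crepDr !addr0. Qed.
Lemma crepZr t a x : rho a (t *: x) = t *: rho a x.
Proof. by case: rhoP => _ l _ _ _; rewrite -[t *: x]addr0 l crep0r addr0. Qed.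
Lemma crepBr a x y : rho a (x - y) = rho a x - rho a y.
Proof. by rewrite -scaleN1r crepDr crepZr scaleN1r. Qed.
Lemma crepM a b x : rho (cmul a b) x = rho a (rho b x).
Proof. by case: rhoP. Qed.
Lemma crep_adj a x y : ip (rho a x) y = ip x (rho (cadj a) y).
Proof. by case: rhoP. Qed.
Lemma crep_nrm a x : nrm (rho a x) <= nrm a * nrm x.
Proof. by case: rhoP. Qed.
End Crep.

Section Truncation.
Variable A : cstarAlg R.
Hypothesis norming : normed_by_reps A.

(** For [b = a^* a], between 0 and 2, the operator [S = 1 - b] is a self-adjoint contraction, and
    [2 b - b^2 = 1 - S^2] lies between 0 and 1. [S] exists only on the Hilbert space, since [A] may
    have no unit. *)
Lemma two_b_sub_sq_le1 (a : A) : nrm a ^+ 2 <= 2 ->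
  nrm (2%:R *: cmul (cadj a) a - cmul (cmul (cadj a) a) (cmul (cadj a) a)) <= 1.
Proof.
move=> a2; apply: norming => // H rho rhoP x; rewrite mul1r.
pose B y := rho (cmul (cadj a) a) y; pose S y := y - B y.
have Badj y w : ip (B y) w = ip y (B w).
  by rewrite /B crep_adj// cadjM cadjK.
have Sle y : nrm (S y) <= nrm y.
  rewrite -(@ler_pXn2r _ 2)// ?nnegrE ?nrm_ge0// -!Re_ip /S ipBl !ipBr -Badj.
  have : nrm (B y) ^+ 2 <= 2 * complex.Re (ip (B y) y).
    rewrite {2}/B crepM// crep_adj// cadjK Re_ip /B crepM//.
    have le2 := crep_nrm rhoP (cadj a) (rho a y); rewrite cadj_nrm in le2.
    apply: (@le_trans _ _ ((nrm a * nrm (rho a y)) ^+ 2)).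
      by rewrite ler_pXn2r// nnegrE ?mulr_ge0 ?nrm_ge0.
    by rewrite exprMn ler_wpM2r// exprn_ge0// nrm_ge0.
  rewrite -Re_ip; move: (ip y y) (ip (B y) y) (ip (B y) (B y)) => [p p'] [r r'] [s s'] /=.
  lra.
have -> : rho (2%:R *: cmul (cadj a) a - cmul (cmul (cadj a) a) (cmul (cadj a) a)) x = x - S (S x).
  rewrite crepB// crepZ// (crepM rhoP _ (cmul (cadj a) a)) /S -!/(B _).
  have -> : B (x - B x) = B x - B (B x) by rewrite /B crepBr.
  rewrite scaler_nat mulr2n (_ : x - B x - _ = x - (B x + B x - B (B x))).
    by rewrite opprB [RHS]addrC subrK.
  by rewrite !opprB opprD !addrA [x - B x + _]addrAC.
have Sadj y w : ip (S y) w = ip y (S w) by rewrite /S ipBl ipBr Badj.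
clearbody S.
rewrite -(@ler_pXn2r _ 2)// ?nnegrE ?nrm_ge0//.
have : nrm (S (S x)) ^+ 2 <= nrm (S x) ^+ 2 by rewrite ler_pXn2r ?nnegrE ?nrm_ge0.
rewrite -!Re_ip ipBl !ipBr [ip (S (S x)) x]Sadj -[ip x (S (S x))]Sadj.
have : 0 <= nrm (S x) ^+ 2 by rewrite exprn_ge0 ?nrm_ge0.
rewrite -Re_ip; move: (ip x x) (ip (S x) (S x)) (ip (S (S x)) _) => [p p'] [r r'] [s s'] /=.
lra.
Qed.

Fixpoint zeta (n : nat) : R := if n is m.+1 then (1 + zeta m ^+ 2) / 2 else 0.

(** The defect [u = 1 - zeta n] evolves by [u (1 - u / 2)], so its inverse grows by at least [1/2]
    at each step, starting from 1; hence [u <= 2 / (n + 2)]. *)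
Lemma zeta_bounds n : [/\ 0 <= zeta n, zeta n <= 1 & 1 - zeta n <= 2 / (n%:R + 2)].
Proof.
elim: n => [|n [z0 z1 zn]] /=; first by split=> //; rewrite subr0 add0r divff.
split.
- by rewrite divr_ge0// addr_ge0// exprn_ge0.
- by rewrite ler_pdivrMr// mul1r lerD2l exprn_ile1.
- set u := 1 - zeta n in zn *.
  have -> : 1 - (1 + zeta n ^+ 2) / 2 = u * (1 - u / 2) by rewrite /u; field.
  have n0 : 0 <= n%:R :> R by [].
  have u0 : 0 <= u by rewrite subr_ge0.
  have un : u * (n%:R + 2) <= 2 by rewrite -ler_pdivlMr//; lra.
  rewrite ler_pdivlMr; last by rewrite -[n.+1%:R]natr1; lra.
  rewrite -[n.+1%:R]natr1; set m := n%:R in n0 un *.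
  have u1 : u <= 1 by rewrite gerBl.
  have : 0 <= (2 - u * (m + 2)) * (1 - u / 2) by apply: mulr_ge0; lra.
  have : 0 <= u * u by exact: mulr_ge0.
  lra.
Qed.

(* The limit [z] satisfies [(1 - z)^2 = (1 - b)^2]; it is [1 - |1 - b|], so that
   [(b - z) / 2] is the positive part of [b - 1].  The numbers [zeta n] majorize
   the norms [nrm (trunc_seq b n)]. *)
Fixpoint trunc_seq (b : A) (n : nat) : A :=
  if n is m.+1 then 2%:R^-1 *: (2%:R *: b - cmul b b + cmul (trunc_seq b m) (trunc_seq b m))
  else 0.

Lemma cmod_half : cmod (2%:R^-1 : R[i]) = 2^-1.
Proof.
rewrite (_ : 2%:R^-1 = (2%:R^-1)%:C); last by rewrite fmorphV rmorph_nat.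
by rewrite cmodR ger0_norm.
Qed.

Section TruncSeq.
Variable b : A.
Hypothesis X1 : nrm (2%:R *: b - cmul b b) <= 1.
Local Notation z := (trunc_seq b).

Lemma trunc_seq_nrm n : nrm (z n) <= zeta n.
Proof.
elim: n => [|n IH]; first by rewrite /= nrm0.
have [z0 _ _] := zeta_bounds n.
rewrite [z _]/= nrmZ cmod_half mulrC ler_pM2r ?invr_gt0//.
rewrite (le_trans (nrmD _ _))// lerD// (le_trans (cmul_nrm _ _))//.
by rewrite expr2 ler_pM ?nrm_ge0.
Qed.

(** [u^2 - v^2 = u (u - v) + (u - v) v] holds without commutativity, and the increments of [zeta]
    satisfy the same recursion with numbers in place of norms. *)
Lemma trunc_seq_step n : nrm (z n.+1 - z n) <= zeta n.+1 - zeta n.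
Proof.
elim: n => [|n IH].
  rewrite /= cmul0l addr0 subr0 nrmZ cmod_half mulrC expr0n addr0 subr0.
  by rewrite ler_pM2r ?invr_gt0.
have [z0 _ _] := zeta_bounds n; have [z0' _ _] := zeta_bounds n.+1.
set u := z n.+1 in IH *; set v := z n in IH *.
have -> : z n.+2 - u = 2%:R^-1 *: (cmul u (u - v) + cmul (u - v) v).
  rewrite [z _]/= -/u {2}/u [z n.+1]/= -/v -scalerBr; congr (_ *: _).
  rewrite cmulBr cmulBl addrA subrK opprD addrA [_ + _ - (_ - _)]addrAC.
  by rewrite subrr add0r.
rewrite nrmZ cmod_half mulrC.
have -> : zeta n.+2 - zeta n.+1 = (zeta n.+1 + zeta n) * (zeta n.+1 - zeta n) / 2.
  transitivity ((1 + zeta n.+1 ^+ 2) / 2 - (1 + zeta n ^+ 2) / 2) => //.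
  by field.
rewrite ler_pM2r ?invr_gt0// mulrDl (le_trans (nrmD _ _))// lerD//.
  by rewrite (le_trans (cmul_nrm _ _))// ler_pM ?nrm_ge0// trunc_seq_nrm.
by rewrite mulrC (le_trans (cmul_nrm _ _))// ler_pM ?nrm_ge0// trunc_seq_nrm.
Qed.

Lemma trunc_seq_dist n m : (n <= m)%N -> nrm (z m - z n) <= zeta m - zeta n.
Proof.
elim: m => [|m IH]; first by rewrite leqn0 => /eqP ->; rewrite !subrr nrm0.
rewrite leq_eqVlt => /predU1P[->|]; first by rewrite !subrr nrm0.
rewrite ltnS => /IH {}IH; rewrite -(subrK (z m) (z m.+1)) -addrA.
rewrite (le_trans (nrmD _ _))//.
rewrite -[leRHS](subrK (zeta m)) [_ - zeta n - _]addrAC -[_ + _ + zeta m]addrA lerD//.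
  exact: trunc_seq_step.
by rewrite [leRHS]addrC.
Qed.

Lemma inv_small (e : R) : 0 < e -> exists N, forall n, (N <= n)%N -> 2 / (n%:R + 2) <= e.
Proof.
move=> e0; exists (Num.trunc (2 / e)).+1 => n Nn.
have n0 : 0 < n%:R + 2 :> R by rewrite ltr_wpDl.
rewrite ler_pdivrMr// mulrC -ler_pdivrMr//.
have /ltW := truncnS_gt (2 / e) => /le_trans; apply.
by rewrite (@le_trans _ _ n%:R)// ?ler_nat// lerDl.
Qed.

Lemma trunc_lim : exists2 zz : A, (forall n, nrm (zz - z n) <= 2 / (n%:R + 2)) &
  z n @[n --> \oo] --> zz.
Proof.
have zd n m : (n <= m)%N -> nrm (z m - z n) <= 2 / (n%:R + 2).
  move=> nm; rewrite (le_trans (trunc_seq_dist nm))//.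
  have [_ _ h1] := zeta_bounds n; have [_ h2 _] := zeta_bounds m.
  by rewrite (le_trans _ h1)// lerD2r.
have /cvg_ex[zz zzP] : cvg (z n @[n --> \oo]).
  apply: cauchy_seq_cvg => e /inv_small[N HN]; exists N => n m Nn Nm.
  have [nm|/ltnW mn] := leqP n m.
    by rewrite nrmBC (le_trans (zd _ _ nm))// HN.
  by rewrite (le_trans (zd _ _ mn))// HN.
exists zz => // n.
apply: (@nrm_cvg_le _ _ (fun m => z m - z n)).
  by apply: cvgB => //; exact: cvg_cst.
by exists n => // m /= nm; exact: zd.
Qed.

End TruncSeq.

Lemma nrm_limit_eq0 (V : normedModType R[i]) (a : V) (C : R) : 0 <= C ->
  (forall n : nat, nrm a <= C * (2 / (n%:R + 2))) -> a = 0.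
Proof.
move=> C0 H; apply: eps_eq0 => e e0.
have [N /(_ N (leqnn N)) HN] := inv_small (e := e / (C + 1)) ltac:(by rewrite divr_gt0// ltr_wpDl).
rewrite (le_trans (H N))//; apply: (@le_trans _ _ (C * (e / (C + 1)))).
  exact: ler_wpM2l.
rewrite mulrCA ler_piMr ?(ltW e0)// ler_pdivrMr ?ltr_wpDl// mul1r lerDl//.
Qed.

Lemma trunc_seq_selfadj (b : A) n : cadj b = b -> cadj (trunc_seq b n) = trunc_seq b n.
Proof.
move=> bb; elim: n => [|n IH]; first exact: cadj0.
rewrite /= cadjZ !cadjD cadjN cadjZ !cadjM bb IH.
by rewrite fmorphV !rmorph_nat.
Qed.

Lemma trunc_seq_comm (b : A) n : cmul b (trunc_seq b n) = cmul (trunc_seq b n) b.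
Proof.
elim: n => [|n IH]; first by rewrite cmul0l cmul0r.
rewrite /= cmulZl cmulZr !(cmulDl, cmulDr, cmulNl, cmulNr) !(cmulZl, cmulZr).
by rewrite !cmulA IH -!cmulA IH.
Qed.

(** Where [b] acts as a contraction, the limit of the recursion is [b] itself. Indeed [b - z_(n+1)]
    is half of [b (b - z_n) + (b - z_n) z_n], and [(1 - zeta n) (1 + zeta n) / 2 = 1 - zeta
    n.+1]. *)
Lemma trunc_seq_crep (b : A) H (rho : A -> H -> H) : crep rho ->
  nrm (2%:R *: b - cmul b b) <= 1 ->
  (forall x, nrm (rho b x) <= nrm x) ->
  forall n x, nrm (rho (b - trunc_seq b n) x) <= (1 - zeta n) * nrm x.
Proof.
move=> rhoP X1 b1; elim=> [|n IH] x; first by rewrite /= !subr0 mul1r.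
set z := trunc_seq b n in IH *; have [z0 z1 _] := zeta_bounds n.
have zn y : nrm (rho z y) <= zeta n * nrm y.
  by rewrite (le_trans (crep_nrm rhoP _ _))// ler_wpM2r ?nrm_ge0// trunc_seq_nrm.
have -> : b - trunc_seq b n.+1 = 2%:R^-1 *: (cmul b (b - z) + cmul (b - z) z).
  have Eb : b = 2%:R^-1 *: (2%:R *: b) by rewrite scalerA mulVf ?scale1r ?pnatr_eq0.
  rewrite [trunc_seq _ _]/= -/z {1}Eb -scalerBr; congr (_ *: _).
  rewrite cmulBr cmulBl [RHS]addrA subrK opprD opprB addrA.
  by rewrite [X in X - _ = _]addrC subrK.
rewrite crepZ// nrmZ cmod_half crepD// !crepM//.
have -> : (1 - zeta n.+1) * nrm x =
    2^-1 * ((1 - zeta n) * nrm x + (1 - zeta n) * (zeta n * nrm x)).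
  by rewrite /=; field.
rewrite ler_pM2l ?invr_gt0// (le_trans (nrmD _ _))// lerD//.
  by rewrite (le_trans (b1 _)).
by rewrite (le_trans (IH _))// ler_wpM2l ?subr_ge0.
Qed.

(* [a' = a (1 - r)] with [r] the positive part of [a^* a - 1]: it has norm at most
   [1] because [(1 + r) (1 - r)^2 <= 1], and [r] dies in every representation
   where [a] is a contraction. *)
Lemma truncation (a : A) : nrm a ^+ 2 <= 2 -> exists2 a' : A, nrm a' <= 1 &
  forall H (rho : A -> H -> H), crep rho -> (forall x, nrm (rho a x) <= nrm x) ->
  forall x, rho a' x = rho a x.
Proof.
move=> a2; pose b := cmul (cadj a) a.
have X1 : nrm (2%:R *: b - cmul b b) <= 1 := two_b_sub_sq_le1 a2.
have bb : cadj b = b by rewrite /b cadjM cadjK.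
have b2 : nrm b <= 2 by rewrite cstar_nrm.
have [z zd zcv] := trunc_lim X1.
have zn1 n : nrm (trunc_seq b n) <= 1.
  by rewrite (le_trans (trunc_seq_nrm X1 n))//; have [] := zeta_bounds n.
have z1 : nrm z <= 1 by apply: (nrm_cvg_le zcv); exists 0%N => // n _ /=; exact: zn1.
have zz : cadj z = z.
  apply/eqP; rewrite -subr_eq0; apply/eqP; apply: (@nrm_limit_eq0 A _ 2) => // n.
  rewrite (_ : _ - _ = cadj (z - trunc_seq b n) - (z - trunc_seq b n)); last first.
    by rewrite cadjD cadjN trunc_seq_selfadj// opprB addrA subrK.
  by rewrite (le_trans (nrmB _ _))// cadj_nrm mulrDl mul1r lerD.
have bz : cmul b z = cmul z b.
  apply/eqP; rewrite -subr_eq0; apply/eqP; apply: (@nrm_limit_eq0 A _ 4) => // n.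
  rewrite (_ : _ - _ = cmul b (z - trunc_seq b n) - cmul (z - trunc_seq b n) b); last first.
    by rewrite cmulBr cmulBl trunc_seq_comm opprB addrA subrK.
  rewrite (le_trans (nrmB _ _))// (_ : 4 = 2 + 2); last by rewrite -natrD.
  rewrite [leRHS]mulrDl lerD// (le_trans (cmul_nrm _ _))//.
    by rewrite ler_pM ?nrm_ge0.
  by rewrite mulrC ler_pM ?nrm_ge0.
(* The recursion in the limit. The error is at most [4] times [2 / (n + 2)]: two from doubling
   [z - y'], and one from each factor of the square. *)
have z2 : 2%:R *: z = 2%:R *: b - cmul b b + cmul z z.
  apply/eqP; rewrite -subr_eq0; apply/eqP; apply: (@nrm_limit_eq0 A _ 4) => // n.
  have E : 2%:R *: trunc_seq b n.+1 = 2%:R *: b - cmul b b + cmul (trunc_seq b n) (trunc_seq b n).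
    by rewrite [trunc_seq _ _]/= scalerA mulfV ?pnatr_eq0// scale1r.
  set y := trunc_seq b n in E *; set y' := trunc_seq b n.+1 in E *.
  rewrite (_ : _ - _ = 2%:R *: (z - y') - (cmul y (z - y) + cmul (z - y) z)); last first.
    rewrite scalerBr E cmulBr cmulBl [cmul y z - _ + _]addrC addrA subrK.
    rewrite -[RHS]addrA -opprD; congr (_ - _); rewrite -[RHS]addrA; congr (_ + _).
    by rewrite addrC subrK.
  have w' : nrm (z - y') <= 2 / (n%:R + 2).
    rewrite (le_trans (zd _))// ler_pM2l// lef_pV2 ?posrE ?ltr_wpDl//.
    by rewrite lerD2r ler_nat.
  have w : nrm (cmul y (z - y) + cmul (z - y) z) <= 2 * (2 / (n%:R + 2)).
    rewrite mulrDl mul1r (le_trans (nrmD _ _))// lerD// (le_trans (cmul_nrm _ _))//.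
      by rewrite -[leRHS]mul1r; exact: ler_pM (nrm_ge0 _) (nrm_ge0 _) (zn1 n) (zd n).
    by rewrite -[leRHS]mulr1; exact: ler_pM (nrm_ge0 _) (nrm_ge0 _) (zd n) z1.
  rewrite (le_trans (nrmB _ _))// nrmZ (_ : 4 = 2 + 2); last by rewrite -natrD.
  rewrite [leRHS]mulrDl lerD//.
  have -> : cmod (2%:R : R[i]) = 2.
    by rewrite -[2%:R](rmorph_nat (real_complex R)) cmodR ger0_norm.
  by rewrite ler_pM2l.
pose r := 2%:R^-1 *: (b - z).
have rr : cadj r = r by rewrite /r cadjZ cadjD cadjN bb zz fmorphV rmorph_nat.
have z2r : b = z + 2%:R *: r.
  by rewrite /r scalerA mulfV ?pnatr_eq0// scale1r addrC subrK.
(* The limit equation reads [b^2 - z^2 = 2 (b - z)]; as [b - r = (b + z) / 2] and [r = (b - z) / 2],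
   it says [(b - r) r = r]. So [b] acts as [1 + r] on the range of [r]. *)
have br : cmul b r = r + cmul r r.
  have bmr : b - r = 2%:R^-1 *: (b + z).
    apply: (@scalerI _ _ 2%:R); first by rewrite pnatr_eq0.
    rewrite scalerBr /r !scalerA mulfV ?pnatr_eq0// !scale1r.
    by rewrite scaler_nat mulr2n opprB [LHS]addrC addrA subrK addrC.
  apply/eqP; rewrite -subr_eq -cmulBl bmr; apply/eqP.
  rewrite /r cmulZl cmulZr cmulBr !cmulDl bz.
  rewrite opprD addrA addrK.
  have -> : cmul b b - cmul z z = 2%:R *: (b - z).
    by rewrite scalerBr z2 opprD opprB addrA [X in _ = X - _]addrC subrK.
  by congr (_ *: _); rewrite scalerA mulVf ?pnatr_eq0// scale1r.
exists (a - cmul a r).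
  (* With [u = r x], the relations [b x = z x + 2 u] and [b u = u + r u] turn [|a (x - u)|^2] into
     the real part of [<z x, x> - 2 |u|^2 + <b u, u>]. This is at most [|x|^2], since [z] has norm
     at most 1 and [b] at most 2. *)
  apply: norming => // H rho rhoP x; rewrite mul1r crepB// crepM// -crepBr//.
  set u := rho r x.
  have Bu : rho b u = u + rho r u by rewrite /u -!crepM// br crepD.
  have radj y w : ip (rho r y) w = ip y (rho r w) by rewrite crep_adj// rr.
  have Bux : ip (rho b u) x = ip u x + ip u u by rewrite Bu ipDl radj.
  have Bx : ip (rho b x) x = ip (rho z x) x + 2%:R * ip u x.
    by rewrite {1}z2r crepD// crepZ// ipDl ipZl.
  have Bxu : ip (rho b x) u = Num.conj (ip (rho b u) x).
    by rewrite crep_adj// bb -ip_conj.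
  have Zx := Re_ip_le (rho z x) x.
  have Buu := Re_ip_le (rho b u) u.
  have Zx1 : nrm (rho z x) * nrm x <= nrm x ^+ 2.
    by rewrite expr2 ler_wpM2r ?nrm_ge0// (le_trans (crep_nrm rhoP _ _))// ler_piMl ?nrm_ge0.
  have Buu2 : nrm (rho b u) * nrm u <= 2 * nrm u ^+ 2.
    rewrite expr2 mulrA ler_wpM2r ?nrm_ge0// (le_trans (crep_nrm rhoP _ _))//.
    by rewrite ler_wpM2r ?nrm_ge0.
  rewrite -(@ler_pXn2r _ 2)// ?nnegrE ?nrm_ge0// -[leLHS]Re_ip.
  rewrite -[ip _ _]/(ip (rho a (x - u)) (rho a (x - u))).
  have -> : ip (rho a (x - u)) (rho a (x - u)) = ip (rho b (x - u)) (x - u).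
    by rewrite /b crepM// [RHS]crep_adj// cadjK.
  rewrite crepBr// ipBl !ipBr Bxu Bux Bx.
  move: Zx Zx1 Buu Buu2; rewrite -!Re_ip.
  move: (ip (rho z x) x) (ip u x) (ip u u) (ip (rho b u) u) (nrm (rho z x) * nrm x)
    (nrm (rho b u) * nrm u) (ip x x) => [p p'] [s s'] [v v'] [w w'] c d [e e'] /=.
  lra.
move=> H rho rhoP le1 x; rewrite crepB// crepM//.
(* In such a representation [b] acts as a contraction, so the recursion tends to [b] as well as to
   [z], and [r] acts as 0. *)
suff -> : rho r x = 0 by rewrite crep0r// subr0.
have adj1 y : nrm (rho (cadj a) y) <= nrm y.
  apply: nrm_sq_le; first exact: nrm_ge0.
  rewrite -Re_ip crep_adj// cadjK mulrC (le_trans (Re_ip_le _ _))//.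
  by rewrite [leLHS]mulrC ler_wpM2r ?nrm_ge0.
have b1 y : nrm (rho b y) <= nrm y by rewrite /b crepM// (le_trans (adj1 _)).
apply: (@nrm_limit_eq0 H _ (2 * nrm x)) => [|n]; first by rewrite mulr_ge0 ?nrm_ge0.
rewrite /r crepZ// nrmZ cmod_half ler_pdivrMl//.
rewrite -(subrK (trunc_seq b n) b) -addrA crepD// (le_trans (nrmD _ _))//.
have h1 := trunc_seq_crep rhoP X1 b1 n x.
have h2 : nrm (rho (trunc_seq b n - z) x) <= 2 / (n%:R + 2) * nrm x.
  by rewrite (le_trans (crep_nrm rhoP _ _))// ler_wpM2r ?nrm_ge0// nrmBC.
have [_ _ h3] := zeta_bounds n.
have h4 := ler_wpM2r (nrm_ge0 x) h3.
move: h1 h2 h4; set w := 2 / _; have := nrm_ge0 x.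
have : 0 <= w by rewrite divr_ge0// addr_ge0.
move=> w0 t0 {}h1 {}h2 {}h3; rewrite (le_trans (lerD (le_trans h1 h3) h2))//.
have := mulr_ge0 w0 t0; lra.
Qed.

End Truncation.
End CstarBasics.

(** * Extension of representations to the full algebra *)

Section FullExtension.
Context {R : realType} {G : groupType} {Q : topologicalType} {act : G -> Q -> Q}.
Hypotheses (lcQ : locally_compact [set: Q]) (hQ : hausdorff_space Q)
  (act_homeo : action_by_homeo act).
Variable A : fullCstar R act.

Local Notation fn := (arrow G Q -> R[i]).
Local Notation emb := (full_emb A).
Implicit Types (f k : fn) (a b : A).

Lemma full_approx a e : 0 < e -> exists2 f, Cc act f & nrm (a - emb f) <= e.
Proof.
move=> e0; have [_ [f Cf <-] af] := dense_nrm (@full_emb_dense _ _ _ _ A) a e0.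
by exists f.
Qed.

Lemma full_embB f k : Cc act f -> Cc act k -> emb f - emb k = emb (lincomb (-1) k f).
Proof. by move=> Cf Ck; rewrite full_emb_linear// scaleN1r addrC. Qed.

Section ExtRep.
Variables (H : hilbert R) (pi : fn -> {linear H -> H}).
Hypothesis piP : star_rep act pi.

Lemma rep_dist f k x : Cc act f -> Cc act k ->
  nrm (pi f x - pi k x) <= nrm (emb f - emb k) * nrm x.
Proof.
move=> Cf Ck; have Cl : Cc act (lincomb (-1) k f) by exact: Cc_lincomb.
rewrite full_embB// full_emb_norm//.
have -> : pi f x - pi k x = pi (lincomb (-1) k f) x.
  by rewrite (rep_lin piP)// scaleN1r addrC.
exact: rep_full_norm.
Qed.

(** This single estimate determines the extension and carries all its properties: every algebraic
    identity for [rho] follows by replacing elements of the algebra by nearby images of functions in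
    [Cc]. *)
Lemma ext_exists : exists rho : A -> H -> H, forall a f x, Cc act f ->
  nrm (rho a x - pi f x) <= nrm (a - emb f) * nrm x.
Proof.
have apx a n : exists f, Cc act f /\ nrm (a - emb f) <= n.+1%:R^-1.
  by have [f Cf af] := @full_approx a n.+1%:R^-1 ltac:(by rewrite invr_gt0); exists f.
pose u a n := projT1 (cid (apx a n)).
have uC a n : Cc act (u a n) by rewrite /u; case: cid => ? [].
have ua a n : nrm (a - emb (u a n)) <= n.+1%:R^-1 by rewrite /u; case: cid => ? [].
have uL a e : 0 < e -> exists N, forall n, (N <= n)%N -> nrm (a - emb (u a n)) <= e.
  move=> e0; exists (Num.trunc e^-1) => n Nn.
  rewrite (le_trans (ua a n))// invf_ple ?posrE//.
  by rewrite (le_trans (ltW (truncnS_gt _)))// ler_nat.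
have cv a x : cvg (pi (u a n) x @[n --> \oo]).
  apply: cauchy_seq_cvg => e e0.
  have x1 : 0 < nrm x + 1 by rewrite ltr_wpDl ?nrm_ge0.
  have [N HN] := uL a (e / (nrm x + 1) / 2) ltac:(by rewrite !divr_gt0).
  exists N => n m Nn Nm; rewrite (le_trans (rep_dist _ (uC _ _) (uC _ _)))//.
  apply: (@le_trans _ _ (e / (nrm x + 1) * nrm x)).
    rewrite ler_wpM2r ?nrm_ge0// [leRHS]splitr.
    rewrite (_ : emb _ - emb _ = (a - emb (u a m)) - (a - emb (u a n))); last first.
      by rewrite opprB [RHS]addrC addrA subrK.
    by rewrite (le_trans (nrmB _ _))// lerD// HN.
  by rewrite mulrAC ler_pdivrMr// ler_wpM2l ?(ltW e0)// lerDl.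
exists (fun a x => lim (pi (u a n) x @[n --> \oo])) => a f x Cf.
apply/ler_addgt0Pr => e e0.
have x1 : 0 < nrm x + 1 by rewrite ltr_wpDl ?nrm_ge0.
have [N HN] := uL a (e / (nrm x + 1)) ltac:(by rewrite divr_gt0).
apply: (@nrm_cvg_le _ _ (fun n => pi (u a n) x - pi f x)).
  by apply: cvgB; [exact: cv|exact: cvg_cst].
exists N => // n /= Nn; rewrite (le_trans (rep_dist _ (uC _ _) Cf))//.
rewrite (_ : emb _ - emb _ = (a - emb f) - (a - emb (u a n))); last first.
  by rewrite opprB [RHS]addrC addrA subrK.
apply: (@le_trans _ _ ((nrm (a - emb f) + e / (nrm x + 1)) * nrm x)).
  by rewrite ler_wpM2r ?nrm_ge0// (le_trans (nrmB _ _))// lerD2l HN.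
rewrite mulrDl lerD2l mulrAC ler_pdivrMr// ler_wpM2l ?(ltW e0)// lerDl//.
Qed.

Lemma ext_rep : exists2 rho : A -> H -> H, crep rho &
  forall f x, Cc act f -> rho (emb f) x = pi f x.
Proof.
have [rho rhoE] := ext_exists.
have rhof f x : Cc act f -> rho (emb f) x = pi f x.
  move=> Cf; apply/eqP; rewrite -subr_eq0; apply/eqP; apply: nrm_eq0.
  by apply/eqP; rewrite eq_le nrm_ge0 (le_trans (rhoE _ f _ Cf))// subrr nrm0 mul0r.
(* The extra bound [d <= 1] serves multiplicativity, where the norm of the approximant [emb f] must
   stay below [nrm a + 1]. *)
have small e c : 0 < e -> 0 <= c -> exists2 d : R, 0 < d & d * c <= e /\ d <= 1.
  move=> e0 c0; exists (Num.min (e / (c + 1)) 1).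
    by rewrite lt_min ltr01 divr_gt0// ltr_wpDl.
  rewrite ge_min lexx orbT; split=> //.
  apply: (@le_trans _ _ (e / (c + 1) * c)).
    by rewrite ler_wpM2r// ge_min lexx.
  by rewrite mulrAC ler_pdivrMr ?ltr_wpDl// ler_wpM2l ?(ltW e0)// lerDl.
have bnd a x : nrm (rho a x) <= nrm a * nrm x.
  apply/ler_addgt0Pr => e e0.
  have [d d0 [dx _]] := small e (2 * nrm x) e0 ltac:(by rewrite mulr_ge0 ?nrm_ge0).
  have [f Cf af] := full_approx a d0.
  rewrite -(subrK (pi f x) (rho a x)) (le_trans (nrmD _ _))//.
  have h1 := le_trans (rhoE a f x Cf) (ler_wpM2r (nrm_ge0 x) af).
  have h2 : nrm (pi f x) <= (nrm a + d) * nrm x.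
    rewrite (le_trans (rep_full_norm lcQ hQ act_homeo x Cf piP))// -(full_emb_norm A)//.
    rewrite ler_wpM2r ?nrm_ge0// -(subrK a (emb f)) addrC (le_trans (nrmD _ _))//.
    by rewrite lerD2l nrmBC.
  have := lerD h1 h2; lra.
have lin t a b x : rho (t *: a + b) x = t *: rho a x + rho b x.
  apply/eqP; rewrite -subr_eq0; apply/eqP; apply: eps_eq0 => e e0.
  have [d d0 [dx _]] := small e (2 * (cmod t + 1) * nrm x) e0
    ltac:(by rewrite !mulr_ge0 ?addr_ge0 ?cmod_ge0 ?nrm_ge0).
  have [f Cf af] := full_approx a d0; have [k Ck bk] := full_approx b d0.
  have Cl : Cc act (lincomb t f k) by exact: Cc_lincomb.
  have h1 := rhoE (t *: a + b) _ x Cl.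
  have h2 := le_trans (rhoE a f x Cf) (ler_wpM2r (nrm_ge0 x) af).
  have h3 := le_trans (rhoE b k x Ck) (ler_wpM2r (nrm_ge0 x) bk).
  have h4 : nrm (t *: a + b - emb (lincomb t f k)) <= (cmod t + 1) * d.
    rewrite full_emb_linear// opprD addrACA -scalerBr (le_trans (nrmD _ _))//.
    by rewrite nrmZ mulrDl mul1r lerD// ler_wpM2l ?cmod_ge0.
  have {}h1 := le_trans h1 (ler_wpM2r (nrm_ge0 x) h4).
  rewrite (_ : _ - _ = (rho (t *: a + b) x - pi (lincomb t f k) x)
    - (t *: (rho a x - pi f x) + (rho b x - pi k x))); last first.
    rewrite (rep_lin piP)// scalerBr addrACA -opprD opprB.
    by rewrite [RHS]addrA subrK.
  rewrite (le_trans (nrmB _ _))//.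
  have h5 : nrm (t *: (rho a x - pi f x) + (rho b x - pi k x)) <=
      cmod t * (d * nrm x) + d * nrm x.
    by rewrite (le_trans (nrmD _ _))// nrmZ lerD// ler_wpM2l ?cmod_ge0.
  have := lerD h1 h5; lra.
have linr t a x y : rho a (t *: x + y) = t *: rho a x + rho a y.
  apply/eqP; rewrite -subr_eq0; apply/eqP; apply: eps_eq0 => e e0.
  have [d d0 [dx _]] := small e (nrm (t *: x + y) + (cmod t * nrm x + nrm y)) e0
    ltac:(by rewrite !addr_ge0 ?mulr_ge0 ?cmod_ge0 ?nrm_ge0).
  have [f Cf af] := full_approx a d0.
  have h1 := le_trans (rhoE a f (t *: x + y) Cf) (ler_wpM2r (nrm_ge0 _) af).
  have h2 := le_trans (rhoE a f x Cf) (ler_wpM2r (nrm_ge0 x) af).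
  have h3 := le_trans (rhoE a f y Cf) (ler_wpM2r (nrm_ge0 y) af).
  rewrite (_ : _ - _ = (rho a (t *: x + y) - pi f (t *: x + y))
    - (t *: (rho a x - pi f x) + (rho a y - pi f y))); last first.
    rewrite linearP scalerBr addrACA -opprD opprB.
    by rewrite [RHS]addrA subrK.
  rewrite (le_trans (nrmB _ _))//.
  have h5 : nrm (t *: (rho a x - pi f x) + (rho a y - pi f y)) <=
      cmod t * (d * nrm x) + d * nrm y.
    by rewrite (le_trans (nrmD _ _))// nrmZ lerD// ler_wpM2l ?cmod_ge0.
  have := lerD h1 h5; lra.
exists rho => //; split=> //.
- move=> a b x; apply/eqP; rewrite -subr_eq0; apply/eqP; apply: eps_eq0 => e e0.
  have [d d0 [dx d1]] := small e (2 * (nrm a + 1 + nrm b) * nrm x) e0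
    ltac:(by rewrite !mulr_ge0 ?addr_ge0 ?nrm_ge0).
  have [f Cf af] := full_approx a d0; have [k Ck bk] := full_approx b d0.
  have Cfk : Cc act (Defs.conv act f k) by exact: Cc_conv.
  have nf : nrm (emb f) <= nrm a + 1.
    rewrite -(subrK a (emb f)) addrC (le_trans (nrmD _ _))// lerD2l nrmBC.
    exact: le_trans af d1.
  have h1 : nrm (rho (cmul a b) x - pi (Defs.conv act f k) x) <=
      (d * nrm b + (nrm a + 1) * d) * nrm x.
    rewrite (le_trans (rhoE _ _ _ Cfk))// ler_wpM2r ?nrm_ge0// full_embM//.
    rewrite (_ : _ - _ = cmul (a - emb f) b + cmul (emb f) (b - emb k)); last first.
      by rewrite cmulBl cmulBr addrA subrK.
    by rewrite (le_trans (nrmD _ _))// lerD// (le_trans (cmul_nrm _ _))// ler_pM ?nrm_ge0.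
  have h2 : nrm (rho a (rho b x) - pi f (pi k x)) <= (d * nrm b + (nrm a + 1) * d) * nrm x.
    rewrite (_ : _ - _ = (rho a (rho b x) - pi f (rho b x)) + pi f (rho b x - pi k x)); last first.
      by rewrite linearB /= addrA subrK.
    rewrite mulrDl (le_trans (nrmD _ _))// lerD//.
      by rewrite (le_trans (rhoE _ _ _ Cf))// -mulrA ler_pM ?nrm_ge0.
    rewrite (le_trans (rep_full_norm lcQ hQ act_homeo _ Cf piP))// -(full_emb_norm A)//.
    rewrite -mulrA ler_pM ?nrm_ge0// (le_trans (rhoE _ _ _ Ck))// ler_wpM2r ?nrm_ge0//.
  rewrite (_ : _ - _ = (rho (cmul a b) x - pi (Defs.conv act f k) x)
     - (rho a (rho b x) - pi f (pi k x))); last first.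
    by rewrite (repM piP)// opprB addrA subrK.
  rewrite (le_trans (nrmB _ _))//; have := lerD h1 h2; lra.
- move=> a x y; apply/eqP; rewrite -subr_eq0; apply/eqP; apply: (@eps_eq0 _ R[i]^o) => e e0.
  have [d d0 [dx _]] := small e (2 * nrm x * nrm y) e0
    ltac:(by rewrite !mulr_ge0 ?nrm_ge0).
  have [f Cf af] := full_approx a d0.
  have Ci : Cc act (invol act f) by exact: Cc_invol.
  rewrite -/(cmod _) (_ : _ - _ = ip (rho a x - pi f x) y
    - ip x (rho (cadj a) y - pi (invol act f) y)); last first.
    by rewrite ipBl ipBr (rep_adj piP)// opprB addrA subrK.
  have h1 : cmod (ip (rho a x - pi f x) y) <= d * nrm x * nrm y.
    rewrite (le_trans (CauchySchwarz _ _))// ler_wpM2r ?nrm_ge0//.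
    by rewrite (le_trans (rhoE _ _ _ Cf))// ler_wpM2r ?nrm_ge0.
  have h2 : cmod (ip x (rho (cadj a) y - pi (invol act f) y)) <= nrm x * (d * nrm y).
    rewrite (le_trans (CauchySchwarz _ _))// ler_wpM2l ?nrm_ge0//.
    rewrite (le_trans (rhoE _ _ _ Ci))// ler_wpM2r ?nrm_ge0// full_embJ//.
    by rewrite -cadjN -cadjD cadj_nrm.
  by rewrite (le_trans (cmodD _ _))// cmodN; have := lerD h1 h2; lra.
Qed.

End ExtRep.

Lemma full_normed_by_reps : normed_by_reps A.
Proof.
move=> a C C0 HC; apply/ler_addgt0Pr => e e0.
have e2 : 0 < e / 2 by rewrite divr_gt0.
have [f Cf af] := full_approx a e2.
have : full_norm act f <= C + e / 2.
  apply: full_norm_le => //; first by rewrite addr_ge0 ?(ltW e2).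
  move=> H pi piP x; have [rho rhoP rhof] := ext_rep piP.
  rewrite -rhof// -(subrK a (emb f)) crepD// mulrDl addrC (le_trans (nrmD _ _))//.
  rewrite lerD ?HC// (le_trans (crep_nrm rhoP _ _))// ler_wpM2r ?nrm_ge0//.
  by rewrite nrmBC.
rewrite -(full_emb_norm A)// => h.
rewrite -(subrK (emb f) a) (le_trans (nrmD _ _))//; lra.
Qed.

End FullExtension.

(** * Fibre ideals *)

Section FibreIdeals.
Context {R : realType} {G : groupType} {Q : topologicalType} {act : G -> Q -> Q}.
Hypotheses (lcQ : locally_compact [set: Q]) (hQ : hausdorff_space Q)
  (act_homeo : action_by_homeo act).
Local Notation fn := (arrow G Q -> R[i]).
Variables (X : cstarAlg R) (emb : fn -> X).
Hypotheses
  (emb_lin : forall t f k, Cc act f -> Cc act k -> emb (lincomb t f k) = t *: emb f + emb k)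
  (embM : forall f k, Cc act f -> Cc act k -> emb (Defs.conv act f k) = cmul (emb f) (emb k)).
Implicit Types (f k : fn) (q : Q) (a b j : X).

Local Notation J q := (fibre_ideal emb q).

Lemma fibre_ideal_closed q : closed_ideal (J q).
Proof.
split.
- by apply: closed_bigI => I [[]].
- by move=> I [[]].
- by move=> t a b Ja Jb I II; have [[_ _ l _ _] _] := II; apply: l; [exact: Ja|exact: Jb].
- by move=> a b Jb I II; have [[_ _ _ l _] _] := II; apply: l; exact: Jb.
- by move=> a b Ja I II; have [[_ _ _ _ l] _] := II; apply: l; exact: Ja.
Qed.

Lemma fibre_ideal_min q (I : set X) : closed_ideal I ->
  (forall (f : Q -> R[i]) a, C0_space f -> f q = 0 -> C0_image emb f a -> I a) -> J q `<=` I.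
Proof. by move=> cI HI a; apply; split=> // b [f [C0f fq fb]]; exact: HI fb. Qed.

Lemma fibre_ideal_gen q (f : Q -> R[i]) a : C0_space f -> f q = 0 -> C0_image emb f a -> J q a.
Proof. by move=> C0f fq fa I [_]; apply; exists f. Qed.

Lemma p_fibre_le q a j : J q j -> p_fibre emb q a <= nrm (a + j).
Proof.
move=> Jj; apply: ge_inf; last by exists j.
by exists 0 => _ [k _ <-]; exact: nrm_ge0.
Qed.

Lemma p_fibre_ge q a c : (forall j, J q j -> c <= nrm (a + j)) -> c <= p_fibre emb q a.
Proof.
move=> H; apply: lb_le_inf; last by move=> _ [j Jj <-]; exact: H.
by have [_ J0 _ _ _] := fibre_ideal_closed q; exists (nrm (a + 0)), 0.
Qed.

Lemma p_fibre_ge0 q a : 0 <= p_fibre emb q a.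
Proof. by apply: p_fibre_ge => j _; exact: nrm_ge0. Qed.

Lemma p_fibre_dist q a b : p_fibre emb q a <= p_fibre emb q b + nrm (a - b).
Proof.
rewrite -lerBlDr; apply: p_fibre_ge => j Jj; rewrite lerBlDr.
rewrite (le_trans (p_fibre_le a Jj))//.
by rewrite -{1}(subrK b a) -addrA addrC nrmD.
Qed.

(** The kernel of [rho] is a closed ideal. It contains the generators: a function vanishing at [q]
    is approximated by functions [h] in [Cc_space] that are small at [q], hence act with small
    norm. *)
Lemma crep_fibre_ideal q (H : hilbert R) (rho : X -> H -> H) : crep rho ->
  (forall h x, Cc_space h -> nrm (rho (emb (extend_units h)) x) <= cmod (h q) * nrm x) ->
  forall j, J q j -> forall x, rho j x = 0.
Proof.
move=> rhoP rhoh; apply: fibre_ideal_min; first split.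
- apply: nrm_closed => a Ha x; apply: eps_eq0 => e e0.
  have x1 : 0 < nrm x + 1 by rewrite ltr_wpDl ?nrm_ge0.
  have [b rb ab] := Ha (e / (nrm x + 1)) ltac:(by rewrite divr_gt0).
  rewrite -(subrK b a) crepD// rb addr0 (le_trans (crep_nrm rhoP _ _))//.
  rewrite (le_trans (ler_wpM2r (nrm_ge0 x) ab))// mulrAC ler_pdivrMr// ler_wpM2l ?(ltW e0)//.
  by rewrite lerDl.
- by move=> x; exact: crep0.
- by move=> t a b ra rb x; rewrite crepD// crepZ// ra rb scaler0 addr0.
- by move=> a b rb x; rewrite crepM// rb crep0r.
- by move=> a b ra x; rewrite crepM// ra.
move=> f a [cf _] fq fa x; apply: eps_eq0 => e e0.
have x1 : 0 < nrm x + 1 by rewrite ltr_wpDl ?nrm_ge0.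
have d0 : 0 < e / (nrm x + 1) / 2 by rewrite !divr_gt0.
have [h [Ch fh ah]] := fa _ d0.
rewrite -(subrK (emb (extend_units h)) a) crepD// (le_trans (nrmD _ _))//.
have h1 := le_trans (crep_nrm rhoP (a - emb (extend_units h)) x) (ler_wpM2r (nrm_ge0 x) ah).
have hq : cmod (h q) <= e / (nrm x + 1) / 2 by rewrite -cmodN -[- h q]add0r -fq.
have h2 := le_trans (rhoh h x Ch) (ler_wpM2r (nrm_ge0 x) hq).
rewrite (le_trans (lerD h1 h2))// -mulrDl -splitr mulrAC ler_pdivrMr//.
by rewrite ler_wpM2l ?(ltW e0)// lerDl.
Qed.

Definition mulu (u : Q -> R) (f : fn) : fn := fun c => (u (src c))%:C * f c.

Lemma muluE u f : Cc act f -> cutoff setT u -> mulu u f = Defs.conv act (sgl 1%g (fun q => (u q)%:C)) f.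
Proof.
move=> Cf [cu u01 uc]; rewrite conv_sgll//; last exact: ccin_fix1 uc.
by apply: fn_ext => g q; rewrite /mulu /lbl /src /= invg1 mul1g.
Qed.

Lemma Cc_mulu u f : Cc act f -> cutoff setT u -> Cc act (mulu u f).
Proof.
move=> Cf uc; rewrite muluE//; apply: Cc_conv => //; apply: Cc_sgl => //.
by case: uc => _ _ uc; exact: ccin_fix1 uc.
Qed.

Lemma cutoff_range f : Cc act f -> exists2 w : Q -> R, cutoff setT w & forall g q, f (mk_arrow g q) != 0 -> w q = 1.
Proof.
move=> [cf cK fI].
have cK2 : compact (snd @` closure [set c | f c != 0]).
  by apply: continuous_compact cK; apply: continuous_subspaceT => -[a b]; exact: cvg_snd.
have [w wc w1] := cutoff_compact (R := R) lcQ hQ (@openT Q) cK2 (@subsetT _ _).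
exists w => // g q fgq; apply: w1; exists (mk_arrow g q) => //.
exact: subset_closure.
Qed.

Lemma ccin_C0 (h : Q -> R[i]) : ccin setT h -> C0_space h.
Proof.
move=> [ch [K [cK _ hK]]]; split=> // e e0.
apply: subclosed_compact cK _.
  apply: (@closed_comp _ _ (fun q => cmod (h q)) [set y | e <= y]) => [q _|].
    exact: continuous_cmod.
  exact: closed_ge.
move=> q /= eh; apply: hK; apply: contraTneq eh => ->.
by rewrite cmod0 -ltNge.
Qed.

(* [f - u f = (w (1 - u)) f] for any cutoff [w] equal to [1] on the range of
   the support of [f], and [w (1 - u)] vanishes at [q]. *)
Lemma fibre_ideal_cutoff q u f : Cc act f -> cutoff setT u -> u q = 1 ->
  J q (emb (mulu u f) - emb f).
Proof.
move=> Cf uc uq; have [w wc w1] := cutoff_range Cf.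
pose h q' := (w q' * (u q' - 1))%:C : R[i].
have [cu u01 uQ] := uc; have [cw w01 wQ] := wc.
have hc : ccin setT h.
  rewrite (_ : h = fun q' => (u q' - 1)%:C * (w q')%:C).
    apply: ccinMl => //; apply: continuousC_real => x.
    by apply: cvgB; [exact: cu|exact: cvg_cst].
  by apply/funext => q'; rewrite /h mulrC rmorphM.
have hc1 : ccin (fixint act 1%g) h by exact: ccin_fix1 hc.
have -> : emb (mulu u f) - emb f = cmul (emb (extend_units h)) (emb f).
  rewrite -embM//; last by rewrite extend_unitsE; exact: Cc_sgl.
  rewrite extend_unitsE conv_sgll// -scaleN1r addrC -emb_lin//; last exact: Cc_mulu.
  congr emb; apply: fn_ext => g q'.
  rewrite /lincomb /mulu /lbl /src /= invg1 mul1g /h.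
  have [->|/w1 ->] := eqVneq (f (mk_arrow g q')) 0; first by rewrite !mulr0 addr0.
  by rewrite mul1r rmorphB mulrBl mul1r mulN1r addrC.
have [_ _ _ _ Jr] := fibre_ideal_closed q; apply: Jr.
apply: (@fibre_ideal_gen q h); first exact: ccin_C0.
  by rewrite /h uq subrr mulr0.
move=> e e0; exists h; split; first exact/(ccin_Cc hQ).
  by move=> q'; rewrite subrr cmod0 ltW.
by rewrite subrr nrm0 ltW.
Qed.

End FibreIdeals.

(** * Representations of the convolution algebra from a representation of the group and a point *)

Section GroupReps.
Context {R : realType} {G : groupType} {Q : topologicalType} {act : G -> Q -> Q}.
Hypotheses (lcQ : locally_compact [set: Q]) (hQ : hausdorff_space Q)
  (act_homeo : action_by_homeo act).
Local Notation fn := (arrow G Q -> R[i]).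
Implicit Types (f k : fn) (q : Q) (F : {fset G}).

Lemma fsbig_supp_fset (V : zmodType) (F : {fset G}) (phi : G -> V) :
  (forall g, g \notin F -> phi g = 0) ->
  \sum_(g \in [set: G]) phi g = \sum_(g <- F) phi g.
Proof.
move=> H; rewrite -(@fsbig_widen _ _ _ _ [set` F])//; last first.
  by move=> g [_ /= /negP gF]; exact: H.
by rewrite fsbig_finite//= set_fsetK.
Qed.

(** [V 1] is only a self-adjoint idempotent: this accommodates the representations induced from
    strong limits, for which it is a projection that may be proper. *)
Definition grep (K : hilbert R) (V : G -> {linear K -> K}) :=
  (forall g h x, V (g * h)%g x = V g (V h x)) /\
  (forall g x y, ip (V g x) y = ip x (V g^-1%g y)).

Section Grep.
Variables (K : hilbert R) (V : G -> {linear K -> K}).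
Hypothesis VP : grep V.

Lemma grepM g h x : V (g * h)%g x = V g (V h x). Proof. by case: VP. Qed.
Lemma grep_adj g x y : ip (V g x) y = ip x (V g^-1%g y). Proof. by case: VP. Qed.

(** [V g^-1 V g = V 1] is a self-adjoint idempotent, hence a contraction, and
    [|V g x|^2 = <V 1 x, x>]. *)
Lemma grep_le g x : nrm (V g x) <= nrm x.
Proof.
have V1 y : nrm (V 1%g y) <= nrm y.
  apply: nrm_sq_le; first exact: nrm_ge0.
  rewrite -Re_ip -{2}(invg1 G) -grep_adj -grepM mulg1 mulrC.
  exact: Re_ip_le.
rewrite -(@ler_pXn2r _ 2)// ?nnegrE ?nrm_ge0// -[leLHS]Re_ip.
rewrite -{2}(invgK g) -grep_adj -grepM mulVg (le_trans (Re_ip_le _ _))//.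
by rewrite expr2 ler_wpM2r ?nrm_ge0.
Qed.

Variable q : Q.

(** [star_rep] takes a linear map for every function, even outside [Cc]; when the support over [q]
    is infinite, [fset_set] is empty and [gev] is 0. *)
Definition gevs f := fset_set [set g | f (mk_arrow g q) != 0].

Definition gev f (x : K) : K := \sum_(g <- gevs f) f (mk_arrow g q) *: V g x.

Lemma gev_linear f : linear (gev f).
Proof.
move=> t x y; rewrite /gev scaler_sumr -big_split /=; apply: eq_bigr => g _.
by rewrite linearP scalerDr !scalerA mulrC.
Qed.

HB.instance Definition _ f := GRing.isLinear.Build R[i] K K _ (gev f) (gev_linear f).

Lemma gevE f F x : suppF F f -> gev f x = \sum_(g <- F) f (mk_arrow g q) *: V g x.
Proof.
move=> fF; rewrite -fsbig_supp_fset; last by move=> g /(fF g q) ->; rewrite scale0r.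
rewrite (@fsbig_supp_fset _ (gevs f))// => g.
rewrite in_fset_set; last first.
  apply: (@sub_finite_set _ _ [set` F]) => //= h /= hf.
  by apply: contraR hf => /(fF h q) ->.
rewrite -[_ \in _]/(_ \in _) => /negP; rewrite inE => /negP.
by rewrite negbK => /eqP ->; rewrite scale0r.
Qed.

Lemma gev_le f F x : suppF F f ->
  nrm (gev f x) <= (\sum_(g <- F) cmod (f (mk_arrow g q))) * nrm x.
Proof.
move=> fF; rewrite (gevE _ fF) (le_trans (nrm_sum _ _ _))// mulr_suml.
by apply: ler_sum => g _; rewrite nrmZ ler_wpM2l ?cmod_ge0// grep_le.
Qed.

Lemma gev_units h x : ccin setT h -> nrm (gev (extend_units h) x) <= cmod (h q) * nrm x.
Proof.
move=> hc; rewrite extend_unitsE (gevE _ (@suppF_sgl _ _ _ 1%g h)) big_seq_fset1.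
by rewrite sglE eqxx nrmZ ler_wpM2l ?cmod_ge0// grep_le.
Qed.

(** Over a fixed point [q], convolution and involution are those of the group algebra;
    multiplicativity is the substitution [g -> h g] in the inner sum, and the adjoint is the
    substitution [g -> g^-1]. *)
Lemma gev_star_rep : star_rep act (fun f => [the {linear K -> K} of gev f]).
Proof.
split => /=.
- move=> f /Cc_supp[F fF]; apply: bound_continuous => x; exact: gev_le fF.
- move=> t f k x Cf Ck; have [F [fF kF]] := Cc_supp2 Cf Ck.
  rewrite (gevE _ fF) (gevE _ kF) (@gevE _ F); last first.
    by move=> g q' gF; rewrite /lincomb fF// kF// mulr0 addr0.
  rewrite scaler_sumr -big_split; apply: eq_bigr => g _ /=.
  by rewrite /lincomb scalerDl scalerA.
- move=> f k x Cf Ck; have [F [fF kF]] := Cc_supp2 Cf Ck.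
  pose F3 := [fset (x * y)%g | x in F, y in F]%fset.
  have F3P g h : h \in F -> g \notin F3 -> k (mk_arrow (h^-1 * g)%g q) = 0.
    move=> hF gF; apply: kF; apply: contra gF => hg.
    by apply/imfset2P; exists h => //; exists (h^-1 * g)%g => //; rewrite mulVKg.
  rewrite (@gevE _ F3); last first.
    move=> g q' gF; rewrite (convE _ _ Cf Ck fF) big_seq big1// => h hF.
    rewrite [k _]kF ?mulr0//; apply: contra gF => hg.
    by apply/imfset2P; exists h => //; exists (h^-1 * g)%g => //; rewrite mulVKg.
  rewrite (gevE _ fF) (gevE _ kF).
  under eq_bigr do rewrite (convE _ _ Cf Ck fF) scaler_suml.
  rewrite exchange_big /= big_seq [RHS]big_seq; apply: eq_bigr => h hF.
  under eq_bigr do rewrite -scalerA.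
  rewrite -scaler_sumr; congr (_ *: _).
  rewrite -(@fsbig_supp_fset _ F3); last by move=> g /(F3P g h hF) ->; rewrite scale0r.
  rewrite (reindex_fsbigT (fun g : G => (h * g)%g)); last first.
    by exists (fun g => (h^-1 * g)%g) => g; rewrite (mulKg, mulVKg).
  rewrite (@fsbig_supp_fset _ F); last first.
    by move=> g gF; rewrite mulKg kF// scale0r.
  rewrite linear_sum; apply: eq_bigr => g _.
  by rewrite mulKg linearZ /= grepM.
- move=> f x y Cf; have [F fF] := Cc_supp Cf.
  pose F' := [fset x^-1%g | x in F]%fset.
  have F'P g : g \notin F' -> g^-1%g \notin F.
    by apply: contra => gF; apply/imfsetP; exists g^-1%g => //; rewrite invgK.
  rewrite (gevE _ fF) (@gevE _ F'); last first.
    by move=> g q' /F'P gF; rewrite involE// fF// rmorph0.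
  have ipsl (F0 : {fset G}) (z : G -> K) w : ip (\sum_(g <- F0) z g) w = \sum_(g <- F0) ip (z g) w.
    elim: (enum_fset F0) => [|a s IH]; rewrite ?big_nil ?ip0l// !big_cons ipDl IH//.
  have ipsr (F0 : {fset G}) (z : G -> K) w : ip w (\sum_(g <- F0) z g) = \sum_(g <- F0) ip w (z g).
    elim: (enum_fset F0) => [|a s IH]; rewrite ?big_nil ?ip0r// !big_cons ipDr IH//.
  rewrite ipsl ipsr -(@fsbig_supp_fset _ F); last by move=> g /(fF g q) ->; rewrite scale0r ip0l.
  rewrite -(@fsbig_supp_fset _ F'); last first.
    by move=> g /F'P gF; rewrite involE// fF// rmorph0 scale0r ip0r.
  rewrite [RHS](reindex_fsbigT (fun g : G => g^-1%g)); last by exists (fun g => g^-1%g); exact: invgK.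
  apply: eq_fsbigr => g _; rewrite involE// invgK ipZl ipZr conjCK.
  by rewrite grep_adj.
Qed.

End Grep.
End GroupReps.

(** * Strong limits along cutoffs *)

Section StrongLimit.
Context {R : realType} {G : groupType} {Q : topologicalType} {act : G -> Q -> Q}.
Hypotheses (lcQ : locally_compact [set: Q]) (hQ : hausdorff_space Q)
  (act_homeo : action_by_homeo act).
Local Notation fn := (arrow G Q -> R[i]).
Variables (H : hilbert R) (pi : fn -> {linear H -> H}).
Hypothesis piP : star_rep act pi.
Variables (W : set Q) (w : Q -> R).
Hypothesis wW : cutoff W w.

Definition pstab : set G := [set g | W `<=` fixint act g].

Lemma pstab1 : pstab 1%g.
Proof. by move=> q _; exact: stab1. Qed.
Lemma pstabM g h : pstab g -> pstab h -> pstab (g * h)%g.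
Proof. by move=> Lg Lh q Wq; apply: stabM => //; [exact: Lg|exact: Lh]. Qed.
Lemma pstabV g : pstab g -> pstab g^-1%g.
Proof. by move=> Lg q Wq; apply: stabV => //; exact: Lg. Qed.

(** Increases with [n] to the indicator function of [w > 0], and is 1 for every [n] where
    [w = 1]. *)
Definition ramp (n : nat) (q : Q) : R := Num.min 1 (n.+1%:R * w q).

Lemma ramp01 n q : 0 <= ramp n q <= 1.
Proof.
case: wW => _ w01 _; have /andP[w0 _] := w01 q.
by rewrite /ramp le_min ler01 ge_min lexx mulr_ge0.
Qed.

Lemma ramp_mono n m q : (n <= m)%N -> ramp n q <= ramp m q.
Proof.
case: wW => _ w01 _; have /andP[w0 _] := w01 q => nm.
rewrite /ramp le_min ge_min lexx /= ge_min; apply/orP; right.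
by rewrite ler_wpM2r// ler_nat.
Qed.

(** The product vanishes where [(m + 1) w >= 1]; elsewhere [w < 1 / (m + 1)] and
    [ramp n <= (n + 1) w]. So [u_n u_m] tends to [u_n] uniformly as [m] grows, which is what makes
    the strong limits multiplicative. *)
Lemma ramp_prod n m q : ramp n q * (1 - ramp m q) <= n.+1%:R / m.+1%:R.
Proof.
case: wW => _ w01 _; have /andP[w0 _] := w01 q.
have /andP[r0 r1] := ramp01 n q; have /andP[s0 s1] := ramp01 m q.
have m0 : 0 < m.+1%:R :> R by [].
have [mw|mw] := leP 1 (m.+1%:R * w q).
  by rewrite /ramp (min_l mw) subrr mulr0 divr_ge0.
apply: (@le_trans _ _ (ramp n q)); first by rewrite ler_piMr// gerBl.
rewrite (@le_trans _ _ (n.+1%:R * w q))//; first by rewrite /ramp ge_min lexx orbT.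
by rewrite ler_wpM2l// -[leRHS]mul1r ler_pdivlMr// mulrC ltW.
Qed.

Lemma continuous_ramp n : continuous (ramp n).
Proof.
move=> q; apply: (@continuous_min R Q (fun=> 1) (fun q => n.+1%:R * w q) q).
  exact: cvg_cst.
by apply: cvgM; [exact: cvg_cst|case: wW => cw _ _; exact: cw].
Qed.

Lemma ccin_ramp n g : pstab g -> ccin (fixint act g) (fun q => (ramp n q)%:C).
Proof.
move=> Lg; case: wW => _ _ wc; apply: (ccin_mono Lg); apply: (ccin_sub wc).
  exact/continuousC_real/continuous_ramp.
by move=> q [wq]; rewrite /ramp wq mulr0 min_r.
Qed.

Local Notation u := (fun g n => sgl g (fun q => (ramp n q)%:C)).

Lemma rep_sgl_sq g h x : ccin (fixint act g) h ->
  nrm (pi (sgl g h) x) ^+ 2 =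
  complex.Re (ip (pi (sgl 1%g (fun q => (cmod (h q) ^+ 2)%:C)) x) x).
Proof.
move=> hg; rewrite -Re_ip -(rep_square hQ act_homeo piP)//; last exact: Cc_sgl.
rewrite invol_sgl// conv_sgl//; last by apply: ccinJ; apply: ccin_mono hg => q; exact: stabV.
by rewrite mulVg; congr (complex.Re (ip (pi (sgl _ _) _) _)); apply/funext => q; rewrite cmod_sqr.
Qed.

Let s n x : R := complex.Re (ip (pi (u 1%g n) x) x).

Lemma ccin_ramp_setT n : ccin setT (fun q => (ramp n q)%:C : R[i]).
Proof. by apply: ccin_mono (@ccin_ramp n 1%g pstab1) => q. Qed.

Lemma ramp_sum_le n x : s n x <= nrm x ^+ 2.
Proof.
rewrite (le_trans (Re_ip_le _ _))// expr2 ler_wpM2r ?nrm_ge0//.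
apply: (rep_units_le1 hQ act_homeo piP); split; [exact: continuous_ramp|exact: ramp01|].
exact: ccin_ramp_setT.
Qed.

Lemma sgl_sub g (h k : Q -> R[i]) x : ccin (fixint act g) h -> ccin (fixint act g) k ->
  pi (sgl g (fun q => h q - k q)) x = pi (sgl g h) x - pi (sgl g k) x.
Proof.
move=> hg kg; have := rep_sgl_lin hQ piP (-1) x kg hg.
rewrite scaleN1r addrC => <-; congr (pi (sgl _ _) _); apply/funext => q.
by rewrite mulN1r addrC.
Qed.

Lemma ccinB O (h k : Q -> R[i]) : ccin O h -> ccin O k -> ccin O (fun q => h q - k q).
Proof.
move=> hO kO; rewrite (_ : (fun _ => _) = fun q => h q + (-1) * k q).
  by apply: ccinD => //; apply: ccinMl => //; exact: continuousC_cst.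
by apply/funext => q; rewrite mulN1r.
Qed.

(* [(u_m - u_n)^2 <= u_m - u_n], so the increments of [pi (u_n delta_g) x] are
   controlled by those of the bounded increasing sequence [<pi (u_n) x, x>]. *)
Lemma ramp_dist g n m x : pstab g -> (n <= m)%N ->
  nrm (pi (u g m) x - pi (u g n) x) ^+ 2 <= s m x - s n x.
Proof.
move=> Lg nm; have cm := ccin_ramp m Lg; have cn := ccin_ramp n Lg.
have cm1 := ccin_ramp m pstab1; have cn1 := ccin_ramp n pstab1.
rewrite -sgl_sub// rep_sgl_sq; last exact: ccinB.
have -> : s m x - s n x = 1 * complex.Re (ip (pi (sgl 1%g (fun q => (ramp m q - ramp n q)%:C)) x) x).
  have -> : (fun q => (ramp m q - ramp n q)%:C : R[i]) = (fun q => (ramp m q)%:C - (ramp n q)%:C).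
    by apply/funext => q; rewrite rmorphB.
  rewrite sgl_sub// ipBl mul1r /s; by move: (ip _ _) (ip _ _) => [a b] [c d].
have D01 q : 0 <= ramp m q - ramp n q <= 1.
  rewrite subr_ge0 ramp_mono//= lerBlDr.
  have /andP[_ /le_trans] := ramp01 m q; apply.
  by rewrite lerDl; case/andP: (ramp01 n q).
have E q : cmod ((ramp m q)%:C - (ramp n q)%:C) ^+ 2 = (ramp m q - ramp n q) ^+ 2.
  by rewrite -rmorphB cmodR real_normK// num_real.
have cB : ccin setT (fun q => (ramp m q - ramp n q)%:C : R[i]).
  rewrite (_ : (fun _ => _) = fun q => (ramp m q)%:C - (ramp n q)%:C).
    by apply: ccinB; exact: ccin_ramp_setT.
  by apply/funext => q; rewrite rmorphB.
have contB : continuous (fun q => ramp m q - ramp n q).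
  by move=> q; apply: cvgB; exact: continuous_ramp.
rewrite (_ : (fun q => (cmod _ ^+ 2)%:C) = fun q => ((ramp m q - ramp n q) * (ramp m q - ramp n q))%:C); last first.
  by apply/funext => q; rewrite E expr2.
apply: (rep_units_mono hQ act_homeo piP) => //.
- rewrite (_ : (fun _ => _) = fun q => (ramp m q - ramp n q)%:C * (ramp m q - ramp n q)%:C).
    by apply: ccinMl => //; case: cB.
  by apply/funext => q; rewrite rmorphM.
- by move=> q; apply: cvgM; exact: contB.
- by move=> q; have /andP[d0 d1] := D01 q; rewrite mul1r ler_piMr.
Qed.

Lemma ramp_cvg g x : pstab g -> cvg (pi (u g n) x @[n --> \oo]).
Proof.
move=> Lg; apply: cauchy_seq_cvg => e e0.
have sup_s : has_sup (range (s ^~ x)).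
  split; first by exists (s 0%N x), 0%N.
  by exists (nrm x ^+ 2) => _ [n _ <-]; exact: ramp_sum_le.
have e2 : 0 < e ^+ 2 by rewrite exprn_gt0.
have [_ [N _ <-] HN] := sup_adherent e2 sup_s.
have smono n m : (n <= m)%N -> s n x <= s m x.
  by move=> nm; rewrite -subr_ge0 (le_trans _ (ramp_dist x Lg nm))// exprn_ge0 ?nrm_ge0.
have key n m : (N <= n)%N -> (n <= m)%N -> nrm (pi (u g m) x - pi (u g n) x) <= e.
  move=> Nn nm; rewrite -(@ler_pXn2r _ 2)// ?nnegrE ?nrm_ge0 ?(ltW e0)//.
  rewrite (le_trans (ramp_dist x Lg nm))// lerBlDl -lerBlDr.
  rewrite (le_trans _ (smono _ _ Nn))// (le_trans _ (ltW HN))// lerB//.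
  by apply: ub_le_sup; [exact: sup_s.2|exists m].
exists N => n m Nn Nm; have [nm|/ltnW mn] := leqP n m; last exact: key.
by rewrite nrmBC key.
Qed.

Definition slim (g : G) (x : H) : H := lim (pi (u g n) x @[n --> \oo]).

Lemma slim_cvg g x : pstab g -> pi (u g n) x @[n --> \oo] --> slim g x.
Proof. exact: ramp_cvg. Qed.

Lemma slim_linear g t x y : pstab g -> slim g (t *: x + y) = t *: slim g x + slim g y.
Proof.
move=> Lg; apply: (@cvg_unique_nrm _ _ _ \oo _ (fun n => pi (u g n) (t *: x + y))).
  exact: slim_cvg.
under eq_fun do rewrite linearP.
by apply: cvgD; [apply: cvgZr|]; exact: slim_cvg.
Qed.

Lemma slim_adj g x y : pstab g -> ip (slim g x) y = ip x (slim g^-1%g y).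
Proof.
move=> Lg; apply: (@cvg_unique_nrm _ R[i]^o _ \oo _ (fun n => ip (pi (u g n) x) y)).
  by apply: ip_cvgl; exact: slim_cvg.
have -> : (fun n => ip (pi (u g n) x) y) = (fun n => Num.conj (ip (pi (u g^-1%g n) y) x)).
  apply/funext => n; rewrite -ip_conj (rep_adj piP); last by apply/Cc_sgl/ccin_ramp.
  rewrite invol_sgl//; last exact: ccin_ramp.
  by congr (ip _ (pi (sgl _ _) _)); apply/funext => q; rewrite conjR.
rewrite [ip x _]ip_conj; apply/cvg_nrm => e e0.
have /cvg_nrm/(_ e e0) := ip_cvgl (z := x) (@slim_cvg _ y (pstabV Lg)).
by apply: filterS => n; rewrite -rmorphB => h; rewrite -[nrm _]/(cmod _) cmodJ.
Qed.

(** With [n] fixed, [u_n u_m] tends to [u_n] in norm, so only the limit in [m] is taken here;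
    [slimM] then takes the one in [n], and no double limit occurs. *)
Lemma slim_rep g h n x : pstab g -> pstab h ->
  pi (u g n) (slim h x) = pi (u (g * h)%g n) x.
Proof.
move=> Lg Lh; have Lgh := pstabM Lg Lh.
have cg := ccin_ramp n Lg; have cgh := ccin_ramp n Lgh.
apply: (@cvg_unique_nrm _ _ _ \oo _ (fun m => pi (u g n) (pi (u h m) x))).
  have [cpi _ _ _] := piP.
  apply: (cvg_comp _ _ (@slim_cvg _ x Lh)); exact/cpi/Cc_sgl.
apply/cvg_nrm => e e0.
have x1 : 0 < n.+1%:R * (nrm x + 1) by rewrite mulr_gt0// ltr_wpDl ?nrm_ge0.
exists (Num.trunc (n.+1%:R * (nrm x + 1) / e)) => // m /= Nm.
have ch := ccin_ramp m Lh.
rewrite -(repM piP); [|exact: Cc_sgl..].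
rewrite conv_sgl// -sgl_sub//; last first.
  apply: ccin_sub cgh _ _; first by apply: continuousCM; [case: cg|case: ch].
  by move=> q ->; rewrite mul0r.
apply: (@le_trans _ _ (n.+1%:R / m.+1%:R * nrm x)).
  apply: (rep_sgl_le lcQ hQ act_homeo piP).
  - apply: ccinB => //; apply: ccin_sub cgh _ _; first by apply: continuousCM; [case: cg|case: ch].
    by move=> q ->; rewrite mul0r.
  - by rewrite divr_ge0.
  - move=> q; rewrite -rmorphM -rmorphB cmodR -{1}[ramp n q]mulr1 -mulrBr.
    rewrite ger0_norm ?ramp_prod// mulr_ge0 ?subr_ge0//.
      by case/andP: (ramp01 n q).
    by case/andP: (ramp01 m q).
rewrite mulrAC ler_pdivrMr//; apply: (@le_trans _ _ (n.+1%:R * (nrm x + 1))).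
  by rewrite ler_wpM2l// lerDl.
rewrite [leRHS]mulrC -ler_pdivrMr// (le_trans (ltW (truncnS_gt _)))// ler_nat.
exact: Nm.
Qed.

Lemma slimM g h x : pstab g -> pstab h -> slim (g * h)%g x = slim g (slim h x).
Proof.
move=> Lg Lh; apply: (@cvg_unique_nrm _ _ _ \oo _ (fun n => pi (u (g * h)%g n) x)).
  exact/slim_cvg/pstabM.
under eq_fun do rewrite -slim_rep//.
exact: slim_cvg.
Qed.

Lemma slim_le g x : pstab g -> nrm (slim g x) <= nrm x.
Proof.
move=> Lg; apply: (@nrm_cvg_le _ H _ _ _ (@slim_cvg _ x Lg)); exists 0%N => // n _.
rewrite -[leRHS]mul1r; apply: (rep_sgl_le lcQ hQ act_homeo piP) => //; first exact: ccin_ramp.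
by move=> q; rewrite cmodR; have /andP[r0 r1] := ramp01 n q; rewrite ger0_norm.
Qed.

(** Wherever [k] is nonzero all the ramps are 1, so the sequence defining the limit is constant. *)
Lemma slim_sgl g (k : Q -> R[i]) x : pstab g -> ccin W k -> (forall q, k q != 0 -> w q = 1) ->
  slim g (pi (sgl 1%g k) x) = pi (sgl g k) x.
Proof.
move=> Lg kW kw; apply: (@cvg_unique_nrm _ _ _ \oo _ (fun n => pi (u g n) (pi (sgl 1%g k) x))).
  exact: slim_cvg.
have k1 : ccin (fixint act 1%g) k by exact: ccin_fix1 kW.
rewrite (_ : (fun _ => _) = fun=> pi (sgl g k) x); first exact: cvg_cst.
apply/funext => n; have cg := ccin_ramp n Lg.
rewrite -(repM piP); [|exact: Cc_sgl..].
rewrite conv_sgl// mulg1; congr (pi (sgl _ _) _); apply/funext => q.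
have [->|/kw wq] := eqVneq (k q) 0; first by rewrite mulr0.
by rewrite /ramp wq mulr1 min_l ?mul1r// ler1n.
Qed.

End StrongLimit.

(** * Induced representations and the full fibre norms *)

Section Induced.
Context {R : realType} {G : groupType}.
Variables (H : hilbert R) (L : set G) (U : G -> H -> H).
Hypotheses (L1 : L 1%g) (LM : forall g h, L g -> L h -> L (g * h)%g)
  (LV : forall g, L g -> L g^-1%g).
Hypotheses
  (U_linear : forall g t x y, L g -> U g (t *: x + y) = t *: U g x + U g y)
  (UM : forall g h x, L g -> L h -> U (g * h)%g x = U g (U h x))
  (U_adj : forall g x y, L g -> ip (U g x) y = ip x (U g^-1%g y))
  (U_le : forall g x, L g -> nrm (U g x) <= nrm x).
Implicit Types (g h s t : G) (xi eta : l2 G H).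

(* The coset [L] is represented by [1], the point supporting [delta x] below. *)
Definition coset_repr t : G :=
  if `[< L t >] then 1%g else xget 1%g [set s | L (s^-1 * t)%g].

Lemma coset_reprP t : L ((coset_repr t)^-1 * t)%g.
Proof.
rewrite /coset_repr; case: asboolP => Lt; first by rewrite invg1 mul1g.
by case: xgetP => [s _ //|/(_ t)]; rewrite /= mulVg => /(_ L1).
Qed.

Lemma coset_repr_eq s t : L (s^-1 * t)%g -> coset_repr s = coset_repr t.
Proof.
move=> Lst; have Lts : L (t^-1 * s)%g by rewrite -[s]invgK -invgM; exact: LV.
have -> : coset_repr s = coset_repr t => //; rewrite /coset_repr.
have -> : L s = L t.
  apply/propext; split=> Lx; first by rewrite -(mulVKg s t); exact: LM.
  by rewrite -(mulVKg t s); exact: LM.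
case: ifP => // _; congr xget; apply/funext => r; apply/propext; split=> /= Lx.
  by rewrite -(mulVKg s t) mulgA; exact: LM.
by rewrite -(mulVKg t s) mulgA; exact: LM.
Qed.

Lemma coset_reprK t : coset_repr (coset_repr t) = coset_repr t.
Proof. by apply: coset_repr_eq; exact: coset_reprP. Qed.

Lemma coset_repr1 t : L t -> coset_repr t = 1%g.
Proof. by move=> Lt; rewrite /coset_repr; case: asboolP. Qed.

Definition isrepr t := coset_repr t == t.

(** The action of [g^-1] on the left cosets of [L], read on representatives. It fails to match left
    multiplication in [G] by the element of [L] in [L_cocycle]. *)
Local Notation nxt g t := (coset_repr (g^-1 * t)%g).

Lemma isrepr_nxt g t : isrepr (nxt g t).
Proof. by rewrite /isrepr coset_reprK. Qed.

Lemma nxtK g t : isrepr t -> nxt g^-1%g (nxt g t) = t.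
Proof.
move=> /eqP tt; rewrite invgK -[RHS]tt; apply: coset_repr_eq.
by have := coset_reprP (g^-1 * t)%g; rewrite invgM -mulgA.
Qed.

Lemma nxt_mul g h t : nxt h (nxt g t) = nxt (g * h)%g t.
Proof.
apply: coset_repr_eq; have := coset_reprP (g^-1 * t)%g.
by rewrite !invgM !invgK -!mulgA mulVKg.
Qed.

Lemma L_cocycle g t : L (t^-1 * g * nxt g t)%g.
Proof.
have /LV := coset_reprP (g^-1 * t)%g.
by rewrite !invgM !invgK.
Qed.

(** The induced representation on l^2 of [G/L] with values in [H], realized by functions on all of
    [G] that are supported on the coset representatives. *)
Definition ind_fun g (xi : G -> H) t : H :=
  if isrepr t then U (t^-1 * g * nxt g t)%g (xi (nxt g t)) else 0.

Lemma nxt_inj g s t : isrepr s -> isrepr t -> nxt g s = nxt g t -> s = t.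
Proof. by move=> s1 t1 st; rewrite -(nxtK g s1) st nxtK. Qed.

Lemma sum_repr (V : nmodType) g (F : G -> V) (D : {fset G}) :
  \sum_(t <- D | isrepr t) F (nxt g t) =
  \sum_(s <- [fset nxt g t | t in [fset t in D | isrepr t]]%fset) F s.
Proof.
rewrite big_imfset /=; first by rewrite big_fset_condE.
by move=> s t; rewrite !inE /= => /andP[_ s1] /andP[_ t1]; exact: nxt_inj.
Qed.

Lemma ind_fun_sum g xi D : sqsum (ind_fun g xi) D <= nrm xi ^+ 2.
Proof.
rewrite (le_trans _ (l2_sqsum_le xi [fset nxt g t | t in [fset t in D | isrepr t]]%fset))//.
rewrite /sqsum -(@sum_repr _ g (fun s => nrm (xi s) ^+ 2)) [leRHS]big_mkcond /=.
apply: ler_sum => t _; rewrite /ind_fun; case: ifP => _; last by rewrite nrm0 expr0n.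
by rewrite ler_pXn2r ?nnegrE ?nrm_ge0// U_le//; exact: L_cocycle.
Qed.

Lemma ind_fun_sqsummable g xi : ind_fun g xi \in sqsummable.
Proof. by apply/sqsummableP; exists (nrm xi ^+ 2) => D; exact: ind_fun_sum. Qed.

Definition ind g xi : l2_hilbert G H := L2 (ind_fun_sqsummable g xi).

Lemma ind_linear g : linear (ind g : l2_hilbert G H -> l2_hilbert G H).
Proof.
move=> t xi eta; apply: l2_ext => s.
rewrite [RHS]l2D l2Z /ind /= /ind_fun; case: ifP => _; last by rewrite scaler0 addr0.
by rewrite -U_linear//; exact: L_cocycle.
Qed.

Definition ind_map g : {linear l2_hilbert G H -> l2_hilbert G H} :=
  HB.pack (ind g) (GRing.isLinear.Build R[i] (l2_hilbert G H) (l2_hilbert G H) _ (ind g) (ind_linear g)).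

Lemma indM g h xi : ind (g * h)%g xi = ind g (ind h xi).
Proof.
apply: l2_ext => t; rewrite /ind /= {1 2}/ind_fun; case: ifP => // t1.
rewrite /ind_fun isrepr_nxt -UM; [|exact: L_cocycle..].
rewrite nxt_mul; congr (U _ _); rewrite -!mulgA mulVKg; done.
Qed.

Lemma ind_adj g xi eta : @ip _ (l2_hilbert G H) (ind g xi) eta = @ip _ (l2_hilbert G H) xi (ind g^-1%g eta).
Proof.
apply/eqP; rewrite -subr_eq0; apply/eqP; apply: (@eps_eq0 _ R[i]^o) => e e0.
have e2 : 0 < e / 2 by rewrite divr_gt0.
have [D0 H0] := l2ip_approx (ind g xi) eta e2.
have [D1 H1] := l2ip_approx xi (ind g^-1%g eta) e2.
(* [D] is enlarged so that its image [E] under [nxt g] contains every representative lying in [D1].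
   The points of [D1] outside [E] are then no representatives, [ind g^-1 eta] vanishes there, and
   the two finite sums agree exactly. *)
pose D := (D0 `|` [fset nxt g^-1%g s | s in [fset s in D1 | isrepr s]])%fset.
pose E := [fset nxt g t | t in [fset t in D | isrepr t]]%fset.
pose D' := (D1 `|` E)%fset.
have DE : ipD (ind g xi) eta D = ipD xi (ind g^-1%g eta) D'.
  transitivity (\sum_(t <- D | isrepr t) ip (xi (nxt g t)) (ind g^-1%g eta (nxt g t))).
    rewrite /ipD [RHS]big_mkcond /=; apply: eq_bigr => t _.
    rewrite /ind_fun isrepr_nxt; case: ifP => t1; last by rewrite ip0l.
    rewrite U_adj; last exact: L_cocycle.
    by rewrite !nxtK// !invgM !invgK mulgA.
  rewrite (@sum_repr _ g (fun s => ip (xi s) (ind g^-1%g eta s))) -/E.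
  rewrite /ipD; apply: big_fset_incl; first by apply/fsubsetP => x xE; rewrite inE xE orbT.
  move=> s; rewrite inE => /orP[sD1|->//] sE; rewrite /ind /= /ind_fun.
  case: ifP => s1; last by rewrite ip0r.
  move/negP: sE; case; apply/imfsetP; exists (nxt g^-1%g s); last first.
    by rewrite -{1}(nxtK g^-1%g s1) invgK.
  rewrite !inE /= isrepr_nxt andbT; apply/orP; right.
  by apply/imfsetP; exists s => //; rewrite !inE /= sD1 s1.
have {}H0 := H0 D (fsubsetUl _ _); have {}H1 := H1 D' (fsubsetUl _ _).
rewrite -[nrm _]/(cmod _) (_ : _ - _ = (l2ip (ind g xi) eta - ipD (ind g xi) eta D)
  - (l2ip xi (ind g^-1%g eta) - ipD xi (ind g^-1%g eta) D')); last first.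
  by rewrite DE opprB addrA subrK.
by rewrite [leRHS]splitr (le_trans (cmodD _ _))// cmodN lerD.
Qed.

Lemma ind_grep : grep ind_map.
Proof. by split=> [g h xi|g xi eta]; [exact: indM|exact: ind_adj]. Qed.

Definition delta_fun (x : H) t : H := if t == 1%g then x else 0.

Lemma delta_sum x D : sqsum (delta_fun x) D <= nrm x ^+ 2.
Proof.
rewrite /sqsum; have [D1|D1] := boolP (1%g \in D); last first.
  rewrite big_seq big1 ?exprn_ge0 ?nrm_ge0// => t tD; rewrite /delta_fun ifN ?nrm0 ?expr0n//.
  by apply: contraNneq D1 => <-.
rewrite (big_fsetD1 1%g)//= {1}/delta_fun eqxx big_seq big1 ?addr0// => t.
by rewrite !inE /delta_fun => /andP[/negPf -> _]; rewrite nrm0 expr0n.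
Qed.

Lemma delta_sqsummable x : delta_fun x \in sqsummable.
Proof. by apply/sqsummableP; exists (nrm x ^+ 2) => D; exact: delta_sum. Qed.

Definition delta (x : H) : l2_hilbert G H := L2 (delta_sqsummable x).

Lemma delta_nrm x : nrm (delta x) <= nrm x.
Proof. by apply: l2_nrm_le; [exact: nrm_ge0|exact: delta_sum]. Qed.

(** On the trivial coset the induced representation restricts to [U] itself, which is why induction
    from [L] does not decrease norms. *)
Lemma ind_delta g x : L g -> (ind_map g (delta x) : l2 G H) 1%g = U g x.
Proof.
move=> Lg; rewrite /= /ind_fun /isrepr coset_repr1// eqxx.
rewrite coset_repr1; last by rewrite mulg1; exact: LV.
by rewrite /delta_fun eqxx invg1 mul1g mulg1.
Qed.

End Induced.

(** * Continuity of the full fibre norms *)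

Section FullContinuity.
Context {R : realType} {G : groupType} {Q : topologicalType} {act : G -> Q -> Q}.
Hypotheses (lcQ : locally_compact [set: Q]) (hQ : hausdorff_space Q)
  (act_homeo : action_by_homeo act).
Variable A : fullCstar R act.
Local Notation fn := (arrow G Q -> R[i]).
Local Notation emb := (full_emb A).
Implicit Types (f k : fn) (q : Q) (F : {fset G}).

Lemma near_fset (I : choiceType) (F : {fset I}) (P : I -> Q -> Prop) q :
  (forall i, \forall q' \near q, P i q') -> \forall q' \near q, forall i, i \in F -> P i q'.
Proof.
move=> HP; elim/fset1U_rect : F => [|a F aF IH]; first by apply: filterS filterT.
apply: filterS (filterI (HP a) IH) => q' [Pa PF] i.
by rewrite !inE => /predU1P[->//|/PF].
Qed.

(** The extension to the full algebra kills the fibre ideal at [q], so it is bounded by the norm of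
    every representative modulo that ideal. *)
Lemma gev_le_p_full (K : hilbert R) (V : G -> {linear K -> K}) q f (x : K) :
  grep V -> Cc act f -> nrm x <= 1 -> nrm (gev V q f x) <= p_full (A := A) q (emb f).
Proof.
move=> VP Cf x1; have [rho rhoP rhof] := ext_rep lcQ hQ act_homeo A (gev_star_rep act_homeo VP q).
apply: p_fibre_ge => j Jj.
have rj : rho j x = 0.
  apply: (crep_fibre_ideal rhoP) Jj _ => h y Ch.
  rewrite rhof; last exact: Cc_units.
  by apply: gev_units => //; exact/(ccin_Cc hQ).
rewrite -[gev V q f x]rhof// -[rho _ _]addr0 -rj -crepD//.
rewrite (le_trans (crep_nrm rhoP _ _))// ler_piMr//; exact: nrm_ge0.
Qed.

(** The estimate holds for arbitrary [q] and [q0], hence also with them exchanged: the vector that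
    almost attains the norm at [q0] lives in a representation of all of [G], and the same vector is
    tested at [q]. *)
Lemma p_full_near F f q q0 : Cc act f -> suppF F f ->
  p_full (A := A) q0 (emb f) <= p_full (A := A) q (emb f)
    + \sum_(g <- F) cmod (f (mk_arrow g q0) - f (mk_arrow g q)).
Proof.
move=> Cf fF; apply/ler_addgt0Pr => e e0.
(* Freezing the coefficients of [f] at [q0] costs at most [d] for each element of [F], in total
   [e / 2]; the other half pays for a vector that only almost attains the norm. *)
pose n := (size F)%:R : R; pose d := e / 2 / (n + 1).
have n0 : 0 <= n by rewrite /n.
have d0 : 0 < d by rewrite !divr_gt0// ltr_wpDl.
have dn : n * d <= e / 2.
  rewrite /d mulrC mulrAC ler_pdivrMr ?ltr_wpDl//.
  by rewrite ler_wpM2l ?lerDl// ltW// divr_gt0.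
pose W := interior [set q' | forall g, g \in F ->
  (int_stab act q0 g -> int_stab act q' g) /\
  cmod (f (mk_arrow g q') - f (mk_arrow g q0)) <= d].
have oW : open W by exact: open_interior.
have Wq0 : W q0.
  apply: near_fset => g; apply: filterI.
    have [sg|nsg] := pselect (int_stab act q0 g); last by apply: filterS filterT => q'.
    have : nbhs q0 (fixint act g) by apply: open_nbhs_nbhs; split=> //; exact: open_fixint.
    by apply: filterS => q' sq' _.
  have [cg _] := Cc_slice g Cf; have /continuousC/(_ q0 _ d0) := cg.
  by apply: filterS => q'; rewrite cmodBC.
have WP q' : W q' -> forall g, g \in F -> (int_stab act q0 g -> int_stab act q' g) /\
  cmod (f (mk_arrow g q') - f (mk_arrow g q0)) <= d by move/interior_subset.
have [u uW uq0] := cutoff_point (R := R) lcQ hQ oW Wq0.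
have [cu u01 ucW] := uW.
(* A second cutoff, equal to 1 where [u] is nonzero: the ramps built on [w] leave [u] unchanged, so
   that [slim_sgl] applies to [u]. *)
have [w wW w1] := cutoff_ccin lcQ hQ oW ucW.
have uT : cutoff setT u by split=> //; exact: ccin_mono ucW.
have Cuf : Cc act (mulu u f) by exact: Cc_mulu.
have le1 : p_full (A := A) q0 (emb f) <= full_norm act (mulu u f).
  rewrite -(full_emb_norm A)// -[emb (mulu u f)](subrK (emb f)) addrC.
  apply: p_fibre_le; apply: (fibre_ideal_cutoff lcQ hQ act_homeo) => //.
  - by move=> *; exact: full_emb_linear.
  - by move=> *; exact: full_embM.
have S0 : 0 <= \sum_(g <- F) cmod (f (mk_arrow g q0) - f (mk_arrow g q)).
  by apply: sumr_ge0 => g _; exact: cmod_ge0.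
have P0 : 0 <= p_full (A := A) q (emb f) by exact: p_fibre_ge0.
(* A near-maximal vector is available only for a positive norm; otherwise the bound is trivial. *)
have [f0|f0] := leP (full_norm act (mulu u f)) 0.
  by rewrite (le_trans le1)// (le_trans f0)// !addr_ge0// ltW.
have e2 : 0 < e / 2 by rewrite divr_gt0.
have [H [pi [x [piP x1 le2]]]] := full_norm_approx Cuf e2 f0.
pose L := pstab (act := act) W.
have L1 : L 1%g by exact: pstab1.
have LM g h : L g -> L h -> L (g * h)%g by exact: pstabM.
have LV g : L g -> L g^-1%g by exact: pstabV.
pose U := @slim R G Q H pi w.
have Ulin g t y z : L g -> U g (t *: y + z) = t *: U g y + U g z.
  by move=> Lg; exact: (slim_linear hQ act_homeo piP wW).
have UM g h y : L g -> L h -> U (g * h)%g y = U g (U h y).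
  by move=> Lg Lh; exact: (slimM lcQ hQ act_homeo piP wW).
have Uadj g y z : L g -> ip (U g y) z = ip y (U g^-1%g z).
  by move=> Lg; exact: (slim_adj hQ act_homeo piP wW).
have Ule g y : L g -> nrm (U g y) <= nrm y.
  by move=> Lg; exact: (slim_le lcQ hQ act_homeo piP wW).
pose V := ind_map L1 LM LV Ulin Ule.
have VP : grep V by exact: ind_grep.
pose y := pi (sgl 1%g (fun q => (u q)%:C)) x.
have y1 : nrm y <= 1.
  by rewrite (le_trans (rep_units_le1 hQ act_homeo piP _ uT)).
have Ld g : g \in F -> int_stab act q0 g -> L g.
  by move=> gF sg q' Wq'; have [+ _] := WP q' Wq' g gF; apply.
pose c g := f (mk_arrow g q0).
have c0 g : ~ int_stab act q0 g -> c g = 0 by exact: Cc_nstab.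
(* An element of [F] outside the stabilizer at [q0] need not lie in [L], and [U] is controlled only
   on [L]; its coefficient at [q0] is 0, and the term is set to 0. *)
pose z g := if `[< int_stab act q0 g >] then c g *: U g y else 0.
have zE g : g \in F -> nrm (pi (sgl g (fun q => (u q)%:C * f (mk_arrow g q))) x - z g) <= d.
  move=> gF; have ufg : ccin (fixint act g) (fun q => (u q)%:C * f (mk_arrow g q)).
    by apply: ccinMl; [exact: Cc_slice|exact: continuousC_real].
  have dle q' : cmod ((u q')%:C * (f (mk_arrow g q') - c g)) <= d.
    have [uq|uq] := eqVneq (u q')%:C (0 : R[i]); first by rewrite uq mul0r cmod0 ltW.
    have Wq' : W q' by case: ucW => _ [K [_ KW /(_ q' uq) /KW]].
    have /andP[u0 u1] := u01 q'.
    rewrite cmodM cmodR ger0_norm// (le_trans (ler_piMl _ u1)) ?cmod_ge0//.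
    by have [_] := WP q' Wq' g gF.
  rewrite /z; case: asboolP => sg; last first.
    rewrite subr0 (le_trans (rep_sgl_le lcQ hQ act_homeo piP x ufg (ltW d0) _))//.
      by move=> q'; have := dle q'; rewrite c0// subr0.
    by rewrite ler_piMr// ltW.
  have Lg := Ld g gF sg.
  have ug : ccin (fixint act g) (fun q => (u q)%:C) by exact: ccin_mono Lg ucW.
  rewrite (_ : U g y = pi (sgl g (fun q => (u q)%:C)) x); last first.
    exact: (slim_sgl hQ act_homeo piP wW).
  have ucg : ccin (fixint act g) (fun q => c g * (u q)%:C).
    by apply: ccinMl => //; exact: continuousC_cst.
  have -> : c g *: pi (sgl g (fun q => (u q)%:C)) x = pi (sgl g (fun q => c g * (u q)%:C)) x.
    rewrite -(repZ hQ piP); last exact: Cc_sgl.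
    congr (pi _ x); apply: fn_ext => h q'; rewrite !sglE; case: ifP; rewrite ?mulr0//.
  rewrite -(sgl_sub hQ piP)// (le_trans (rep_sgl_le lcQ hQ act_homeo piP x _ (ltW d0) _))//.
  - exact: ccinB.
  - by move=> q'; rewrite [c g * _]mulrC -mulrBr.
  - by rewrite ler_piMr// ltW.
have le3 : nrm (pi (mulu u f) x) <= e / 2 + nrm (\sum_(g <- F) z g).
  have ufF : suppF F (mulu u f) by move=> g q' gF; rewrite /mulu fF// mulr0.
  rewrite (sgl_decomp Cuf ufF) (rep_sum hQ piP); last first.
    by move=> g; apply: Cc_sgl => //; exact: Cc_slice.
  rewrite -[X in nrm X](subrK (\sum_(g <- F) z g)) (le_trans (nrmD _ _))// lerD2r.
  rewrite -sumrB (le_trans (nrm_sum _ _ _))// (le_trans _ dn)//.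
  rewrite big_seq (@le_trans _ _ (\sum_(g <- F | g \in F) d))//.
    by apply: ler_sum => g gF; exact: zE.
  by rewrite -big_seq big_const_seq count_predT iter_addr_0 /n mulr_natl.
pose delt := delta y : l2_hilbert G H.
have delt1 : nrm delt <= 1 by rewrite (le_trans (delta_nrm _)).
(* The sum is the value at the neutral element of the operator applied to [delt], and evaluation at
   a point is contractive. *)
have le4 : nrm (\sum_(g <- F) z g) <= nrm (gev V q0 f delt).
  rewrite (_ : \sum_(g <- F) z g = (gev V q0 f delt : l2 G H) 1%g); first exact: l2_point.
  rewrite (gevE _ _ _ fF).
  have evs (r : seq G) (xi : G -> l2 G H) : (\sum_(g <- r) xi g) 1%g = \sum_(g <- r) xi g 1%g.
    by elim: r => [|a r IH]; rewrite ?big_nil// !big_cons l2D IH.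
  rewrite evs big_seq [RHS]big_seq; apply: eq_bigr => g gF.
  rewrite l2Z /z -/(c g); case: asboolP => sg; last by rewrite c0// scale0r.
  by rewrite (ind_delta L1 LM LV Ulin Ule)//; exact: Ld.
have le5 : nrm (gev V q0 f delt) <= nrm (gev V q f delt) +
    \sum_(g <- F) cmod (f (mk_arrow g q0) - f (mk_arrow g q)).
  rewrite -(subrK (gev V q f delt) (gev V q0 f delt)) (le_trans (nrmD _ _))// addrC lerD2l.
  rewrite !(gevE _ _ _ fF) -sumrB (le_trans (nrm_sum _ _ _))//; apply: ler_sum => g _.
  rewrite -scalerBl nrmZ ler_piMr ?cmod_ge0//.
  exact: le_trans (grep_le VP _ _) delt1.
have le6 := gev_le_p_full q VP Cf delt1.
have le7 := le_trans le4 (le_trans le5 (lerD le6 (lexx _))).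
apply: (le_trans le1); move: le2; rewrite lerBlDr => /le_trans; apply.
apply: (le_trans (lerD le3 (lexx _))).
by rewrite addrAC -splitr addrC lerD2r.
Qed.

Lemma near_variation F f q0 e : Cc act f -> 0 < e ->
  \forall q \near q0, \sum_(g <- F) cmod (f (mk_arrow g q0) - f (mk_arrow g q)) <= e.
Proof.
move=> Cf e0.
have cS : (fun q => \sum_(g <- F) cmod (f (mk_arrow g q0) - f (mk_arrow g q))) @ q0
    --> \sum_(g <- F) cmod (f (mk_arrow g q0) - f (mk_arrow g q0)).
  apply: cvg_big => [|g _]; first exact: add_continuous.
  apply: (@cvg_nrm_nrm _ _ _ _ R[i]^o); apply: cvgB; first exact: cvg_cst.
  by have [cg _] := Cc_slice g Cf; exact: cg.
rewrite big1 in cS; last by move=> g _; rewrite subrr cmod0.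
move/cvg_real/(_ _ e0) : cS; apply: filterS => q.
by rewrite sub0r normrN; exact/le_trans/ler_norm.
Qed.

Lemma p_full_continuous (a : A) : continuous (fun q => p_full (A := A) q a).
Proof.
move=> q0; apply/cvg_real => e e0.
have e3 : 0 < e / 3 by rewrite divr_gt0.
have [f Cf af] := full_approx a e3.
have [F fF] := Cc_supp Cf.
pose S q := \sum_(g <- F) cmod (f (mk_arrow g q0) - f (mk_arrow g q)).
apply: filterS (near_variation F q0 Cf e3) => q Sq.
have h1 := p_full_near q q0 Cf fF; have h2 := p_full_near q0 q Cf fF.
have Sym : \sum_(g <- F) cmod (f (mk_arrow g q) - f (mk_arrow g q0)) = S q.
  by apply: eq_bigr => g _; rewrite cmodBC.
rewrite Sym in h2; rewrite -/(S q) in h1 Sq.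
have d1 := p_fibre_dist emb q0 a (emb f); have d2 := p_fibre_dist emb q0 (emb f) a.
have d3 := p_fibre_dist emb q a (emb f); have d4 := p_fibre_dist emb q (emb f) a.
rewrite [nrm (emb f - a)]nrmBC in d2 d4.
rewrite /p_full in h1 h2 *; rewrite ler_norml; apply/andP; split; lra.
Qed.

End FullContinuity.

(** * The left regular representation *)

Section ComplexHilbert.
Context {R : realType}.

(** An alias of [R[i]^o] that carries completeness, proved through real and imaginary parts, and so
    makes the scalars a [hilbert]. *)
Definition C_module : Type := R[i]^o.

HB.instance Definition _ := NormedModule.copy C_module R[i]^o.

Let C_complete (F : set_system C_module) : ProperFilter F -> cauchy F -> cvg F.
Proof.
move=> FF /cauchy_ballP Fc.
have Fc' e : 0 < e -> exists2 A, F A & forall z w, A z -> A w -> cmod (z - w) <= e.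
  move=> e0; have [[A B]/= [FA FB] AB] := Fc e%:C ltac:(by rewrite ltcR).
  exists (A `&` B); first exact: filterI.
  move=> z w [zA _] [_ wB]; have := AB (z, w) (conj zA wB).
  by rewrite -ball_normE /= cmodE ltcR => /ltW.
have part (p : R[i] -> R) : (forall z w, `|p z - p w| <= cmod (z - w)) -> cvg ((fun z : R[i]^o => p z) @ F).
  move=> pl; apply/cauchy_cvgP/cauchy_ballP => e e0.
  have [A FA Ae] := Fc' (e / 2) ltac:(by rewrite divr_gt0).
  exists (p @` A, p @` A).
    by split; apply: (@filterS _ F _ A) => // z Az /=; exists z.
  move=> [_ _] /= [[z Az <-] [w Aw <-]].
  rewrite -ball_normE /= (le_lt_trans (pl _ _))// (le_lt_trans (Ae _ _ Az Aw))//.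
  by rewrite ltr_pdivrMr// mulr_natr mulr2n ltrDl.
have Re_le (z : R[i]) : `|complex.Re z| <= cmod z.
  by rewrite -lecR -cmodE normc_ge_Re.
have Im_le (z : R[i]) : `|complex.Im z| <= cmod z.
  rewrite -lecR -cmodE normc_def lecR -sqrtr_sqr ler_sqrt ?addr_ge0 ?sqr_ge0//.
  by rewrite lerDr sqr_ge0.
have cRe : cvg ((fun z : R[i]^o => complex.Re z) @ F).
  by apply: part => z w; rewrite (_ : _ - _ = complex.Re (z - w))//; case: z w => [? ?] [].
have cIm : cvg ((fun z : R[i]^o => complex.Im z) @ F).
  by apply: part => z w; rewrite (_ : _ - _ = complex.Im (z - w))//; case: z w => [? ?] [].
apply/cvg_ex; exists ((lim ((fun z : R[i]^o => complex.Re z) @ F)) +i* (lim ((fun z : R[i]^o => complex.Im z) @ F)) : R[i]^o).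
apply/(@cvg_nrm _ _ _ _ C_module id) => e e0.
have e2 : 0 < e / 2 by rewrite divr_gt0.
move/cvg_real/(_ _ e2) : cRe => cRe; move/cvg_real/(_ _ e2) : cIm => cIm.
apply: filterS (filterI cRe cIm) => -[a b] /= [h1 h2].
rewrite -[nrm _]/(cmod _).
rewrite (_ : _ - _ = (lim ((fun z : R[i]^o => complex.Re z) @ F) - a)%:C +
  'i%C * (lim ((fun z : R[i]^o => complex.Im z) @ F) - b)%:C); last first.
  by apply/eqP; rewrite eq_complex /=; apply/andP; split; apply/eqP; ring.
rewrite [leRHS]splitr (le_trans (cmodD _ _))// lerD//; first by rewrite cmodR.
rewrite cmodM cmodR (_ : cmod 'i%C = 1) ?mul1r//.
by apply: complexI; rewrite -cmodE complexiE normCi.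
Qed.

HB.instance Definition _ := Uniform_isComplete.Build C_module C_complete.

Let C_ip (z w : C_module) : R[i] := (fun z' w' : R[i] => z' * Num.conj w') z w.

Let C_ip_linear a (x y z : C_module) : C_ip (a *: x + y) z = a * C_ip x z + C_ip y z.
Proof. by rewrite /C_ip [X in X * _]/(a * (x : R[i]) + (y : R[i])) mulrDl mulrA. Qed.

Let C_ip_conj x y : C_ip y x = Num.conj (C_ip x y).
Proof. by rewrite /C_ip rmorphM /= conjCK mulrC. Qed.

Let C_ip_norm x : C_ip x x = `|x| ^+ 2.
Proof. by rewrite /C_ip normCK. Qed.

Definition C_hilbert : hilbert R := @Hilbert R C_module C_ip C_ip_linear C_ip_conj C_ip_norm.

Lemma C_ip1 (z : C_hilbert) : ip z (1 : R[i]) = z.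
Proof. by rewrite /= /C_ip rmorph1 mulr1. Qed.

End ComplexHilbert.

Section RegularRep.
Context {R : realType} {G : groupType}.
Local Notation l2C := (l2_hilbert G (@C_hilbert R)).

Lemma triv1 : [set 1%g : G] 1%g. Proof. by []. Qed.
Lemma trivM (g h : G) : [set 1%g : G] g -> [set 1%g : G] h -> [set 1%g : G] (g * h)%g.
Proof. by move=> -> ->; rewrite /= mulg1. Qed.
Lemma trivV (g : G) : [set 1%g : G] g -> [set 1%g : G] g^-1%g.
Proof. by move=> ->; rewrite /= invg1. Qed.

(** Cosets of the trivial subgroup are points and each is its own representative, so this is the
    left regular representation, see [regularE]. *)
Definition regular : G -> {linear l2C -> l2C} :=
  @ind_map R G C_hilbert [set 1%g] (fun=> id) triv1 trivM trivV
    (fun _ _ _ _ _ => erefl) (fun _ _ _ => lexx _).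

Lemma regularE g (xi : l2C) t : (regular g xi : l2 G C_hilbert) t = (xi : l2 G C_hilbert) (g^-1 * t)%g.
Proof.
have reprE (s : G) : coset_repr [set 1%g] s = s.
  have e1 : ((coset_repr [set 1%g] s)^-1 * s)%g = 1%g := coset_reprP triv1 s.
  by rewrite -[RHS](mulVKg (coset_repr [set 1%g] s)) e1 mulg1.
by rewrite /regular /= /ind_fun /isrepr !reprE eqxx.
Qed.

Lemma regular_grep : grep regular.
Proof. by apply: ind_grep. Qed.

End RegularRep.

(** * The reduced algebra *)

Section Reduced.
Context {R : realType} {G : groupType} {Q : topologicalType} {act : G -> Q -> Q}.
Hypotheses (lcQ : locally_compact [set: Q]) (hQ : hausdorff_space Q)
  (act_homeo : action_by_homeo act).
Variables (A : fullCstar R act) (E : condExp A) (B : redCstar E).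
Variable S : forall q : Q, gns (ev_exp B q).
Local Notation fn := (arrow G Q -> R[i]).
Local Notation emb := (full_emb A).
Local Notation remb := (red_emb B).
Local Notation proj := (red_proj B).
Local Notation K q := (gns_hilbert (S q)).
Local Notation v q := (gns_vec (S q)).
Local Notation T q := (gns_rep (S q)).
Implicit Types (f k : fn) (q : Q) (F : {fset G}) (a : A) (b c : B).

Lemma remb_lin t f k : Cc act f -> Cc act k ->
  remb (lincomb t f k) = t *: remb f + remb k.
Proof. by move=> Cf Ck; rewrite /red_emb full_emb_linear// linearP. Qed.

Lemma rembM f k : Cc act f -> Cc act k -> remb (Defs.conv act f k) = cmul (remb f) (remb k).
Proof. by move=> Cf Ck; rewrite /red_emb full_embM// red_projM. Qed.

Lemma rembJ f : Cc act f -> remb (invol act f) = cadj (remb f).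
Proof. by move=> Cf; rewrite /red_emb full_embJ// red_projJ. Qed.

Lemma red_norm_lift a (k : A) : proj k = 0 -> nrm (proj a) <= nrm (a + k).
Proof.
move=> k0; rewrite red_proj_norm; apply: ge_inf; last by exists k.
by exists 0 => _ [j _ <-]; exact: nrm_ge0.
Qed.

Lemma red_proj_le a : nrm (proj a) <= nrm a.
Proof. by rewrite (le_trans (@red_norm_lift a 0 _)) ?linear0 ?addr0. Qed.

Lemma red_norm_approx b e : 0 < e -> exists2 a, proj a = b & nrm a <= nrm b + e.
Proof.
move=> e0; have [a0 <-] := red_proj_surj b.
rewrite red_proj_norm /quotient_norm; set N := [set nrm _ | _ in _].
have hN : has_inf N.
  split; first by exists (nrm (a0 + 0)), 0 => //=; rewrite linear0.
  by exists 0 => _ [j _ <-]; exact: nrm_ge0.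
have [_ [k /= k0 <-] le] := inf_adherent e0 hN.
by exists (a0 + k); [rewrite linearD k0 addr0|exact: ltW].
Qed.

Lemma remb_approx b e : 0 < e -> exists2 f, Cc act f & nrm (b - remb f) <= e.
Proof.
move=> e0; have [a <-] := red_proj_surj b; have [f Cf af] := full_approx a e0.
by exists f => //; rewrite -linearB (le_trans (red_proj_le _)).
Qed.

Lemma v_ip q b c : ip (v q b) (v q c) = red_exp (cmul (cadj c) b) q.
Proof. exact: gns_vec_ip. Qed.

Lemma v_le q b : nrm (v q b) <= nrm b.
Proof.
apply/ler_addgt0Pr => e e0; have [a <- ae] := red_norm_approx b e0.
apply: le_trans ae; rewrite -(@ler_pXn2r _ 2)// ?nnegrE ?nrm_ge0// -Re_ip v_ip.
rewrite -red_projJ -red_projM red_exp_proj (le_trans (Re_le_cmod _))//.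
by rewrite (le_trans (cexp_contractive _ _ _))// cstar_nrm.
Qed.

Lemma T_v q b c : T q b (v q c) = v q (cmul b c).
Proof. exact: gns_repE. Qed.

Lemma v_dense q (x : K q) e : 0 < e -> exists2 f, Cc act f & nrm (x - v q (remb f)) <= e.
Proof.
move=> e0; have e2 : 0 < e / 2 by rewrite divr_gt0.
have [_ [b _ <-] xb] := dense_nrm (@gns_vec_dense _ _ _ (S q)) x e2.
have [f Cf bf] := remb_approx b e2; exists f => //.
rewrite -(subrK (v q b) x) -addrA [leRHS]splitr (le_trans (nrmD _ _))// lerD//.
by rewrite -linearB (le_trans (v_le _ _)).
Qed.

(** A GNS triple prescribes its operators only on the vectors [gns_vec], and continuity gives each
    of them some bound. Linearity in the algebra element, multiplicativity and adjoints are all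
    transferred from those vectors by this density argument. *)
Lemma T_ext q (W : normedModType R[i]) (f g : K q -> W) (C D : R) :
  (forall x y, nrm (f x - f y) <= C * nrm (x - y)) ->
  (forall x y, nrm (g x - g y) <= D * nrm (x - y)) ->
  (forall k, Cc act k -> f (v q (remb k)) = g (v q (remb k))) -> f =1 g.
Proof.
move=> fC gD fg x; apply/eqP; rewrite -subr_eq0; apply/eqP; apply: eps_eq0 => e e0.
have CD : 0 < `|C| + `|D| + 1 by rewrite ltr_wpDl// addr_ge0.
have [k Ck xk] := v_dense x (divr_gt0 e0 CD); set y := v q (remb k) in xk.
rewrite (_ : f x - g x = (f x - f y) - (g x - g y)); last first.
  by rewrite /y fg// opprB addrA subrK.
rewrite (le_trans (nrmB _ _))// (le_trans (lerD (fC x y) (gD x y)))// -mulrDl.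
apply: (@le_trans _ _ ((`|C| + `|D| + 1) * nrm (x - y))).
  rewrite ler_wpM2r ?nrm_ge0// -addrA lerD ?ler_norm// ler_wpDr// ler_norm//.
by rewrite mulrC -ler_pdivlMr.
Qed.

Lemma T_bound q b : exists2 C, 0 <= C & forall x, nrm (T q b x) <= C * nrm x.
Proof. exact/linear_bound/gns_rep_continuous. Qed.

Lemma T_lip q b C : (forall x, nrm (T q b x) <= C * nrm x) ->
  forall x y, nrm (T q b x - T q b y) <= C * nrm (x - y).
Proof. by move=> HC x y; rewrite -linearB. Qed.

Lemma T_linear q t b c x : T q (t *: b + c) x = t *: T q b x + T q c x.
Proof.
have [C1 _ H1] := T_bound q (t *: b + c); have [C2 _ H2] := T_bound q b.
have [C3 _ H3] := T_bound q c; move: x.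
apply: (@T_ext q _ _ (fun x => t *: T q b x + T q c x) C1 (cmod t * C2 + C3)).
- exact: T_lip.
- move=> x y; rewrite opprD addrACA -scalerBr mulrDl (le_trans (nrmD _ _))// nrmZ -mulrA.
  by rewrite lerD ?ler_wpM2l ?cmod_ge0// T_lip.
- by move=> k Ck; rewrite !T_v cmul_linearl linearP.
Qed.

Lemma T_M q b c x : T q (cmul b c) x = T q b (T q c x).
Proof.
have [C1 _ H1] := T_bound q (cmul b c); have [C2 C20 H2] := T_bound q b.
have [C3 _ H3] := T_bound q c; move: x.
apply: (@T_ext q _ _ (fun x => T q b (T q c x)) C1 (C2 * C3)).
- exact: T_lip.
- move=> x y; rewrite -linearB (le_trans (H2 _))// -mulrA ler_wpM2l//; exact: T_lip.
- by move=> k Ck; rewrite !T_v cmulA.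
Qed.

Lemma T_adj q b x y : ip (T q b x) y = ip x (T q (cadj b) y).
Proof.
have [C1 C10 H1] := T_bound q b; have [C2 C20 H2] := T_bound q (cadj b).
have base k k' : ip (T q b (v q (remb k))) (v q (remb k')) =
    ip (v q (remb k)) (T q (cadj b) (v q (remb k'))).
  by rewrite !T_v !v_ip cadjM cadjK -cmulA.
have step x' k' : ip (T q b x') (v q (remb k')) = ip x' (T q (cadj b) (v q (remb k'))).
  move: x'; apply: (@T_ext q R[i]^o (fun x' => ip (T q b x') (v q (remb k')))
    (fun x' => ip x' (T q (cadj b) (v q (remb k')))) (C1 * nrm (v q (remb k')))
    (nrm (T q (cadj b) (v q (remb k'))))) => [z w|z w|k Ck]; last exact: base.
  - rewrite -ipBl (le_trans (CauchySchwarz _ _))// mulrAC ler_wpM2r ?nrm_ge0//.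
    exact: T_lip.
  - by rewrite -ipBl (le_trans (CauchySchwarz _ _))// mulrC.
move: y; apply: (@T_ext q R[i]^o (fun y => ip (T q b x) y)
  (fun y => ip x (T q (cadj b) y)) (nrm (T q b x)) (nrm x * C2)) => [z w|z w|k Ck].
- by rewrite -ipBr (le_trans (CauchySchwarz _ _)).
- rewrite -ipBr (le_trans (CauchySchwarz _ _))// -mulrA ler_wpM2l ?nrm_ge0//.
  exact: T_lip.
- exact: step.
Qed.

Lemma T_star_rep q : star_rep act (fun f => T q (remb f)).
Proof.
split.
- by move=> f Cf; exact: gns_rep_continuous.
- by move=> t f k x Cf Ck; rewrite remb_lin// T_linear.
- by move=> f k x Cf Ck; rewrite rembM// T_M.
- by move=> f x y Cf; rewrite T_adj rembJ.
Qed.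

Lemma T_dense_le q b M : 0 <= M ->
  (forall f, Cc act f -> nrm (T q b (v q (remb f))) <= M * nrm (v q (remb f))) ->
  forall x, nrm (T q b x) <= M * nrm x.
Proof.
move=> M0 main x; have [C C0 HC] := T_bound q b.
apply/ler_addgt0Pr => e e0; have D0 : 0 < C + M + 1 by rewrite ltr_wpDl// addr_ge0.
have [f Cf xf] := v_dense x (divr_gt0 e0 D0); set y := v q (remb f) in xf.
rewrite -(subrK (T q b y) (T q b x)) (le_trans (nrmD _ _))//.
have h1 := le_trans (T_lip HC x y) (ler_wpM2l C0 xf).
have h2 : nrm (T q b y) <= M * (nrm x + e / (C + M + 1)).
  rewrite (le_trans (main f Cf))// ler_wpM2l//.
  by rewrite -/y -(subrK x y) addrC (le_trans (nrmD _ _))// lerD2l nrmBC.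
rewrite (le_trans (lerD h1 h2))// mulrDr addrCA lerD2l -mulrDl mulrCA.
by rewrite ler_piMr ?(ltW e0)// ler_pdivrMr// mul1r lerDl.
Qed.

(** On [Cc] the GNS operators form a [star_rep], hence are bounded by the full norm. For general
    [a], an approximant [k] is taken in the left factor only, and the error on a vector
    [v q (remb f)] is at most [|a - emb k| |emb f|]. *)
Lemma T_proj_le q a x : nrm (T q (proj a) x) <= nrm a * nrm x.
Proof.
have main f : Cc act f -> nrm (T q (proj a) (v q (remb f))) <= nrm a * nrm (v q (remb f)).
  move=> Cf; apply/ler_addgt0Pr => e e0; set x0 := v q (remb f).
  pose D := nrm (emb f) + nrm x0 + 1.
  have D0 : 0 < D by rewrite ltr_wpDl// addr_ge0 ?nrm_ge0.
  have [k Ck ak] := full_approx a (divr_gt0 e0 D0).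
  have h1 : nrm (T q (remb k) x0) <= nrm (emb k) * nrm x0.
    by rewrite full_emb_norm//; exact: (rep_full_norm lcQ hQ act_homeo _ Ck (T_star_rep q)).
  have h2 : nrm (T q (proj a) x0 - T q (remb k) x0) <= e / D * nrm (emb f).
    rewrite /x0 !T_v -linearB -cmulBl (le_trans (v_le _ _))//.
    rewrite /red_emb -linearB -red_projM (le_trans (red_proj_le _))//.
    by rewrite (le_trans (cmul_nrm _ _))// ler_wpM2r ?nrm_ge0.
  have h3 : nrm (emb k) <= nrm a + e / D.
    rewrite -(subrK a (emb k)) addrC (le_trans (nrmD _ _))// lerD2l nrmBC//.
  have h4 := le_trans h1 (ler_wpM2r (nrm_ge0 x0) h3).
  rewrite -(subrK (T q (remb k) x0) (T q (proj a) x0)) (le_trans (nrmD _ _))//.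
  rewrite (le_trans (lerD h2 h4))// mulrDl addrCA lerD2l -mulrDr mulrAC ler_pdivrMr//.
  by rewrite ler_wpM2l ?(ltW e0)// /D lerDl.
exact: T_dense_le (nrm_ge0 a) main x.
Qed.

Lemma T_le q b x : nrm (T q b x) <= nrm b * nrm x.
Proof.
apply/ler_addgt0Pr => e e0; have D0 : 0 < nrm x + 1 by rewrite ltr_wpDl ?nrm_ge0.
have [a <- ae] := red_norm_approx b (divr_gt0 e0 D0).
rewrite (le_trans (T_proj_le a x))//.
rewrite (le_trans (ler_wpM2r (nrm_ge0 x) ae))// mulrDl lerD2l mulrAC ler_pdivrMr//.
by rewrite ler_wpM2l ?(ltW e0)// lerDl.
Qed.

Lemma T_crep q : crep (T q : B -> K q -> K q).
Proof.
split.
- by move=> t b c x; exact: T_linear.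
- by move=> t b x y; rewrite linearP.
- by move=> b c x; exact: T_M.
- by move=> b x y; exact: T_adj.
- by move=> b x; exact: T_le.
Qed.

Lemma T_proj_crep q : crep (fun (a : A) x => T q (proj a) x).
Proof.
split.
- by move=> t b c x; rewrite linearP T_linear.
- by move=> t b x y; rewrite linearP.
- by move=> b c x; rewrite red_projM T_M.
- by move=> b x y; rewrite T_adj red_projJ.
- by move=> b x; exact: T_proj_le.
Qed.

(** [E (x a y)] at [q] is the matrix coefficient of [T q (proj a)] between [v q (proj y)] and the
    vector of [cadj (proj x)]; the kernel of the projection is defined by the vanishing of all
    these. *)
Lemma T_faithful b : (forall q x, T q b x = 0) -> b = 0.
Proof.
have [a <-] := red_proj_surj b => Ta; apply/red_proj_ker => x y q.
rewrite -(red_exp_proj B) !red_projM -(cadjK (proj x)) -cmulA -v_ip -T_v Ta ip0l//.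
Qed.

Lemma red_norm_le b C : 0 <= C ->
  (forall q x, nrm (T q b x) <= C * nrm x) -> nrm b <= C.
Proof.
move=> C0 HC; have [//|Cb] := leP (nrm b) C.
have b0 : 0 < nrm b by exact: le_lt_trans Cb.
(* The maximum with [3/4] of the norm keeps [b / c0] of norm at most [4/3] even for small [C]. A
   lift of norm at most [7/5] then exists, and [(7/5)^2 = 49/25 <= 2] is what [truncation] accepts.
   Its result has the same image, of norm at most 1, against [c0 < nrm b]. *)
pose c0 := Num.max C (nrm b * (3 / 4)).
have c00 : 0 < c0 by rewrite lt_max (mulr_gt0 b0) ?orbT.
have c0b : c0 < nrm b by rewrite gt_max Cb /= gtr_pMr//; lra.
have b43 : nrm b / c0 <= 4 / 3.
  rewrite ler_pdivrMr//; apply: (@le_trans _ _ (4 / 3 * (nrm b * (3 / 4)))).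
    by have := ltW b0; lra.
  by rewrite ler_wpM2l// le_max lexx orbT.
have e0 : 0 < (7 / 5 - 4 / 3 : R) by lra.
have cc : cmod (c0^-1%:C : R[i]) = c0^-1 by rewrite cmodR ger0_norm// invr_ge0 ltW.
have nb : nrm (c0^-1%:C *: b) = nrm b / c0 by rewrite nrmZ cc mulrC.
have [a aE ale] := red_norm_approx (c0^-1%:C *: b) e0.
have a2 : nrm a ^+ 2 <= 2.
  have a75 : nrm a <= 7 / 5 by rewrite nb in ale; lra.
  apply: (@le_trans _ _ ((7 / 5) ^+ 2)); last by rewrite expr2; lra.
  by rewrite ler_pXn2r ?nnegrE ?nrm_ge0//; lra.
have [a' a'1 Ha'] := truncation (full_normed_by_reps lcQ hQ act_homeo (A := A)) a2.
have : proj (a' - a) = 0.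
  apply: T_faithful => q x; rewrite linearB (crepB (T_crep q)).
  rewrite (Ha' _ _ (T_proj_crep q)) ?subrr// => y.
  rewrite aE -[c0^-1%:C *: b]addr0 T_linear (crep0 (T_crep q)) addr0 nrmZ cc.
  rewrite mulrC ler_pdivrMr// mulrC (le_trans (HC q y))// ler_wpM2r ?nrm_ge0//.
  by rewrite le_max lexx.
rewrite linearB => /eqP; rewrite subr_eq0 => /eqP a'a.
have : nrm b / c0 <= 1 by rewrite -nb -aE -a'a (le_trans (red_proj_le _)).
by rewrite ler_pdivrMr// mul1r leNgt c0b.
Qed.

End Reduced.

(** * Comparison of the two descriptions of the l^2 norm *)

Section GroupNorms.
Context {R : realType} {G : groupType}.
Local Notation l2C := (l2_hilbert G (@C_hilbert R)).

Lemma ip_delta (H : hilbert R) (xi : l2_hilbert G H) x :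
  ip xi (delta x) = ip ((xi : l2 G H) 1%g) x.
Proof.
apply/eqP; rewrite -subr_eq0; apply/eqP; apply: (@eps_eq0 _ R[i]^o) => e e0.
have [D0 H0] := l2ip_approx xi (delta x : l2 G H) e0.
have /H0 := fsubsetUl D0 [fset 1%g]%fset.
rewrite /ipD (big_fsetD1 1%g)/=; last by rewrite !inE eqxx orbT.
rewrite [delta_fun x 1%g]/delta_fun eqxx [\sum_(i <- _) _]big_seq big1 ?addr0// => t.
by rewrite !inE /delta_fun => /andP[/negPf -> _]; rewrite ip0r.
Qed.

Lemma l2sqE (xi : l2C) : l2sq (xi : l2 G C_hilbert) = (nrm xi ^+ 2)%:E.
Proof.
apply/eqP; rewrite eq_le; apply/andP; split.
  apply: ge_ereal_sup => _ [D [finD _] <-].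
  rewrite fsbig_finite//= sumEFin lee_fin; exact: (l2_sqsum_le (xi : l2 G C_hilbert) (fset_set D)).
apply/lee_addgt0Pr => e e0; have [D /(_ D (fsubset_refl D))] := sqnorm_approx (l2P xi) e0.
rewrite -l2_nrm_sq => H; apply: (@le_trans _ _ ((sqsum xi D)%:E + e%:E)%E).
  by rewrite -EFinD lee_fin -lerBlDl (le_trans (ler_norm _)).
rewrite leeD2r// /l2sq; apply: esum_ge; exists [set` D]; first by split.
by rewrite fsbig_finite//= set_fsetK sumEFin lee_fin.
Qed.

Lemma l2sq_le1 (xi : G -> R[i]) : (l2sq xi <= 1)%E ->
  exists2 eta : l2C, nrm eta <= 1 & (eta : l2 G C_hilbert) = xi :> (G -> R[i]).
Proof.
move=> xi1; have sq (D : {fset G}) : sqsum (xi : G -> C_hilbert) D <= 1 ^+ 2.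
  rewrite expr1n -lee_fin (le_trans _ xi1)// esum_ge//; exists [set` D]; first by split.
  by rewrite fsbig_finite//= set_fsetK sumEFin lee_fin.
have xiP : (xi : G -> C_hilbert) \in sqsummable by apply/sqsummableP; exists (1 ^+ 2).
by exists (L2 xiP : l2C) => //; exact: l2_nrm_le.
Qed.

End GroupNorms.

(** * The regular representation evaluated at a point *)

Section RegularFibre.
Context {R : realType} {G : groupType} {Q : topologicalType} {act : G -> Q -> Q}.
Hypotheses (lcQ : locally_compact [set: Q]) (hQ : hausdorff_space Q)
  (act_homeo : action_by_homeo act).
Local Notation fn := (arrow G Q -> R[i]).
Local Notation l2C := (l2_hilbert G (@C_hilbert R)).
Implicit Types (f k : fn) (q : Q) (F : {fset G}) (xi : l2C).
Local Notation val xi := (l2_fun (xi : l2 G C_hilbert)).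

Definition fibre_rep q f : {linear l2C -> l2C} := [the {linear l2C -> l2C} of gev regular q f].

Lemma fibre_rep_star q : star_rep act (fibre_rep q).
Proof. exact: (gev_star_rep act_homeo regular_grep). Qed.

Lemma fibre_repE q f F xi t : suppF F f ->
  val (fibre_rep q f xi) t = \sum_(g <- F) f (mk_arrow g q) * val xi (g^-1 * t)%g.
Proof.
move=> fF; rewrite /fibre_rep /= (gevE _ _ _ fF).
have evs (r : seq G) (z : G -> l2 G C_hilbert) : (\sum_(g <- r) z g) t = \sum_(g <- r) z g t.
  by elim: r => [|a r IH]; rewrite ?big_nil// !big_cons l2D IH.
by rewrite evs; apply: eq_bigr => g _; rewrite l2Z regularE.
Qed.

(** The slice of [f] over [q] as a vector of l^2(G), see [fibre_vecE]. It is the concrete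
    counterpart of the GNS vector of [f]: by [fibre_vec_ip] the inner products are the same. *)
Definition fibre_vec q f : l2C := fibre_rep q f (@delta R G C_hilbert (1 : R[i])).

Lemma fibre_vecE q f t : Cc act f -> val (fibre_vec q f) t = f (mk_arrow t q).
Proof.
move=> Cf; have [F fF] := Cc_supp Cf; rewrite (fibre_repE _ _ _ fF).
have e g : val (@delta R G C_hilbert (1 : R[i])) (g^-1 * t)%g = (g == t)%:R.
  rewrite /= /delta_fun; have -> : (g^-1 * t == 1 :> G)%g = (g == t).
    by rewrite -(inj_eq (mulgI g)) mulVKg mulg1 eq_sym.
  by case: eqP.
under eq_bigr do rewrite e.
have [tF|tF] := boolP (t \in F).
  rewrite (big_fsetD1 t)//= eqxx mulr1 big_seq big1 ?addr0// => g.
  by rewrite !inE => /andP[/negPf -> _]; rewrite mulr0.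
rewrite fF// big_seq big1// => g gF; case: eqP => [gt|]; last by rewrite mulr0.
by rewrite -gt gF in tF.
Qed.

Lemma fibre_vec_conv q f k : Cc act f -> Cc act k ->
  fibre_vec q (Defs.conv act f k) = fibre_rep q f (fibre_vec q k).
Proof. by move=> Cf Ck; rewrite /fibre_vec (repM (fibre_rep_star q)). Qed.

Lemma fibre_vec_ip q f k : Cc act f -> Cc act k ->
  ip (fibre_vec q f) (fibre_vec q k) = Defs.conv act (invol act k) f (unit_arrow q).
Proof.
move=> Cf Ck; have Ci := Cc_invol hQ act_homeo Ck; have Cc := Cc_conv hQ act_homeo Ci Cf.
rewrite [RHS](_ : _ = val (fibre_vec q (Defs.conv act (invol act k) f)) 1%g); last first.
  by rewrite fibre_vecE.
rewrite ip_conj /fibre_vec (rep_adj (fibre_rep_star q))// -ip_conj -(repM (fibre_rep_star q))//.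
by rewrite ip_delta C_ip1.
Qed.

Lemma fibre_rep_continuous q f : Cc act f -> continuous (fibre_rep q f).
Proof. by move=> Cf; case: (fibre_rep_star q) => c _ _ _; exact: c. Qed.

(** Each [g] in the stabilizer has a cutoff at [q] inside [fixint g]. So the slices of [Cc] over [q]
    exhaust the group algebra of the interior stabilizer. *)
Lemma finsupp_ext q (F : {fset G}) (x : G -> R[i]) :
  (forall g, x g != 0 -> int_stab act q g) -> (forall g, g \notin F -> x g = 0) ->
  exists2 k, Cc act k & forall g, k (mk_arrow g q) = x g.
Proof.
move=> xs xF.
have ex g : exists u : Q -> R, ccin (fixint act g) (fun q' => x g * (u q')%:C) /\ u q = 1.
  have [x0|/xs sg] := eqVneq (x g) 0.
    exists (fun=> 1); split=> //; rewrite x0 (_ : (fun=> _) = fun=> 0); first exact: ccin0.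
    by apply/funext => q'; rewrite mul0r.
  have [u [_ _ uc] u1] := cutoff_point (R := R) lcQ hQ (@open_fixint _ _ act g) sg.
  by exists u; split=> //; apply: ccinMl => //; exact: continuousC_cst.
pose u g := projT1 (cid (ex g)).
have uc g : ccin (fixint act g) (fun q' => x g * (u g q')%:C) := (projT2 (cid (ex g))).1.
have u1 g : u g q = 1 := (projT2 (cid (ex g))).2.
exists (fun c => \sum_(g <- F) sgl g (fun q' => x g * (u g q')%:C) c) => [|g].
  by apply: Cc_sum => // g; exact: Cc_sgl.
under eq_bigr do rewrite sglE u1 mulr1.
have [gF|gF] := boolP (g \in F); last first.
  rewrite xF// big_seq big1// => h hF; rewrite ifN//.
  by apply: contraNneq gF => ->.
rewrite (big_fsetD1 g)//= eqxx big_seq big1 ?addr0// => h.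
by rewrite !inE eq_sym => /andP[/negPf -> _].
Qed.

(* [G] is a disjoint union of right cosets of the interior stabilizer, and
   the fibre representation acts on each of them as on the stabilizer. *)
Lemma fibre_rep_le q f M : Cc act f -> 0 <= M ->
  (forall k, Cc act k -> nrm (fibre_rep q f (fibre_vec q k)) <= M * nrm (fibre_vec q k)) ->
  forall xi, nrm (fibre_rep q f xi) <= M * nrm xi.
Proof.
move=> Cf M0 HM xi; have [F fF] := Cc_supp Cf.
pose L := int_stab act q.
have L1 : L 1%g by exact: stab1.
have LM g h : L g -> L h -> L (g * h)%g by exact: stabM.
have LV g : L g -> L g^-1%g by exact: stabV.
(* Inversion turns representatives of left cosets into representatives of the right cosets [L t]. *)
pose c t := (coset_repr L t^-1)^-1%g.
have cP t : L (t * (c t)^-1)%g.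
  by rewrite /c invgK -[(t * _)%g]invgK invgM; apply: LV; exact: coset_reprP.
have cE s t : L (s * t^-1)%g -> c s = c t.
  move=> Lst; congr (_^-1)%g; apply: coset_repr_eq => //; rewrite invgK //.
apply: l2_nrm_le => [|D']; first by rewrite mulr_ge0 ?nrm_ge0.
(* The points where the value of [xi] enters the result on [D']. Below, [x r] is the part of [xi] on
   [D] in the coset of [r], moved into [L] by right translation, which commutes with the left
   action. *)
pose D := [fset (h^-1 * t)%g | h in F, t in D']%fset.
pose x r (g : G) : R[i] := if `[< L g >] && ((g * r)%g \in D) then val xi (g * r)%g else 0.
have ex r : exists2 k, Cc act k & forall g, k (mk_arrow g q) = x r g.
  apply: (@finsupp_ext q [fset (s * r^-1)%g | s in D]%fset).
    by move=> g; rewrite /x; case: asboolP => //=; rewrite eqxx.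
  move=> g gD; rewrite /x; case: asboolP => //= Lg; case: ifP => // gr.
  by move/negP: gD; case; apply/imfsetP; exists (g * r)%g => //; rewrite mulgK.
pose k r := projT1 (cid2 (ex r)).
have Ck r : Cc act (k r) by rewrite /k; case: cid2.
have kE r g : k r (mk_arrow g q) = x r g by rewrite /k; case: cid2 => k' ? /=.
have stepL r : \sum_(t <- D' | c t == r) nrm (val (fibre_rep q f xi) t) ^+ 2 <=
    nrm (fibre_rep q f (fibre_vec q (k r))) ^+ 2.
  pose D1 := [fset (t * r^-1)%g | t in [fset t in D' | c t == r]]%fset.
  apply: le_trans (l2_sqsum_le _ D1); rewrite /sqsum big_imfset /=; last first.
    by move=> s t _ _; exact: mulIg.
  rewrite -big_fset_condE /= big_seq_cond [leRHS]big_seq_cond.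
  apply: ler_sum => t /andP[tD' /eqP ct]; rewrite !(fibre_repE _ _ _ fF).
  rewrite le_eqVlt; apply/orP; left; apply/eqP; congr (nrm _ ^+ 2).
  rewrite big_seq [RHS]big_seq; apply: eq_bigr => h hF; rewrite fibre_vecE// kE.
  have [->|fh] := eqVneq (f (mk_arrow h q)) 0; first by rewrite !mul0r.
  have Lh : L h := Cc_stab Cf fh.
  rewrite /x; have -> : (h^-1 * (t * r^-1) * r)%g = (h^-1 * t)%g by rewrite -!mulgA mulVg mulg1.
  case: asboolP => [_|nL]; last by case: nL; apply: LM; [exact: LV|rewrite -ct; exact: cP].
  by rewrite ifT//; apply/imfset2P; exists h => //; exists t.
have stepR r : c r = r ->
    nrm (fibre_vec q (k r)) ^+ 2 <= \sum_(s <- D | c s == r) nrm (val xi s) ^+ 2.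
  move=> cr; rewrite l2_nrm_sq; apply: sqnorm_le => E.
  pose P g := `[< L g >] && ((g * r)%g \in D).
  pose E1 := [fset (g * r)%g | g in [fset g in E | P g]]%fset.
  apply: (@le_trans _ _ (sqsum (val xi) E1)).
    rewrite /sqsum big_imfset /=; last by move=> s t _ _; exact: mulIg.
    rewrite -big_fset_condE /= [leRHS]big_mkcond /=; apply: ler_sum => g _.
    by rewrite fibre_vecE// kE /x -/(P g); case: ifP => // _; rewrite nrm0 expr0n.
  rewrite big_fset_condE; apply: sqsum_mono; apply/fsubsetP => s /imfsetP[g /=].
  rewrite !inE /= => /andP[_ /andP[/asboolP Lg gr]] ->; rewrite gr /=.
  by apply/eqP; rewrite -[RHS]cr; apply: cE; rewrite mulgK.
pose C := [fset c t | t in D']%fset.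
have cC r : r \in C -> c r = r.
  move=> /imfsetP[t _ ->]; apply: cE.
  by rewrite -[(c t * _)%g]invgK invgM invgK; exact/LV/cP.
apply: (@le_trans _ _ (M ^+ 2 * sqsum (val xi) D)); last first.
  by rewrite exprMn ler_wpM2l ?exprn_ge0//; exact: (l2_sqsum_le (xi : l2 G C_hilbert)).
(* The finite sum over [D'] is split along the right cosets it meets; on each, the hypothesis is
   applied to the slice [k r]. *)
rewrite /sqsum (partition_big_imfset _ c)/= -/C.
apply: (@le_trans _ _ (M ^+ 2 * \sum_(r <- C) \sum_(s <- D | c s == r) nrm (val xi s) ^+ 2)).
  rewrite mulr_sumr big_seq [leRHS]big_seq; apply: ler_sum => r rC.
  rewrite (le_trans (stepL r))// (le_trans _ (ler_wpM2l _ (stepR r (cC r rC)))) ?exprn_ge0//.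
  by rewrite -exprMn ler_pXn2r ?nnegrE ?mulr_ge0 ?nrm_ge0// HM.
rewrite ler_wpM2l ?exprn_ge0//.
rewrite (exchange_big_dep predT)//=; apply: ler_sum => s _; rewrite [leLHS]big_mkcond /=.
have [sC|sC] := boolP (c s \in C).
  rewrite (big_fsetD1 (c s))//= eqxx big_seq big1 ?addr0// => r.
  by rewrite !inE eq_sym => /andP[/negPf -> _].
rewrite big_seq big1 ?exprn_ge0 ?nrm_ge0// => r rC.
by case: eqP => // sr; rewrite sr rC in sC.
Qed.

End RegularFibre.

(** * Continuity of the reduced fibre norms and their coincidence *)

Section ReducedFibres.
Context {R : realType} {G : groupType} {Q : topologicalType} {act : G -> Q -> Q}.
Hypotheses (lcQ : locally_compact [set: Q]) (hQ : hausdorff_space Q)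
  (act_homeo : action_by_homeo act).
Variables (A : fullCstar R act) (E : condExp A) (B : redCstar E).
Variable S : forall q : Q, gns (ev_exp B q).
Local Notation fn := (arrow G Q -> R[i]).
Local Notation l2C := (l2_hilbert G (@C_hilbert R)).
Local Notation remb := (red_emb B).
Local Notation v q := (gns_vec (S q)).
Local Notation T q := (gns_rep (S q)).
Local Notation val xi := (l2_fun (xi : l2 G C_hilbert)).
Implicit Types (f k : fn) (q : Q) (F : {fset G}) (b : B) (xi : l2C).

Lemma v_nrm q f : Cc act f -> nrm (v q (remb f)) = nrm (fibre_vec q f).
Proof.
move=> Cf; apply/eqP; rewrite -(@eqrXn2 _ 2)// ?nrm_ge0// -!Re_ip.
rewrite (fibre_vec_ip hQ act_homeo _ Cf Cf) v_ip -rembJ// -rembM//; last exact: Cc_invol.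
rewrite /red_emb red_exp_proj cexp_restr//.
by apply: Cc_conv => //; exact: Cc_invol.
Qed.

Lemma T_v_nrm q f k : Cc act f -> Cc act k ->
  nrm (T q (remb f) (v q (remb k))) = nrm (fibre_rep q f (fibre_vec q k)).
Proof.
move=> Cf Ck; rewrite T_v -rembM// v_nrm ?(fibre_vec_conv act_homeo)//.
exact: Cc_conv.
Qed.

(** GNS vectors correspond isometrically to slices over [q], which intertwines the two actions but
    reaches only functions supported on the stabilizer; [fibre_rep_le] extends the bound to all of
    l^2(G). *)
Lemma p_Ered_fibre q f : Cc act f -> p_Ered (S q) (remb f) = opnorm (fibre_rep q f).
Proof.
move=> Cf; have cT : continuous (T q (remb f)) by exact: gns_rep_continuous.
have cr : continuous (fibre_rep q f) by exact: (fibre_rep_continuous act_homeo).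
apply/eqP; rewrite eq_le; apply/andP; split.
  apply: opnorm_le; first exact: opnorm_ge0.
  apply: T_dense_le => [|k Ck]; first exact: opnorm_ge0.
  by rewrite T_v_nrm// v_nrm//; exact: opnormP.
apply: opnorm_le; first exact: opnorm_ge0.
apply: (fibre_rep_le lcQ hQ act_homeo Cf) => [|k Ck]; first exact: opnorm_ge0.
by rewrite -T_v_nrm// -v_nrm//; exact: opnormP.
Qed.

(** The reduced norm tests only vectors supported on the stabilizer. Normalized slices are such
    vectors, and [fibre_rep_le] shows that they suffice for the operator norm on l^2(G). *)
Lemma opnorm_norm_red q f (x : G -> R[i]) : Cc act f ->
  (forall g, f (mk_arrow g q) = x g) -> opnorm (fibre_rep q f) = norm_red (int_stab act q) x.
Proof.
move=> Cf fx; have [F fF] := Cc_supp Cf.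
have cr : continuous (fibre_rep q f) by exact: (fibre_rep_continuous act_homeo).
have xF g : g \notin F -> x g = 0 by move=> gF; rewrite -fx fF.
have lr (xi : l2C) : left_regular x (val xi) = val (fibre_rep q f xi) :> (G -> R[i]).
  apply/funext => g; rewrite (fibre_repE _ _ _ fF) /left_regular (@fsbig_supp_fset _ _ F).
    by apply: eq_bigr => h _; rewrite fx.
  by move=> h /xF ->; rewrite mul0r.
have lrn (xi : l2C) : Num.sqrt (fine (l2sq (left_regular x (val xi)))) = nrm (fibre_rep q f xi).
  by rewrite lr l2sqE /= sqrtr_sqr ger0_norm ?nrm_ge0.
rewrite /norm_red; set N := [set _ | _ in _].
have ubN : ubound N (opnorm (fibre_rep q f)).
  move=> _ [y /= [_ y1] <-]; have [xi xi1 <-] := l2sq_le1 y1.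
  by rewrite lrn opnorm_ge.
have N0 : N !=set0.
  exists (nrm (fibre_rep q f 0)), (val (0 : l2C)); last by rewrite lrn.
  by split=> // ; rewrite l2sqE nrm0 expr0n lee_fin.
have sN : 0 <= sup N.
  have [y Ny] := N0; apply: le_trans (ub_le_sup _ Ny); last by exists (opnorm (fibre_rep q f)).
  by case: Ny => z _ <-; exact: sqrtr_ge0.
apply/eqP; rewrite eq_le; apply/andP; split; last exact: ge_sup.
apply: opnorm_le => //; apply: (fibre_rep_le lcQ hQ act_homeo Cf) => // k Ck.
set y := fibre_vec q k; have [y0|y0] := eqVneq (nrm y) 0.
  by rewrite (nrm_eq0 y0) linear0 nrm0 mulr0.
have yp : 0 < nrm y by rewrite lt_neqAle eq_sym y0 nrm_ge0.
rewrite -ler_pdivrMr//; have cc : cmod ((nrm y)^-1%:C : R[i]) = (nrm y)^-1.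
  by rewrite cmodR ger0_norm// invr_ge0 ltW.
apply: ub_le_sup; first by exists (opnorm (fibre_rep q f)).
exists (val ((nrm y)^-1%:C *: y)); last by rewrite lrn linearZ nrmZ cc mulrC.
split=> [g ng|]; last by rewrite l2sqE nrmZ cc mulVf// expr1n lee_fin.
rewrite l2Z (fibre_vecE _ _ Ck) (Cc_nstab Ck ng); exact: scaler0.
Qed.

(** On a GNS vector, multiplication by [h] changes the slice over [q] only by the factor [h q]. *)
Lemma T_units q h x : Cc_space h -> T q (remb (extend_units h)) x = h q *: x.
Proof.
move=> Ch; have Ce := Cc_units hQ act_homeo Ch.
have h1 : ccin (fixint act 1%g) h by apply: (ccin_fix1 act_homeo); apply/(ccin_Cc hQ).
move: x; apply: (@T_ext _ _ _ _ _ _ _ S q _ _ (fun x => h q *: x)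
  (nrm (remb (extend_units h))) (cmod (h q))).
- by apply: T_lip => y; exact: (T_le lcQ hQ act_homeo).
- by move=> x y; rewrite -scalerBr nrmZ.
move=> k Ck; have Cek := Cc_conv hQ act_homeo Ce Ck.
apply/eqP; rewrite -subr_eq0; apply/eqP/nrm_eq0.
rewrite T_v -rembM// -linearZ -linearB addrC -scaleNr -remb_lin// v_nrm; last exact: Cc_lincomb.
rewrite (_ : fibre_vec _ _ = 0) ?nrm0//; apply: l2_ext => g.
rewrite (@fibre_vecE _ _ _ act); last exact: Cc_lincomb.
rewrite /lincomb extend_unitsE conv_sgll//= /lbl /src /= invg1 mul1g mulNr addNr.
by [].
Qed.

Lemma p_Ered_le q b : p_Ered (S q) b <= nrm b.
Proof. by apply: opnorm_le => [|x]; [exact: nrm_ge0|exact: (T_le lcQ hQ act_homeo)]. Qed.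

Lemma p_EredD q b c : p_Ered (S q) (b + c) <= p_Ered (S q) b + p_Ered (S q) c.
Proof.
have c0 b' : continuous (T q b') by exact: gns_rep_continuous.
apply: opnorm_le => [|x]; first by rewrite addr_ge0// opnorm_ge0.
by rewrite (crepD (T_crep lcQ hQ act_homeo S q)) (le_trans (nrmD _ _))// mulrDl lerD// opnormP.
Qed.

Lemma p_Ered_dist q b c : p_Ered (S q) b <= p_Ered (S q) c + nrm (b - c).
Proof. by rewrite -{1}(subrK c b) addrC (le_trans (p_EredD _ _ _))// lerD2l p_Ered_le. Qed.

Lemma opnorm_fibre_near F f q q0 : Cc act f -> suppF F f ->
  opnorm (fibre_rep q0 f) <= opnorm (fibre_rep q f)
    + \sum_(g <- F) cmod (f (mk_arrow g q0) - f (mk_arrow g q)).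
Proof.
move=> Cf fF; have cr q' : continuous (fibre_rep q' f) by exact: (fibre_rep_continuous act_homeo).
apply: opnorm_le => [|x].
  by rewrite addr_ge0 ?opnorm_ge0// sumr_ge0// => g _; exact: cmod_ge0.
rewrite -(subrK (fibre_rep q f x) (fibre_rep q0 f x)) (le_trans (nrmD _ _))// addrC mulrDl.
rewrite lerD ?opnormP// /fibre_rep /= !(gevE _ _ _ fF) -sumrB (le_trans (nrm_sum _ _ _))//.
rewrite mulr_suml; apply: ler_sum => g _; rewrite -scalerBl nrmZ ler_wpM2l ?cmod_ge0//.
exact: (grep_le regular_grep).
Qed.

Lemma p_Ered_continuous b : continuous (fun q => p_Ered (S q) b).
Proof.
move=> q0; apply/cvg_real => e e0.
have e3 : 0 < e / 3 by rewrite divr_gt0.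
have [f Cf bf] := remb_approx b e3.
have [F fF] := Cc_supp Cf.
pose s q := \sum_(g <- F) cmod (f (mk_arrow g q0) - f (mk_arrow g q)).
apply: filterS (near_variation F q0 Cf e3) => q Sq.
have h1 := opnorm_fibre_near q q0 Cf fF; have h2 := opnorm_fibre_near q0 q Cf fF.
have Sym : \sum_(g <- F) cmod (f (mk_arrow g q) - f (mk_arrow g q0)) = s q.
  by apply: eq_bigr => g _; rewrite cmodBC.
rewrite Sym in h2; rewrite -/(s q) in h1 Sq; rewrite -!p_Ered_fibre// in h1 h2.
have d1 := p_Ered_dist q0 b (remb f); have d2 := p_Ered_dist q0 (remb f) b.
have d3 := p_Ered_dist q b (remb f); have d4 := p_Ered_dist q (remb f) b.
rewrite [nrm (remb f - b)]nrmBC in d2 d4.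
by rewrite ler_norml; apply/andP; split; lra.
Qed.

Lemma p_Ered_le_other q b : p_Ered (S q) b <= p_other q b.
Proof.
have TP := T_crep lcQ hQ act_homeo S q.
apply: p_fibre_ge => j Jj; apply: opnorm_le => [|x]; first exact: nrm_ge0.
have Tj : T q j x = 0.
  apply: (crep_fibre_ideal TP) Jj x => h y Ch.
  by rewrite T_units// nrmZ.
by rewrite -[T q b x]addr0 -Tj -(crepD TP) (T_le lcQ hQ act_homeo).
Qed.

Lemma p_other_emb_le q0 f : Cc act f -> p_other q0 (remb f) <= p_Ered (S q0) (remb f).
Proof.
move=> Cf; apply/ler_addgt0Pr => e e0; set p := p_Ered (S q0) (remb f).
have p0 : 0 <= p by apply: opnorm_ge0; exact: gns_rep_continuous.
pose O := interior [set q | p_Ered (S q) (remb f) <= p + e].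
have oO : open O by exact: open_interior.
have Oq0 : O q0.
  have : {for q0, continuous (fun q => p_Ered (S q) (remb f))} by exact: p_Ered_continuous.
  move=> /cvg_real/(_ _ e0); apply: filterS => q; rewrite ler_norml => /andP[+ _].
  by rewrite lerNl opprB lerBlDl.
have [u uO uq0] := cutoff_point (R := R) lcQ hQ oO Oq0.
have uT : cutoff setT u by have [cu u01 uc] := uO; split=> //; exact: ccin_mono uc.
pose h q := (u q)%:C : R[i].
have Ch : Cc_space h by apply/(ccin_Cc hQ); case: uT.
have Ce := Cc_units hQ act_homeo Ch.
have Jj : fibre_ideal remb q0 (remb (mulu u f) - remb f).
  apply: (fibre_ideal_cutoff lcQ hQ act_homeo) => // [t k k'|k k']; first exact: remb_lin.
  exact: rembM.
rewrite (le_trans (p_fibre_le (remb f) Jj))// addrC subrK (muluE hQ act_homeo Cf uT) -/h -extend_unitsE rembM//.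
apply: (red_norm_le lcQ hQ act_homeo (S := S)) => [|q x]; first by rewrite addr_ge0// ltW.
rewrite (crepM (T_crep lcQ hQ act_homeo S q)) T_units// nrmZ.
have [_ u01 [_ [K [_ KO hK]]]] := uO; have /andP[u0 u1] := u01 q.
have [uq|uq] := eqVneq (h q) 0.
  by rewrite uq cmod0 mul0r mulr_ge0 ?nrm_ge0// addr_ge0// ltW.
have Oq : p_Ered (S q) (remb f) <= p + e by have := interior_subset (KO _ (hK _ uq)).
rewrite /h cmodR ger0_norm//; apply: le_trans (ler_wpM2r (nrm_ge0 x) Oq).
apply: (@le_trans _ _ (nrm (T q (remb f) x))); first by rewrite ler_piMl ?nrm_ge0.
by apply: opnormP; exact: gns_rep_continuous.
Qed.

Lemma p_otherE q b : p_other q b = p_Ered (S q) b.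
Proof.
apply/eqP; rewrite eq_le p_Ered_le_other andbT; apply/ler_addgt0Pr => e e0.
have e2 : 0 < e / 2 by rewrite divr_gt0.
have [f Cf bf] := remb_approx b e2.
have d1 := p_fibre_dist remb q b (remb f).
have d2 := p_Ered_dist q (remb f) b; have d3 := p_other_emb_le q Cf.
by rewrite [nrm (remb f - b)]nrmBC in d2; rewrite /p_other in d3 *; lra.
Qed.

(** [finsupp_ext] ensures that [xget] returns a true extension rather than its default. Which one
    does not matter, since the reduced norm only sees the slice over [q], and that slice vanishes
    off the stabilizer as [x] does. *)
Lemma norm_otherE q (x : G -> R[i]) : group_algebra (int_stab act q) x ->
  norm_other B q x = norm_red (int_stab act q) x.
Proof.
move=> [finx xs]; rewrite /norm_other.
case: xgetP => [f _ [Cf fx]|/= nex].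
  rewrite p_otherE p_Ered_fibre//; apply: opnorm_norm_red => // g.
  have [sg|ng] := pselect (int_stab act q g); first by apply: fx; exact/IntIsoE.
  rewrite (Cc_nstab Cf ng); apply/esym/eqP; apply: contra_notT ng; exact: xs.
have xF g : g \notin fset_set [set g | x g != 0] -> x g = 0.
  by rewrite in_fset_set// notin_setE /= => /negP/negPn/eqP.
have [k Ck kx] := finsupp_ext lcQ hQ xs xF.
by case: (nex k); split=> // g _; exact: kx.
Qed.

End ReducedFibres.

Theorem theorem8p6 (R : realType) (G : groupType) (Q : topologicalType)
  (act : G -> Q -> Q)
  (G_countable : countable [set: G])
  (Q_second_countable : @second_countable Q)
  (Q_locally_compact : locally_compact [set: Q])
  (Q_hausdorff : hausdorff_space Q)
  (act_homeo : action_by_homeo act)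
  (A : fullCstar R act) (E : condExp A) (B : redCstar E)
  (S : forall q : Q, gns (ev_exp B q)) :
  (forall a : A, continuous (fun q : Q => p_full q a)) /\
  [/\ (forall b : B, continuous (fun q : Q => p_Ered (S q) b)),
      (forall (q : Q) (b : B), p_other q b = p_Ered (S q) b)
    & (forall (q : Q) (x : G -> R[i]),
         group_algebra (int_stab act q) x ->
         norm_other B q x = norm_red (int_stab act q) x)].
Proof.
split; first exact: p_full_continuous.
split; [exact: p_Ered_continuous|exact: p_otherE|exact: norm_otherE].
Qed.
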